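(* Let $f:M\to M$ be a partially hyperbolic diffeomorphism of a compact manifold $M$ (of any dimension). If $f$ is center bunched and the distributions $E^{cs}=E^s\oplus E^c$ and $E^{cu}=E^u\oplus E^c$ are Lipschitz, then $f$ is dynamically coherent.
   Context: A $C^1$ diffeomorphism $f$ of a compact manifold $M$ is partially hyperbolic if there is a nontrivial splitting $TM = E^s\oplus E^c\oplus E^u$ invariant under $Df$ (each of the three subbundles is nonzero), and there is a Riemannian metric on $M$ for which one can choose continuous positive functions $\nu,\hat\nu,\gamma,\hat\gamma: M\to\mathbb{R}$ with $\nu,\hat\nu<1$ and $\nu<\gamma<\hat\gamma^{-1}<\hat\nu^{-1}$ such that for every $p \in M$ and every unit vector $v\in T_pM$: $\|Df(v)\|<\nu(p)$ if $v\in E^s(p)$; $\gamma(p)<\|Df(v)\|<\hat\gamma(p)^{-1}$ if $v\in E^c(p)$; $\hat\nu(p)^{-1}<\|Df(v)\|$ if $v\in E^u(p)$. Such an $f$ is center bunched if (for these functions) $\hat\nu(p)<\hat\gamma(p)^2$ and $\nu(p)<\gamma(p)^2$ for every $p\in M$. $f$ is dynamically coherent if there exist $f$-invariant $C^0$ foliations $\mathcal{F}^{cs}$ and $\mathcal{F}^{cu}$ tangent to $E^{cs}$ and $E^{cu}$ respectively. *)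

(* Defs.v *)
From HB Require Import structures.
From mathcomp Require Import all_boot all_order all_algebra.
From mathcomp Require Import all_classical all_reals all_analysis.

Set Implicit Arguments.
Unset Strict Implicit.
Unset Printing Implicit Defensive.

Import Order.TTheory GRing.Theory Num.Theory.
Import numFieldNormedType.Exports.

Local Open Scope classical_set_scope.
Local Open Scope ring_scope.

(* For an open set [U]; 'D_v f is the function x |-> d/dt f (x + t v) at 0. *)
Fixpoint Ck (R : realType) (k : nat) (V W : normedModType R)
    (f : V -> W) (U : set V) : Prop :=
  match k with
  | 0 => forall x, U x -> {for x, continuous f}
  | k'.+1 => (forall x, U x -> differentiable f x) /\
             forall v, Ck k' ('D_v f) U
  end.

(* A homeomorphism from an open subset of [M] onto an open subset of R^n.
   The values of [chart_fun] and [chart_inv] outside these open sets are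
   irrelevant. *)
Record chart (R : realType) (n : nat) (M : topologicalType) := Chart {
  chart_dom : set M;
  chart_fun :> M -> 'rV[R]_n;
  chart_inv : 'rV[R]_n -> M;
  chart_dom_open : open chart_dom;
  chart_cod_open : open (chart_fun @` chart_dom);
  chart_funK : forall p, chart_dom p -> chart_inv (chart_fun p) = p;
  chart_fun_cont : forall p, chart_dom p -> {for p, continuous chart_fun};
  chart_inv_cont : forall x, (chart_fun @` chart_dom) x ->
    {for x, continuous chart_inv}
}.

Definition Ck_transition (R : realType) (n k : nat) (M : topologicalType)
    (B C : chart R n M) : Prop :=
  Ck k (C \o chart_inv B) (B @` (chart_dom B `&` chart_dom C)).

(* A C^oo structure without boundary on [M], given by an atlas indexed by the
   points of [M].  The chart at [p] identifies the tangent space T_pM with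
   R^n: below, a tangent vector at [p] is a row vector, understood in the
   coordinates of [chart_at A p]. *)
Record smooth_atlas (R : realType) (n : nat) (M : topologicalType) := Atlas {
  chart_at : M -> chart R n M;
  chart_at_dom : forall p, chart_dom (chart_at p) p;
  chart_at_smooth : forall k p q, Ck_transition k (chart_at p) (chart_at q)
}.

Section Manifold.
Variables (R : realType) (n : nat) (M : topologicalType).
Variable A : smooth_atlas R n M.

Implicit Types (E : M -> {vspace 'rV[R]_n}) (B : chart R n M) (S : set M).

(* The differential at [p] of the chart [B], as a map T_pM -> R^n. *)
Definition dchart B (p : M) : {linear 'rV[R]_n -> 'rV[R]_n} :=
  'd (B \o chart_inv (chart_at A p)) (chart_at A p p).

(* The inverse map: the tangent vector at [p] with given coordinates in [B]. *)
Definition dchart_inv B (p : M) : {linear 'rV[R]_n -> 'rV[R]_n} :=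
  'd (chart_at A p \o chart_inv B) (B p).

Definition C1_map (f : M -> M) : Prop :=
  continuous f /\
  forall p q, Ck 1 (chart_at A q \o f \o chart_inv (chart_at A p))
    (chart_at A p @`
       (chart_dom (chart_at A p) `&` f @^-1` chart_dom (chart_at A q))).

Definition C1_diffeo (f : M -> M) : Prop :=
  exists f' : M -> M, [/\ cancel f f', cancel f' f, C1_map f & C1_map f'].

(* D_p f : T_pM -> T_(f p)M *)
Definition Df (f : M -> M) (p : M) : {linear 'rV[R]_n -> 'rV[R]_n} :=
  'd (chart_at A (f p) \o f \o chart_inv (chart_at A p)) (chart_at A p p).

Definition inner (g : M -> 'M[R]_n) (p : M) (v w : 'rV[R]_n) : R :=
  (v *m g p *m w^T) 0 0.

Definition gnorm (g : M -> 'M[R]_n) (p : M) (v : 'rV[R]_n) : R :=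
  Num.sqrt (inner g p v v).

(* [g p] is the Gram matrix of an inner product on T_pM; smoothness is that of
   the coefficients of the metric in every chart of the atlas. *)
Definition riemannian_metric (g : M -> 'M[R]_n) : Prop :=
  [/\ forall p, (g p)^T = g p,
      forall p v, v != 0 -> 0 < inner g p v v &
      forall k p0 v w, let B := chart_at A p0 in
        Ck k (fun x => let p := chart_inv B x in
                inner g p (dchart_inv B p v) (dchart_inv B p w))
             (B @` chart_dom B)].

(* [E] has locally, in charts, a frame of [k] vector fields whose coordinate
   expressions have the regularity [P]. *)
Definition has_local_frames
    (P : set 'rV[R]_n -> ('rV[R]_n -> 'rV[R]_n) -> Prop) (k : nat) E : Prop :=
  forall p0, let B := chart_at A p0 in
  exists (U : set M) (X : 'I_k -> 'rV[R]_n -> 'rV[R]_n),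
    [/\ open U, U p0, U `<=` chart_dom B,
        forall i, P (B @` U) (X i) &
        forall p, U p ->
          basis_of (E p) [seq dchart_inv B p (X i (B p)) | i <- enum 'I_k]].

Definition subbundle E : Prop :=
  exists k, has_local_frames
    (fun U X => forall x, U x -> {for x, continuous X}) k E.

Definition lipschitz_distribution E : Prop :=
  exists k, has_local_frames (fun U X => [lipschitz X x | x in U]) k E.

Definition invariant_distribution (f : M -> M) E : Prop :=
  forall p, (linfun (Df f p) @: E p)%VS = E (f p).

Definition dsum (E1 E2 : M -> {vspace 'rV[R]_n}) (p : M) : {vspace 'rV[R]_n} :=
  (E1 p + E2 p)%VS.

Definition invariant_splitting (f : M -> M)
    (Es Ec Eu : M -> {vspace 'rV[R]_n}) : Prop :=
  [/\ [/\ subbundle Es, subbundle Ec & subbundle Eu],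
      forall p, [/\ Es p != 0%VS, Ec p != 0%VS & Eu p != 0%VS],
      forall p, (Es p + Ec p + Eu p)%VS = fullv /\
                directv (Es p + Ec p + Eu p) &
      [/\ invariant_distribution f Es, invariant_distribution f Ec &
          invariant_distribution f Eu]].

Definition partially_hyperbolic (f : M -> M)
    (Es Ec Eu : M -> {vspace 'rV[R]_n}) (g : M -> 'M[R]_n)
    (nu nuh gam gamh : M -> R) : Prop :=
  [/\ C1_diffeo f, invariant_splitting f Es Ec Eu, riemannian_metric g,
      [/\ continuous nu, continuous nuh, continuous gam & continuous gamh] &
      forall p,
        [/\ [/\ 0 < nu p, 0 < nuh p, 0 < gam p & 0 < gamh p],
            nu p < 1 /\ nuh p < 1,
            [/\ nu p < gam p, gam p < (gamh p)^-1 &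
                (gamh p)^-1 < (nuh p)^-1] &
            forall v, gnorm g p v = 1 ->
              [/\ v \in Es p -> gnorm g (f p) (Df f p v) < nu p,
                  v \in Ec p -> gam p < gnorm g (f p) (Df f p v) /\
                                gnorm g (f p) (Df f p v) < (gamh p)^-1 &
                  v \in Eu p -> (nuh p)^-1 < gnorm g (f p) (Df f p v)]]].

Definition center_bunched (nu nuh gam gamh : M -> R) : Prop :=
  forall p, nuh p < gamh p ^+ 2 /\ nu p < gam p ^+ 2.

(* In R^n = R^d x R^(n-d), the points with the same R^(n-d) component as [y] *)
Definition slice (d : nat) (y : 'rV[R]_n) : set 'rV[R]_n :=
  [set x | forall j : 'I_n, (d <= j)%N -> x 0 j = y 0 j].

Definition plaque (d : nat) B (q : M) : set M :=
  chart_dom B `&` B @^-1` slice d (B q).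

(* [F p] is the leaf through [p].  The norm of 'rV[R]_n is the sup norm, hence
   a foliation box is onto the open cube ]-1, 1[^n. *)
Definition foliation_box (d : nat) (F : M -> set M) B : Prop :=
  B @` chart_dom B = ball (0 : 'rV[R]_n) 1 /\
  forall q, chart_dom B q ->
    connected_component (F q `&` chart_dom B) q = plaque d B q.

Definition path_connected S : Prop :=
  forall p q, S p -> S q ->
  exists c : R -> M, [/\ {within `[0, 1], continuous c}, c 0 = p, c 1 = q &
                         c @` `[0, 1] `<=` S].

(* A C^0 foliation: a partition into path-connected leaves which, inside
   suitable boxes around each point, have the plaques as components. *)
Definition foliation (d : nat) (F : M -> set M) : Prop :=
  [/\ (d <= n)%N,
      forall p, F p p,
      forall p q, F p q -> F q = F p,
      forall p, path_connected (F p) &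
      forall p, exists2 B, chart_dom B p & foliation_box d F B].

Definition C1_chart B : Prop :=
  forall p, Ck_transition 1 (chart_at A p) B /\
            Ck_transition 1 B (chart_at A p).

(* [S] is an embedded C^1 submanifold of dimension [d] (there are slice charts
   around its points) with T_qS = E q for every q in [S]. *)
Definition C1_submanifold_tangent (d : nat) S E : Prop :=
  forall q0, S q0 -> exists B,
    [/\ chart_dom B q0, C1_chart B,
        S `&` chart_dom B = chart_dom B `&` B @^-1` slice d 0 &
        forall q, (S `&` chart_dom B) q ->
          forall v, v \in E q <-> slice d 0 (dchart B q v)].

Definition foliation_tangent (d : nat) (F : M -> set M) E : Prop :=
  forall p, exists B,
    [/\ chart_dom B p, foliation_box d F B &
        forall q, chart_dom B q ->
          C1_submanifold_tangent d (plaque d B q) E].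

Definition invariant_foliation (f : M -> M) (F : M -> set M) : Prop :=
  forall p, f @` F p = F (f p).

Definition integrates_to_invariant_foliation (f : M -> M) E : Prop :=
  exists d F, [/\ foliation d F, foliation_tangent d F E &
                  invariant_foliation f F].

Definition dynamically_coherent (f : M -> M)
    (Es Ec Eu : M -> {vspace 'rV[R]_n}) : Prop :=
  integrates_to_invariant_foliation f (dsum Es Ec) /\
  integrates_to_invariant_foliation f (dsum Eu Ec).

End Manifold.

(* Main.v *)
(** In charts the Lipschitz distribution E = E^s + E^c is spanned by lifts X_q(v) of
    the vectors v of a fixed plane, and the flows of the fields q |-> X_q(v) serve
    as candidate leaf coordinates.  Lipschitz regularity alone shows that a path
    tangent to E, of speed at most e and with end points at distance O(e^2), has a
    transverse (E^u) displacement at most C e^2.  The map f multiplies the speed by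
    at most 1/gamh and the transverse displacement by at least 1/nuh, so the bound
    C at f p gives the bound lam C at p as soon as lam > nuh / gamh^2.  By center
    bunching and compactness some lam < 1 works everywhere, hence every C > 0 is
    admissible.

    Thus small quadrilaterals of flow lines close up to o(e^2).  Cutting a thin
    triangle into such quadrilaterals shows that x |-> flow_x(c) is C^1 with image
    tangent to E, and that tangent curves stay in these plaques.  A leaf is the set
    of points joined to a given one by curves tangent to E, which makes invariance
    under f clear.  A leaf meets a box in countably many plaques (each is reached
    through points with rational coordinates), and a connected countable set of
    transverse coordinates is a point, so components are plaques.  For E^u + E^c
    the same argument applies to the inverse of f. *)

From HB Require Import structures.
From mathcomp Require Import all_boot all_order all_algebra.
From mathcomp Require Import all_classical all_reals all_analysis.
From mathcomp Require Import ring lra.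
Require Import Defs.

Set Implicit Arguments.
Unset Strict Implicit.
Unset Printing Implicit Defensive.

Import Order.TTheory GRing.Theory Num.Theory.
Import numFieldNormedType.Exports.

Local Open Scope classical_set_scope.
Local Open Scope ring_scope.

(** The plane field is not differentiable, so it has no Lie brackets, and [f] is only C^1, so there
    is no second-order control of its iterates. The bound [C e^2] still passes through first-order
    data: when the ends of a path are [O(e^2)] apart, strict differentiability replaces [f] by its
    linear part with an error [o(1) * O(e^2) = o(e^2)]; without the condition on the ends this error
    would only be [o(e)]. The implicit constant of that condition changes under [f], so [C] must not
    depend on it, whereas the admissible radius may. The radius also shrinks at each iteration,
    which is harmless because only germs are iterated; uniformity in the base point is recovered
    afterwards by compactness of a ball in a chart. A loop of four flow lines whose base vectors sum
    to zero has no displacement along the base, so Lipschitz regularity already places its ends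
    [O(e^2)] apart, and the germ bound improves this to [o(e^2)]. The dependence of the flows on the
    transverse parameter is only controlled up to Lipschitz order: foliation boxes are merely
    continuous, and each plaque receives a C^1 chart of its own. *)

Section Norms.
Variables (R : realType) (n : nat).
Implicit Types v w : 'rV[R]_n.

Lemma coord_le_norm v i : `|v 0 i| <= `|v|.
Proof.
rewrite [leRHS]/Num.Def.normr /= mx_normrE.
exact: (le_bigmax _ (fun ij : 'I_1 * 'I_n => `|v ij.1 ij.2|) (0, i)).
Qed.

Lemma norm_le_coord v k : 0 <= k -> (forall i, `|v 0 i| <= k) -> `|v| <= k.
Proof.
move=> k0 vk; rewrite [leLHS]/Num.Def.normr /= mx_normrE.
by apply: bigmax_le => // -[i j] _ /=; rewrite (ord1 i).
Qed.

Lemma le_of_geometric (x y C : R) :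
  (forall k, x <= y + C / 2 ^+ k) -> x <= y.
Proof.
move=> H; apply/ler_addgt0Pr => e e0.
have [C0|C0] := leP C 0.
  by have := H 0%N; rewrite expr0 divr1; lra.
have /= [k] := ltr_add_invr (divr_gt0 e0 C0).
rewrite add0r => kH; apply: le_trans (H k) _; rewrite lerD2l.
rewrite ler_pdivrMr ?exprn_gt0//.
have k2 : k.+1%:R <= 2 ^+ k :> R.
  by rewrite -natrX ler_nat ltn_expl.
have : C < e * k.+1%:R.
  by move: kH; rewrite ltr_pdivlMr// mulrC ltr_pdivrMr ?ltr0n.
by move=> /ltW /le_trans; apply; rewrite ler_pM2l.
Qed.

(** The intervals of radius [2 * B / 2 ^+ k] about [u k] are nested, and the supremum of their left
    ends lies in all of them. *)
Lemma geometric_limit (u : nat -> R) (B : R) :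
  (forall k, `|u k.+1 - u k| <= B / 2 ^+ k) ->
  exists l, forall k, `|u k - l| <= 2 * B / 2 ^+ k.
Proof.
move=> uB.
pose a k := u k - 2 * B / 2 ^+ k; pose b k := u k + 2 * B / 2 ^+ k.
have B0 : 0 <= B by have := uB 0%N; rewrite expr0 divr1; apply: le_trans.
have half k : B / 2 ^+ k = 2 * (B / 2 ^+ k.+1).
  by rewrite exprS invfM; field.
have aS k : a k <= a k.+1.
  have := uB k; rewrite ler_norml /a => /andP[H _].
  by have := half k; rewrite -!mulrA; lra.
have bS k : b k.+1 <= b k.
  have := uB k; rewrite ler_norml /b => /andP[_ H].
  by have := half k; rewrite -!mulrA; lra.
have ab k : a k <= b k.
  by rewrite /a /b lerD2l; apply: (@le_trans _ _ 0);
    [rewrite oppr_le0|]; rewrite divr_ge0 ?mulr_ge0 ?exprn_ge0.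
have am : {homo a : i j / (i <= j)%N >-> i <= j} by apply: homo_leq => //; exact: le_trans.
have bm : {homo b : i j / (i <= j)%N >-> j <= i}.
  apply: (@homo_leq _ b (fun x y => y <= x)) => // y x z H1 H2; exact: le_trans H2 H1.
have abjk j k : a j <= b k.
  have [/am H|/ltnW/bm H] := leqP j k; first exact: le_trans H (ab k).
  exact: le_trans (ab j) H.
have hs : has_sup (range a).
  by split; [exists (a 0%N), 0%N|exists (b 0%N) => _ [j _ <-]].
exists (sup (range a)) => k.
have H1 : a k <= sup (range a) by apply: sup_upper_bound => //; exists k.
have H2 : sup (range a) <= b k.
  by apply: ge_sup => [|_ [j _ <-]]; [exists (a 0%N), 0%N|].
by rewrite ler_norml; move: H1 H2; rewrite /a /b; lra.
Qed.

Lemma geometric_limit_rV (u : nat -> 'rV[R]_n) (B : R) :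
  (forall k, `|u k.+1 - u k| <= B / 2 ^+ k) ->
  exists l, forall k, `|u k - l| <= 2 * B / 2 ^+ k.
Proof.
move=> uB.
have B0 : 0 <= B by have := uB 0%N; rewrite expr0 divr1; apply: le_trans.
have /choice[l lH] : forall i, exists l, forall k,
    `|u k 0 i - l| <= 2 * B / 2 ^+ k.
  move=> i; apply: geometric_limit => k.
  by apply: le_trans (uB k); rewrite -[leRHS]/(`|_|); have := coord_le_norm (u k.+1 - u k) i; rewrite !mxE.
exists (\row_i l i) => k; apply: norm_le_coord => [|i].
  by rewrite divr_ge0 ?mulr_ge0 ?exprn_ge0.
by rewrite !mxE.
Qed.

End Norms.

(** * Derivatives of curves *)

Section CurveDerivative.
Variables (R : realType).

(** Epsilon form of [is_derive] (see [cderivP]): remainders are estimated directly and combine with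
    Lipschitz and quadratic bounds without difference quotients. *)
Definition cderiv (W : normedModType R) (c : R -> W) (t : R) (v : W) :=
  forall eta : R, 0 < eta ->
    \forall s \near t, `|c s - c t - (s - t) *: v| <= eta * `|s - t|.

Variable W : normedModType R.
Implicit Types c : R -> W.

Lemma cderivP c t v : cderiv c t v <-> is_derive t (1 : R) c v.
Proof.
split=> [H|[D E] e e0].
  have L : h^-1 *: (c (h *: (1 : R) + t) - c t) @[h --> 0^'] --> v.
    apply/cvgrPdist_le => e e0.
    have /nbhs_ballP[d /= d0 Hd] := H e e0.
    near=> h.
    have h0 : h != 0 by near: h; exact: nbhs_dnbhs_neq.
    have /Hd : ball t d (h + t).
      rewrite /ball /= opprD addrCA subrr addr0 normrN.
      by near: h; exact: dnbhs0_lt.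
    rewrite addrK => Hh.
    rewrite -normrN opprB (_ : h *: (1 : R) = h); last exact: mulr1.
    have -> : h^-1 *: (c (h + t) - c t) - v =
       h^-1 *: (c (h + t) - c t - h *: v).
      by rewrite [RHS]scalerBr scalerA mulVf// scale1r.
    by rewrite normrZ normfV ler_pdivrMl ?normr_gt0// mulrC.
  apply: DeriveDef; first by apply/cvg_ex; exists v.
  by apply/cvg_lim.
have : h^-1 *: (c (h *: (1 : R) + t) - c t) @[h --> 0^'] --> v.
  by rewrite -E; exact: D.
move=> /cvgrPdist_le/(_ e e0)/nbhs_ballP[d /= d0 Hd].
apply/nbhs_ballP; exists d => //= s.
have [-> _|st] := eqVneq s t.
  by rewrite !subrr scale0r subr0 !normr0 mulr0.
rewrite /ball /= distrC => sd.
have st0 : s - t != 0 by rewrite subr_eq0.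
have := Hd (s - t); rewrite /ball /= sub0r normrN => /(_ sd st0).
rewrite (_ : (s - t) *: (1 : R) = s - t); last exact: mulr1.
rewrite subrK -normrN opprB.
have -> : (s - t)^-1 *: (c s - c t) - v =
       (s - t)^-1 *: (c s - c t - (s - t) *: v).
  by rewrite [RHS]scalerBr scalerA mulVf// scale1r.
by rewrite normrZ normfV ler_pdivrMl ?normr_gt0// mulrC.
Unshelve. all: by end_near. Qed.


Lemma cderiv_continuous c t v : cderiv c t v -> {for t, continuous c}.
Proof.
move=> /cderivP[D _]; apply: differentiable_continuous.
exact/derivable1_diffP.
Qed.

Lemma cderiv_eq c t v w : cderiv c t v -> v = w -> cderiv c t w.
Proof. by move=> ? <-. Qed.

Lemma cderiv_near c d t v : (\forall s \near t, c s = d s) ->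
  cderiv c t v -> cderiv d t v.
Proof.
move=> cd H e e0; have cdt := nbhs_singleton cd.
by near=> s; rewrite -cdt -(near cd s)//; near: s; exact: H.
Unshelve. all: by end_near. Qed.

Lemma cderiv_ext c d t v : c =1 d -> cderiv c t v -> cderiv d t v.
Proof. by move=> /funext ->. Qed.

Lemma cderiv_cst (a : W) t : cderiv (fun=> a) t 0.
Proof. by apply/cderivP; exact: is_derive_cst. Qed.

Lemma cderivD c d t v w : cderiv c t v -> cderiv d t w ->
  cderiv (fun s => c s + d s) t (v + w).
Proof. by move=> /cderivP ? /cderivP ?; apply/cderivP; exact: is_deriveD. Qed.

Lemma cderivN c t v : cderiv c t v -> cderiv (fun s => - c s) t (- v).
Proof. by move=> /cderivP ?; apply/cderivP; exact: is_deriveN. Qed.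

Lemma cderivB c d t v w : cderiv c t v -> cderiv d t w ->
  cderiv (fun s => c s - d s) t (v - w).
Proof. by move=> /cderivP ? /cderivP ?; apply/cderivP; exact: is_deriveB. Qed.

Lemma cderivZ (k : R) c t v : cderiv c t v -> cderiv (fun s => k *: c s) t (k *: v).
Proof. by move=> /cderivP ?; apply/cderivP; exact: is_deriveZ. Qed.

Lemma cderiv_affine (a b : W) t : cderiv (fun s => a + s *: b) t b.
Proof.
move=> e e0; near=> s.
by rewrite opprD addrACA subrr add0r -scalerBl subrr normr0 mulr_ge0// ltW.
Unshelve. all: by end_near. Qed.

End CurveDerivative.

Lemma cderiv_comp (R : realType) (W : normedModType R) (c : R -> W) (h : R -> R) t k v :
  cderiv h t k -> cderiv c (h t) v -> cderiv (c \o h) t (k *: v).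
Proof.
move=> hk cv e e0; have hc : {for t, continuous h} := cderiv_continuous hk.
pose K := `|k| + 1.
have K0 : 0 < K by rewrite /K; have := normr_ge0 k; lra.
have e1 : 0 < e / 2 / K by rewrite !divr_gt0.
(* The [1] keeps the increments of [h] below [K * |s - t|]; the other term pays for the remainder of
   [h] multiplied by [v]. *)
pose e2 := Num.min 1 (e / 2 / (`|v| + 1)).
have v0 := normr_ge0 v.
have e20 : 0 < e2 by rewrite lt_min ltr01 /= !divr_gt0//; lra.
near=> s.
have H1 : `|h s - h t - (s - t) *: k| <= e2 * `|s - t|.
  by near: s; exact: hk.
have H2 : `|c (h s) - c (h t) - (h s - h t) *: v| <= e / 2 / K * `|h s - h t|.
  by near: s; exact: (hc _ (cv _ e1)).
have H3 : `|h s - h t| <= K * `|s - t|.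
  have -> : h s - h t = (h s - h t - (s - t) *: k) + (s - t) *: k by rewrite subrK.
  apply: (le_trans (ler_normD _ _)); rewrite normrZ /K.
  have : e2 * `|s - t| <= `|s - t|.
    by rewrite ler_piMl// ge_min lexx.
  by rewrite mulrDl mul1r (mulrC `|k|); lra.
have -> : (c \o h) s - (c \o h) t - (s - t) *: (k *: v) =
   (c (h s) - c (h t) - (h s - h t) *: v) + (h s - h t - (s - t) *: k) *: v.
  by rewrite /= [X in _ = _ + X]scalerBl -[(s - t) *: k]/((s - t) * k) -scalerA addrA subrK.
apply: (le_trans (ler_normD _ _)); rewrite normrZ.
have H4 : e / 2 / K * `|h s - h t| <= e / 2 * `|s - t|.
  apply: (le_trans (ler_wpM2l (ltW e1) H3)).
  by rewrite mulrA divfK ?gt_eqF.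
have H5 : `|h s - h t - (s - t) *: k| * `|v| <= e / 2 * `|s - t|.
  apply: (@le_trans _ _ (e2 * `|s - t| * `|v|)); first exact: ler_wpM2r.
  rewrite mulrAC ler_wpM2r//.
  apply: (@le_trans _ _ (e / 2 / (`|v| + 1) * `|v|)).
    by rewrite ler_wpM2r// ge_min lexx orbT.
  rewrite -mulrA ler_piMr//; first by lra.
  by rewrite mulrC ler_pdivrMr; lra.
by lra.
Unshelve. all: by end_near. Qed.

Section MeanValue.
Variables (R : realType) (n : nat).

Lemma cderiv_coord (c : R -> 'rV[R]_n) t v i :
  cderiv c t v -> cderiv (fun s => c s 0 i) t (v 0 i).
Proof.
move=> H e e0; apply: filterS (H e e0) => s.
by apply: le_trans; apply: le_trans (coord_le_norm _ i); rewrite !mxE.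
Qed.

Lemma cderiv_row (c : R -> 'rV[R]_n) t (v : 'rV[R]_n) :
  (forall i, cderiv (fun s => c s 0 i) t (v 0 i)) -> cderiv c t v.
Proof.
move=> H e e0; near=> s; apply: norm_le_coord => [|i].
  by rewrite mulr_ge0// ltW.
rewrite !mxE; move: i; near: s; apply: filter_forall => i.
exact: H.
Unshelve. all: by end_near. Qed.

Lemma cderiv_nondecr (f f' : R -> R) a b : a <= b ->
  (forall t, a <= t <= b -> cderiv f t (f' t)) ->
  (forall t, a <= t <= b -> 0 <= f' t) -> f a <= f b.
Proof.
move=> ab Hf Hf'.
have [x xab|x|c cab E] := @MVT_segment _ f f' a b ab.
- apply/cderivP/Hf; move: xab; rewrite in_itv /=; lra.
- apply: derivable_within_continuous => z; rewrite in_itv /= => zab.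
  by have /cderivP[] := Hf z zab.
- rewrite -subr_ge0 E mulr_ge0 ?subr_ge0//; apply: Hf'.
  by move: cab; rewrite in_itv.
Qed.

(** The norm is the sup norm, so the bound reduces to the monotonicity of [w + u_i] and [w - u_i]
    for each coordinate [i]. *)
Lemma mean_value_le (u u' : R -> 'rV[R]_n) (w w' : R -> R) a b : a <= b ->
  (forall t, a <= t <= b -> cderiv u t (u' t)) ->
  (forall t, a <= t <= b -> cderiv w t (w' t)) ->
  (forall t, a <= t <= b -> `|u' t| <= w' t) ->
  `|u b - u a| <= w b - w a.
Proof.
move=> ab Hu Hw H.
have Hi i t : a <= t <= b -> - w' t <= u' t 0 i <= w' t.
  by move=> tab; rewrite -ler_norml (le_trans (coord_le_norm _ _))// H.
apply: norm_le_coord => [|i].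
  rewrite subr_ge0; apply: (cderiv_nondecr ab Hw) => t tab.
  exact: le_trans (H t tab).
rewrite !mxE ler_norml; apply/andP; split.
  suff H1 : w a + u a 0 i <= w b + u b 0 i by lra.
  apply: (@cderiv_nondecr (fun s => w s + u s 0 i) (fun s => w' s + u' s 0 i)) => // t tab.
    by apply: cderivD; [exact: Hw|apply: cderiv_coord; exact: Hu].
  by have := Hi i t tab; lra.
suff H1 : w a - u a 0 i <= w b - u b 0 i by lra.
apply: (@cderiv_nondecr (fun s => w s - u s 0 i) (fun s => w' s - u' s 0 i)) => // t tab.
  by apply: cderivB; [exact: Hw|apply: cderiv_coord; exact: Hu].
by have := Hi i t tab; lra.
Qed.

Lemma mean_value_cst (u u' : R -> 'rV[R]_n) (K : R) a b : a <= b ->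
  (forall t, a <= t <= b -> cderiv u t (u' t)) ->
  (forall t, a <= t <= b -> `|u' t| <= K) ->
  `|u b - u a| <= K * (b - a).
Proof.
move=> ab Hu H.
have := @mean_value_le u u' (fun s => 0 + s *: K) (fun=> K) a b ab Hu.
rewrite !add0r -scalerBl mulrC; apply=> // t _.
exact: cderiv_affine.
Qed.

Lemma mean_value_abs (u u' : R -> 'rV[R]_n) (K : R) a b :
  (forall t, Num.min a b <= t <= Num.max a b -> cderiv u t (u' t)) ->
  (forall t, Num.min a b <= t <= Num.max a b -> `|u' t| <= K) ->
  `|u b - u a| <= K * `|b - a|.
Proof.
have [ab|/ltW ab] := leP a b => Hu H.
  rewrite ger0_norm ?subr_ge0//.
  by apply: (mean_value_cst ab Hu).
rewrite distrC (distrC b) ger0_norm ?subr_ge0//.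
by apply: (mean_value_cst ab Hu).
Qed.

(** Gronwall's inequality with the constant doubled. On an interval where [L * (b1 - a1)] is at most
    one half, the maximum of [|d|] is at most [2 * |d a1|], which gives the factor
    [1 + 2 * L * (b1 - a1)], hence the exponential; the factors multiply along a subdivision. *)
Lemma lipschitz_field_growth (d d' : R -> 'rV[R]_n) (L a b : R) :
  a <= b -> 0 <= L ->
  (forall t, a <= t <= b -> cderiv d t (d' t)) ->
  (forall t, a <= t <= b -> `|d' t| <= L * `|d t|) ->
  `|d b| <= expR (2 * L * (b - a)) * `|d a|.
Proof.
move=> ab L0.
have small a1 b1 : a1 <= b1 -> L * (b1 - a1) <= 1 / 2 ->
  (forall t, a1 <= t <= b1 -> cderiv d t (d' t)) ->
  (forall t, a1 <= t <= b1 -> `|d' t| <= L * `|d t|) ->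
  `|d b1| <= expR (2 * L * (b1 - a1)) * `|d a1|.
  move=> ab1 Lab Hd H.
  have cd : {within `[a1, b1], continuous (fun t => `|d t|)}.
    apply/continuous_in_subspaceT => z; rewrite inE /= in_itv /= => zab.
    apply: continuous_comp; last exact: norm_continuous.
    exact: (cderiv_continuous (Hd z zab)).
  have [c] := EVT_max ab1 cd; rewrite in_itv /= => cab cmax.
  set S := `|d c| in cmax.
  have S0 : 0 <= S by exact: normr_ge0.
  have Hbd t : a1 <= t <= b1 -> `|d t - d a1| <= L * S * (t - a1).
    move=> /andP[at1 tb1]; apply: (mean_value_cst at1) => s /andP[as1 st].
      by apply: Hd; rewrite as1 (le_trans st).
    have sab : a1 <= s <= b1 by rewrite as1 (le_trans st).
    apply: le_trans (H s sab) _; rewrite ler_wpM2l// cmax//.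
  have LS t : a1 <= t <= b1 -> L * S * (t - a1) <= L * (b1 - a1) * S.
    move=> tab; rewrite mulrAC ler_wpM2r// ler_wpM2l//; lra.
  have HS : S <= 2 * `|d a1|.
    have H1 := le_trans (Hbd c cab) (LS c cab).
    have H2 : L * (b1 - a1) * S <= 1 / 2 * S by exact: ler_wpM2r.
    have := ler_normD (d a1) (d c - d a1); rewrite addrC subrK -/S; lra.
  have bb : a1 <= b1 <= b1 by rewrite ab1 lexx.
  have H1 := le_trans (Hbd b1 bb) (LS b1 bb).
  have H2 : `|d b1| <= `|d a1| + L * (b1 - a1) * S.
    have := ler_normD (d a1) (d b1 - d a1); rewrite addrC subrK; lra.
  have Lab0 : 0 <= L * (b1 - a1) by rewrite mulr_ge0// subr_ge0.
  have H3 : L * (b1 - a1) * S <= L * (b1 - a1) * (2 * `|d a1|).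
    exact: ler_wpM2l.
  apply: (@le_trans _ _ ((1 + 2 * L * (b1 - a1)) * `|d a1|)).
    rewrite mulrDl mul1r; apply: le_trans H2 _; rewrite lerD2l.
    by apply: le_trans H3 _; rewrite le_eqVlt; apply/orP; left; apply/eqP; ring.
  rewrite ler_wpM2r//; exact: expR_ge1Dx.
move=> Hd H.
have [N HN] : exists N : nat, L * (b - a) <= N.+1%:R / 2.
  exists (Num.truncn (2 * (L * (b - a)))).
  have := truncnS_gt (2 * (L * (b - a))); lra.
pose x (i : nat) : R := a + (b - a) * (i%:R / N.+1%:R).
have N0 : N.+1%:R != 0 :> R by rewrite pnatr_eq0.
have xS i : x i.+1 - x i = (b - a) / N.+1%:R.
  by rewrite /x -natr1; field.
have xSge i : x i <= x i.+1.
  by rewrite -subr_ge0 xS divr_ge0 ?subr_ge0.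
have xm : {homo x : i j / (i <= j)%N >-> i <= j} by apply: homo_leq => //; exact: le_trans.
have x0 : x 0%N = a by rewrite /x mul0r mulr0 addr0.
have xN : x N.+1 = b by rewrite /x divff// mulr1; lra.
suff : forall i, (i <= N.+1)%N -> `|d (x i)| <= expR (2 * L * (x i - a)) * `|d a|.
  by move=> /(_ _ (leqnn _)); rewrite xN.
elim=> [|i IH] iN; first by rewrite x0 subrr mulr0 expR0 mul1r.
have HS : `|d (x i.+1)| <= expR (2 * L * (x i.+1 - x i)) * `|d (x i)|.
  have sub t : x i <= t <= x i.+1 -> a <= t <= b.
    move=> /andP[h1 h2]; rewrite (le_trans _ h1) ?(le_trans h2)//.
      by rewrite -xN xm.
    by rewrite -x0 xm.
  apply: small => // [|t /sub|t /sub]; [|exact: Hd|exact: H].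
  by rewrite xS mulrA ler_pdivrMr ?ltr0n//; lra.
apply: le_trans HS _.
have -> : 2 * L * (x i.+1 - a) = 2 * L * (x i.+1 - x i) + 2 * L * (x i - a) by ring.
rewrite expRD -[leRHS]mulrA ler_wpM2l ?expR_ge0//.
by apply: IH; exact: ltnW.
Qed.

End MeanValue.

Lemma near_norm_lt (R : realType) (W : normedModType R) (x : W) (e : R) :
  0 < e -> \forall y \near x, `|y - x| < e.
Proof.
move=> e0; apply/nbhs_ballP; exists e => //= y.
by rewrite -ball_normE /= distrC.
Qed.

(** * Primitives and flows of Lipschitz fields *)

Section Flow.
Variables (R : realType).

Lemma cderiv0_eq (f : R -> R) a b :
  (forall t, Num.min a b <= t <= Num.max a b -> cderiv f t 0) -> f a = f b.
Proof.
wlog ab : a b / a <= b => [hw|].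
  have [ab|/ltW ab] := leP a b => H; first by apply: hw => // t; rewrite (min_l ab) (max_r ab); exact: H.
  by apply/esym/hw => // t; rewrite (min_l ab) (max_r ab); exact: H.
rewrite (min_l ab) (max_r ab) => H; apply/le_anti/andP; split.
  exact: (@cderiv_nondecr _ f (fun=> 0)).
have := @cderiv_nondecr _ (fun s => - f s) (fun=> - 0) a b ab.
rewrite lerN2; apply=> t tab; last by rewrite oppr0.
by apply: cderivN; exact: H.
Qed.

(** The integral from [- N] is known to be a primitive only on []-N, N[]. Normalised at 0, these
    primitives agree wherever they are comparable, so each point can use its own [N]. *)
Lemma exists_primitive (f : R -> R) : continuous f ->
  exists G : R -> R, forall x, cderiv G x (f x).
Proof.
move=> cf.
pose G (N : nat) x := (\int[lebesgue_measure]_(t in `[- N%:R, x]) f t)%R.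
have GP N x : `|x| < N%:R -> cderiv (G N) x (f x).
  rewrite ltr_norml => /andP[x1 x2].
  have ic : lebesgue_measure.-integrable `[- N%:R, N%:R] (EFin \o f).
    apply: continuous_compact_integrable; first exact: segment_compact.
    exact: continuous_subspaceT.
  have [D E] := continuous_FTC1_closed x2 ic x1 (cf x).
  by apply/cderivP; exact: (DeriveDef D (etrans (esym (derive1E _ _)) E)).
clearbody G.
have Geq N m x : `|x| < N%:R -> `|x| < m%:R -> G N x - G N 0 = G m x - G m 0.
  move=> xN xm.
  suff : G N 0 - G m 0 = G N x - G m x by lra.
  apply: (@cderiv0_eq (fun s => G N s - G m s)) => t tx.
  have tx' : `|t| <= `|x|.
    have [x0|/ltW x0] := leP 0 x.
      by move: tx; rewrite min_l// max_r// (ger0_norm x0) ler_norml => /andP[]; lra.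
    by move: tx; rewrite min_r// max_l// (ler0_norm x0) ler_norml => /andP[]; lra.
  rewrite -(subrr (f t)); apply: cderivB; apply: GP; exact: le_lt_trans xN || exact: le_lt_trans xm.
pose Nx (x : R) := (Num.truncn `|x|).+1.
have NxP x : `|x| < (Nx x)%:R by rewrite /Nx truncnS_gt.
exists (fun x => G (Nx x) x - G (Nx x) 0) => x.
(* One more than the bound at [x], so that every point within distance 1 of [x] is covered. *)
pose m := (Nx x).+1.
have H : cderiv (fun s => G m s - G m 0) x (f x).
  rewrite -[f x]subr0; apply: cderivB; last exact: cderiv_cst.
  by apply: GP; apply: lt_trans (NxP x) _; rewrite ltr_nat.
apply: cderiv_near H; near=> s; apply: Geq => //.
have : `|s| <= `|x| + `|s - x| by rewrite -{1}(subrK x s) addrC ler_normD.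
have : `|s - x| < 1.
  by near: s; exact: (@near_norm_lt R R x 1).
have := NxP x; rewrite /m -[(Nx x).+1]addn1 natrD; lra.
Unshelve. all: by end_near. Qed.

Variable n : nat.
Local Notation V := 'rV[R]_n.

Lemma lipschitz_continuous (Y : V -> V) (L : R) :
  (forall p q, `|Y p - Y q| <= L * `|p - q|) -> continuous Y.
Proof.
move=> H x; apply/(@cvgrPdist_le _ _ _ _ (nbhs_filter x)) => e e0.
have L1 : 0 < `|L| + 1 by have := normr_ge0 L; lra.
apply: filterS (near_norm_lt x (divr_gt0 e0 L1)) => y Hy.
apply: le_trans (H _ _) _.
apply: (@le_trans _ _ ((`|L| + 1) * `|x - y|)).
  by rewrite ler_wpM2r//; have := ler_norm L; lra.
by rewrite mulrC -ler_pdivlMr// distrC ltW.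
Qed.

Lemma exists_primitive_rV (F : R -> V) (c : V) : continuous F ->
  exists G : R -> V, G 0 = c /\ forall x, cderiv G x (F x).
Proof.
move=> cF.
have /choice[G GP] : forall i, exists G : R -> R, forall x, cderiv G x (F x 0 i).
  move=> i; apply: exists_primitive => x.
  exact: (continuous_comp (cF x) (@coord_continuous R 1 n 0 i (F x))).
exists (fun x => \row_i (G i x - G i 0 + c 0 i)); split.
  by apply/rowP => i; rewrite !mxE subrr add0r.
move=> x; apply: cderiv_row => i.
have : cderiv (fun s => (G i s - G i 0) + c 0 i) x (F x 0 i - 0 + 0).
  by apply: cderivD; [apply: cderivB => //; exact: cderiv_cst|exact: cderiv_cst].
rewrite subr0 addr0; by apply: cderiv_ext => s; rewrite mxE.
Qed.

(* The Picard iterates converge locally uniformly because consecutive ones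
   differ by at most [B 2^-k exp(2 L |t|)]. *)
Lemma lipschitz_flow (Y : V -> V) (L : R) (c : V) :
  (forall p q, `|Y p - Y q| <= L * `|p - q|) ->
  exists u : R -> V, u 0 = c /\ forall t, cderiv u t (Y (u t)).
Proof.
move=> HL0.
wlog L0 : L HL0 / 0 < L.
  move=> /(_ (`|L| + 1)); apply; last by have := normr_ge0 L; lra.
  move=> p q; apply: le_trans (HL0 p q) _.
  by rewrite ler_wpM2r//; have := ler_norm L; lra.
have cY := lipschitz_continuous HL0.
(* The Picard operator makes sense on continuous maps; elsewhere it returns its argument as a
   default. *)
have /choice[P PP] : forall u : R -> V, exists w : R -> V, continuous u ->
    w 0 = c /\ forall t, cderiv w t (Y (u t)).
  move=> u; have [cu|ncu] := pselect (continuous u); last by exists u.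
  have [w H] := @exists_primitive_rV (Y \o u) c (fun x => continuous_comp (cu x) (cY _)).
  by exists w.
pose U k := iter k P (fun=> c).
have cU k : continuous (U k).
  elim: k => [|k IH]; first by move=> x; exact: cvg_cst.
  by move=> x; apply: cderiv_continuous; exact: (PP _ IH).2.
have U0 k : U k 0 = c by case: k => [//|k]; exact: (PP _ (cU k)).1.
have dU k t : cderiv (U k.+1) t (Y (U k t)) by exact: (PP _ (cU k)).2.
(* Chosen so that the derivative [Y c] of the first difference is at most [B * (2 * L)], hence below
   the weighted bound. *)
pose B := `|Y c| / (2 * L).
have B0 : 0 <= B by rewrite divr_ge0// mulr_ge0// ltW.
pose E (t : R) := expR (2 * L * `|t|).
have E0 t : 0 < E t by exact: expR_gt0.
have dexp (K a t : R) : cderiv (fun s => K * expR (a * s)) t (K * (a * expR (a * t))).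
  apply/cderivP; have : is_derive t 1 (fun s : R => expR (a * s)) (a * expR (a * t)).
    have H := is_derive1_comp (is_derive_expR (a * t)) (is_deriveZ a (is_derive_id t 1)).
    by apply: is_derive_eq H _; rewrite /GRing.scale /= mulr1 mulrC.
  by move=> H; apply: is_deriveZ.
(* Integrating the weight divides by [2 * L] while the field multiplies by [L]: each Picard step
   gains a factor one half, on the whole line at once. *)
have weight (d d' : R -> V) (K t : R) : 0 <= K -> d 0 = 0 -> (forall s, cderiv d s (d' s)) ->
    (forall s, `|d' s| <= K * (2 * L) * E s) -> `|d t| <= K * E t.
  move=> K0 d0 Hd Hd'.
  have [t0|/ltW t0] := leP 0 t.
    have := @mean_value_le _ _ d d' (fun s => K * expR (2 * L * s)) _ 0 t t0
      (fun s _ => Hd s) (fun s _ => dexp _ _ s).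
    rewrite d0 subr0 mulr0 expR0 mulr1 /E (ger0_norm t0) => H.
    apply: (@le_trans _ _ (K * expR (2 * L * t) - K)); last by lra.
    apply: H => s /andP[s0 _].
    by apply: le_trans (Hd' s) _; rewrite /E (ger0_norm s0) -[leLHS]mulrA.
  have := @mean_value_le _ _ d d' (fun s => - K * expR (- (2 * L) * s)) _ t 0 t0
      (fun s _ => Hd s) (fun s _ => dexp _ _ s).
  rewrite d0 sub0r normrN mulr0 expR0 mulr1 /E (ler0_norm t0) => H.
  apply: (@le_trans _ _ (- K - - K * expR (- (2 * L) * t))).
    apply: H => s /andP[_ s0].
    apply: le_trans (Hd' s) _; rewrite /E (ler0_norm s0).
    have -> : - (2 * L) * s = 2 * L * - s by ring.
    by rewrite le_eqVlt; apply/orP; left; apply/eqP; ring.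
  have -> : 2 * L * - t = - (2 * L) * t by ring.
  by lra.
have diffU k t : `|U k.+1 t - U k t| <= B / 2 ^+ k * E t.
  elim: k t => [|k IH] t.
    rewrite expr0 divr1.
    apply: (@weight (fun s => U 1%N s - c) (fun s => Y c - 0)) => //.
    - by rewrite U0 subrr.
    - by move=> s; apply: cderivB; [exact: dU|exact: cderiv_cst].
    - move=> s; rewrite subr0 /B divfK; last by rewrite mulf_neq0// gt_eqF.
      rewrite ler_peMr// /E -expR0 ler_expR mulr_ge0// mulr_ge0// ltW//.
  apply: (@weight (fun s => U k.+2 s - U k.+1 s) (fun s => Y (U k.+1 s) - Y (U k s))) => //.
  - by rewrite divr_ge0// exprn_ge0.
  - by rewrite !U0 subrr.
  - by move=> s; apply: cderivB; exact: dU.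
  - move=> s; apply: le_trans (HL0 _ _) _.
    apply: (@le_trans _ _ (L * (B / 2 ^+ k * E s))); first by rewrite ler_wpM2l// ltW.
    rewrite le_eqVlt; apply/orP; left; apply/eqP.
    by rewrite exprS invfM; field; rewrite expf_neq0.
have /choice[u uP] : forall t, exists l, forall k, `|U k t - l| <= 2 * (B * E t) / 2 ^+ k.
  move=> t; apply: geometric_limit_rV => k.
  by apply: le_trans (diffU k t) _; rewrite mulrAC.
exists u; split.
  apply/eqP; rewrite -subr_eq0 -normr_eq0; apply/eqP/le_anti; rewrite normr_ge0 andbT.
  apply: (@le_of_geometric _ _ _ (2 * (B * E 0))) => k.
  by rewrite add0r; apply: le_trans (uP 0 k); rewrite U0 distrC.
move=> t.
pose T := `|t| + 1; pose ET := expR (2 * L * T).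
have ETE s : `|s| <= T -> E s <= ET.
  by move=> sT; rewrite ler_expR ler_wpM2l// mulr_ge0// ltW.
pose M := `|Y c| + L * (4 * B * ET).
have ET0 : 0 <= ET by exact: expR_ge0.
have M0 : 0 <= M.
  apply: addr_ge0 => //; apply: mulr_ge0; first exact: ltW.
  by apply: mulr_ge0 => //; apply: mulr_ge0.
have Ubd k s : `|s| <= T -> `|U k s - c| <= 4 * B * ET.
  move=> sT; have h0 := uP s 0%N; have hk := uP s k.
  have e2 : 2 * (B * E s) / 2 ^+ k <= 2 * (B * E s).
    rewrite ler_pdivrMr ?exprn_gt0//; apply: ler_peMr; last by rewrite exprn_ege1// ler1n.
    by apply: mulr_ge0 => //; apply: mulr_ge0 => //; exact: ltW.
  have : 2 * (B * E s) <= 2 * (B * ET) by rewrite !ler_wpM2l// ETE.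
  rewrite expr0 divr1 /U /= in h0.
  have := ler_distD (u s) (U k s) c; rewrite (distrC (u s)); lra.
have YU k s : `|s| <= T -> `|Y (U k s)| <= M.
  move=> sT; have h1 := HL0 (U k s) c; have h2 := Ubd k s sT.
  have h3 : L * `|U k s - c| <= L * (4 * B * ET) by rewrite ler_wpM2l// ltW.
  have := ler_normD (Y c) (Y (U k s) - Y c); rewrite addrC subrK /M; lra.
have dUs k s r : `|s| <= T -> `|r| <= T -> `|U k s - U k r| <= M * `|s - r|.
  case: k => [|k] sT rT; first by rewrite subrr normr0 mulr_ge0.
  apply: (mean_value_abs (fun z _ => dU k z)) => z zrs; apply: YU.
  move: sT rT zrs; rewrite !ler_norml; have [] := leP r s; lra.
have dUU k s : `|s| <= T ->
    `|U k.+1 s - U k.+1 t - (s - t) *: Y (U k t)| <= L * M * `|s - t| * `|s - t|.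
  move=> sT; have tT : `|t| <= T by rewrite /T lerDl.
  have H : forall z, cderiv (fun z => U k.+1 z - (0 + z *: Y (U k t))) z (Y (U k z) - Y (U k t)).
    by move=> z; apply: cderivB; [exact: dU|exact: cderiv_affine].
  have := mean_value_abs (fun z _ => H z) _ (a := t) (b := s) (K := L * M * `|s - t|).
  rewrite !add0r => H1.
  have -> : U k.+1 s - U k.+1 t - (s - t) *: Y (U k t) =
    U k.+1 s - s *: Y (U k t) - (U k.+1 t - t *: Y (U k t)).
    by rewrite scalerBl !opprB -!addrA; congr (_ + _); rewrite addrCA [RHS]addrCA; congr (_ + _); rewrite addrC.
  apply: H1 => z zst; apply: le_trans (HL0 _ _) _.
  have zT : `|z| <= T.
    by move: sT tT zst; rewrite !ler_norml; have [] := leP t s; lra.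
  rewrite -mulrA ler_wpM2l ?(ltW L0)//.
  apply: le_trans (dUs k z t zT tT) _; rewrite ler_wpM2l//.
  move: zst; have [ts|ts] := leP t s => /andP[z1 z2].
    by rewrite !ger0_norm; lra.
  by rewrite !ler0_norm; lra.
have BE0 s : 0 <= 2 * (B * E s).
  by apply: mulr_ge0 => //; apply: mulr_ge0 => //; exact: ltW.
have half k : (2 ^+ k.+1)^-1 <= (2 ^+ k)^-1 :> R.
  rewrite lef_pV2 ?posrE ?exprn_gt0// exprS ler_peMl ?exprn_ge0//.
  by rewrite ler1n.
(* The iterates have a quadratic Taylor remainder with a constant independent of [k], so the bound
   passes to the limit and yields the differential equation without exchanging a limit and an
   integral. *)
have key s : `|s| <= T ->
    `|u s - u t - (s - t) *: Y (u t)| <= L * M * `|s - t| * `|s - t|.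
  move=> sT; have tT : `|t| <= T by rewrite /T lerDl.
  apply: (@le_of_geometric _ _ _ (2 * (B * E s) + 2 * (B * E t) + `|s - t| * (L * (2 * (B * E t))))) => k.
  have h1 := dUU k s sT.
  have h2 : `|U k.+1 s - u s| <= 2 * (B * E s) / 2 ^+ k.
    by apply: le_trans (uP s k.+1) _; apply: ler_wpM2l => //; exact: BE0.
  have h3 : `|U k.+1 t - u t| <= 2 * (B * E t) / 2 ^+ k.
    by apply: le_trans (uP t k.+1) _; apply: ler_wpM2l => //; exact: BE0.
  have h4 : `|(s - t) *: (Y (U k t) - Y (u t))| <= `|s - t| * (L * (2 * (B * E t) / 2 ^+ k)).
    rewrite normrZ ler_wpM2l//; apply: le_trans (HL0 _ _) _.
    by rewrite ler_wpM2l ?(ltW L0).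
  have -> : u s - u t - (s - t) *: Y (u t) =
    (U k.+1 s - U k.+1 t - (s - t) *: Y (U k t)) - (U k.+1 s - u s) + (U k.+1 t - u t)
     + (s - t) *: (Y (U k t) - Y (u t)).
    by apply/rowP => i; rewrite !mxE; ring.
  have := ler_normD (U k.+1 s - U k.+1 t - (s - t) *: Y (U k t) - (U k.+1 s - u s) + (U k.+1 t - u t)) ((s - t) *: (Y (U k t) - Y (u t))).
  have := ler_normD (U k.+1 s - U k.+1 t - (s - t) *: Y (U k t) - (U k.+1 s - u s)) (U k.+1 t - u t).
  have := ler_normB (U k.+1 s - U k.+1 t - (s - t) *: Y (U k t)) (U k.+1 s - u s).
  rewrite !mulrDl -!mulrA in h2 h3 h4 *; lra.
have LM1 : 0 < L * M + 1 by have := mulr_ge0 (ltW L0) M0; lra.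
move=> e e0; near=> s.
have st : `|s - t| < 1.
  by near: s; exact: (@near_norm_lt R R t 1).
have ste : `|s - t| <= e / (L * M + 1).
  by apply: ltW; near: s; apply: (@near_norm_lt R R t); exact: divr_gt0.
have sT : `|s| <= T.
  have : `|s| <= `|t| + `|s - t| by rewrite -{1}(subrK t s) addrC ler_normD.
  by rewrite /T; lra.
apply: le_trans (key s sT) _; rewrite ler_wpM2r//.
apply: (@le_trans _ _ ((L * M + 1) * `|s - t|)); first by rewrite ler_wpM2r//; lra.
by rewrite mulrC -ler_pdivlMr.
Unshelve. all: by end_near. Qed.

End Flow.

(** * Differentials and their action on curves *)

Section Differentials.
Variables (R : realType).

Lemma linear_bounded (n : nat) (W : normedModType R) (f : {linear 'rV[R]_n -> W}) :
  exists2 K, 0 < K & forall v, `|f v| <= K * `|v|.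
Proof.
exists (1 + \sum_i `|f (delta_mx 0 i)|).
  by rewrite ltr_wpDr// sumr_ge0.
move=> v; rewrite {1}(row_sum_delta v) linear_sum mulrDl mul1r.
apply: (le_trans (ler_norm_sum _ _ _)).
apply: (@le_trans _ _ (\sum_i `|f (delta_mx 0 i)| * `|v|)).
  apply: ler_sum => i _; rewrite linearZ normrZ mulrC ler_wpM2l//.
  exact: coord_le_norm.
by rewrite -mulr_suml lerDr.
Qed.

Lemma linear_continuous_rV (n : nat) (W : normedModType R) (f : {linear 'rV[R]_n -> W}) :
  continuous f.
Proof.
have [K K0 H] := linear_bounded f.
move=> x; apply/(@cvgrPdist_le _ _ _ _ (nbhs_filter x)) => e e0.
apply: filterS (near_norm_lt x (divr_gt0 e0 K0)) => y Hy.
rewrite -linearB (le_trans (H _))// mulrC -ler_pdivlMr//.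
by rewrite distrC ltW.
Qed.

Lemma diff_eps (V W : normedModType R) (f : V -> W) x :
  differentiable f x -> forall e : R, 0 < e ->
  \forall y \near x, `|f y - f x - 'd f x (y - x)| <= e * `|y - x|.
Proof.
move=> /diff_locally /eqaddoP H e /H.
move=> /nbhs_ballP[d /= d0 Hd]; apply/nbhs_ballP; exists d => //= y xy.
have := Hd (y - x); rewrite -ball_normE /= sub0r normrN distrC.
move: xy; rewrite -ball_normE /= => xy /(_ xy).
by rewrite -[(_ - _)%R _]/(_ - _) -[(_ + _)%R _]/(_ + _) /= subrK opprD addrA.
Qed.

Lemma eps_diff (n : nat) (W : normedModType R) (f : 'rV[R]_n -> W) x
    (L : {linear 'rV[R]_n -> W}) :
  (forall e : R, 0 < e -> \forall y \near x, `|f y - f x - L (y - x)| <= e * `|y - x|) ->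
  differentiable f x /\ 'd f x = L :> ('rV[R]_n -> W).
Proof.
move=> H.
have cL := @linear_continuous_rV n W L.
have E : f \o shift x = cst (f x) + L +o_ (0 : 'rV[R]_n) id.
  apply/eqaddoP => e /H.
  move=> /nbhs_ballP[d /= d0 Hd]; apply/nbhs_ballP; exists d => //= h hd.
  have := Hd (h + x); rewrite -ball_normE /= opprD addrCA subrr addr0 normrN.
  move: hd; rewrite -ball_normE /= sub0r normrN => hd /(_ hd).
  by rewrite -[(_ - _)%R _]/(_ - _) -[(_ + _)%R _]/(_ + _) /= addrK opprD addrA.
have D := diff_unique cL E; split=> //.
by apply/diff_locallyP; rewrite D.
Qed.

Lemma cderiv_diff (V W : normedModType R) (f : V -> W) (c : R -> V) t v :
  differentiable f (c t) -> cderiv c t v -> cderiv (f \o c) t ('d f (c t) v).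
Proof.
move=> df /cderivP [dc cv].
have Dc : differentiable c t by exact/derivable1_diffP.
have Dfc : differentiable (f \o c) t by exact: differentiable_comp.
apply/cderivP; apply: DeriveDef; first exact/derivable1_diffP.
by rewrite deriveE// diff_comp//= -cv (deriveE _ Dc).
Qed.

Lemma cderiv_linear (n : nat) (W : normedModType R) (f : {linear 'rV[R]_n -> W})
    (c : R -> 'rV[R]_n) t v :
  cderiv c t v -> cderiv (f \o c) t (f v).
Proof.
move=> H e e0; have [K K0 HK] := linear_bounded f.
apply: filterS (H _ (divr_gt0 e0 K0)) => s Hs.
rewrite /= -linearB -linearZ -linearB (le_trans (HK _))// mulrC -ler_pdivlMr//.
by rewrite mulrAC.
Qed.

End Differentials.

(* [X q] is the linear lift of a base vector to the plane [E q]; it depends on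
   its argument only modulo the kernel of [P], which is transverse to [E q]. *)
Record lift_field (R : realType) (n : nat) := LiftField {
  lift :> 'rV[R]_n -> {linear 'rV[R]_n -> 'rV[R]_n};
  lift_proj : {linear 'rV[R]_n -> 'rV[R]_n};
  lift_bound : R;
  lift_lip : R;
  lift_bound_gt0 : 0 < lift_bound;
  lift_lip_gt0 : 0 < lift_lip;
  lift_norm : forall q v, `|lift q v| <= lift_bound * `|v|;
  lift_lipschitz : forall p q v, `|lift p v - lift q v| <= lift_lip * `|p - q| * `|v|;
  lift_projK : forall q v, lift_proj (lift q v) = lift_proj v;
  proj_liftK : forall q v, lift q (lift_proj v) = lift q v
}.

(** * Flows of lifted base vectors *)

Section LiftFlow.
Variables (R : realType) (n : nat) (X : lift_field R n).
Local Notation V := 'rV[R]_n.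
Local Notation P := (lift_proj X).
Local Notation L := (lift_lip X).
Local Notation Mb := (lift_bound X).
Implicit Types (c q xi x h : V).

Lemma lift_flow_subproof :
  exists s : V -> V -> R -> V, forall xi c, s xi c 0 = c /\
    forall t, cderiv (s xi c) t (X (s xi c t) xi).
Proof.
have /choice[s H] : forall a : V * V, exists u : R -> V, u 0 = a.2 /\
    forall t, cderiv u t (X (u t) a.1).
  move=> [xi c]; apply: (@lipschitz_flow _ _ (fun q => X q xi) (L * `|xi|)) => p q.
  by rewrite mulrAC; exact: lift_lipschitz.
by exists (fun xi c => s (xi, c)) => xi c; exact: (H (xi, c)).
Qed.

Definition lift_line := sval (cid lift_flow_subproof).
(** Time is absorbed in the base vector: the flow of [xi] at time [t] is [flow (t *: xi)], so [xi]
    plays the role of an exponential coordinate. *)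
Definition flow xi c := lift_line xi c 1.

Lemma lift_line0 xi c : lift_line xi c 0 = c.
Proof. exact: (svalP (cid lift_flow_subproof) xi c).1. Qed.

Lemma lift_line_deriv xi c t :
  cderiv (lift_line xi c) t (X (lift_line xi c t) xi).
Proof. exact: (svalP (cid lift_flow_subproof) xi c).2. Qed.

Lemma liftZ q (a : R) v : X q (a *: v) = a *: X q v.
Proof. exact: linearZ. Qed.

Lemma lift_ode_close (u v : R -> V) xi a b : a <= b ->
  (forall t, a <= t <= b -> cderiv u t (X (u t) xi)) ->
  (forall t, a <= t <= b -> cderiv v t (X (v t) xi)) ->
  `|u b - v b| <= expR (2 * (L * `|xi|) * (b - a)) * `|u a - v a|.
Proof.
move=> ab Hu Hv.
apply: (@lipschitz_field_growth _ _ (fun t => u t - v t)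
  (fun t => X (u t) xi - X (v t) xi)) => // [|t tab|t tab].
- by rewrite mulr_ge0// ltW// lift_lip_gt0.
- by apply: cderivB; [exact: Hu|exact: Hv].
- by rewrite mulrAC; exact: lift_lipschitz.
Qed.

Lemma lift_ode_unique (u v : R -> V) xi a b : a <= b ->
  (forall t, a <= t <= b -> cderiv u t (X (u t) xi)) ->
  (forall t, a <= t <= b -> cderiv v t (X (v t) xi)) ->
  u a = v a -> u b = v b.
Proof.
move=> ab Hu Hv uva; have := lift_ode_close ab Hu Hv.
rewrite uva subrr normr0 mulr0 normr_le0 => /eqP/subr0_eq; exact.
Qed.

Lemma flow_ode (u : R -> V) xi :
  (forall t, 0 <= t <= 1 -> cderiv u t (X (u t) xi)) -> u 1 = flow xi (u 0).
Proof.
move=> Hu; apply: (lift_ode_unique ler01 Hu) => [t _|].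
  exact: lift_line_deriv.
by rewrite lift_line0.
Qed.

Lemma flow_lipschitz xi c c' :
  `|flow xi c - flow xi c'| <= expR (2 * (L * `|xi|)) * `|c - c'|.
Proof.
have := @lift_ode_close (lift_line xi c) (lift_line xi c') xi 0 1 ler01.
rewrite !lift_line0 subr0 mulr1; apply=> t _; exact: lift_line_deriv.
Qed.

Lemma cderiv_lin (a b t : R) : cderiv (fun s => a + s * b) t b.
Proof. exact: cderiv_affine. Qed.

Lemma flow_add s t xi c :
  flow ((s + t) *: xi) c = flow (t *: xi) (flow (s *: xi) c).
Proof.
have line r xi' c' : lift_line xi' c' r = flow (r *: xi') c'.
  have := @flow_ode (fun s => lift_line xi' c' (0 + s * r)) (r *: xi').
  rewrite !add0r mul0r mul1r lift_line0; apply=> z _.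
  rewrite liftZ; apply: (@cderiv_comp _ _ (lift_line xi' c') (fun s => 0 + s * r)).
    exact: cderiv_lin.
  exact: lift_line_deriv.
have H z : 0 <= z <= 1 -> cderiv (fun z => lift_line xi c (s + z * t)) z
    (X (lift_line xi c (s + z * t)) (t *: xi)).
  move=> _; rewrite liftZ.
  apply: (@cderiv_comp _ _ (lift_line xi c) (fun z => s + z * t)).
    exact: cderiv_lin.
  exact: lift_line_deriv.
by have := flow_ode H; rewrite mul0r addr0 mul1r !line.
Qed.

Lemma flow_line xi c t : cderiv (fun r => flow (r *: xi) c) t (X (flow (t *: xi) c) xi).
Proof.
have line r : lift_line xi c r = flow (r *: xi) c.
  have := @flow_ode (fun s => lift_line xi c (0 + s * r)) (r *: xi).
  rewrite !add0r mul0r mul1r lift_line0; apply=> z _.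
  rewrite liftZ; apply: (@cderiv_comp _ _ (lift_line xi c) (fun s => 0 + s * r)).
    exact: cderiv_lin.
  exact: lift_line_deriv.
rewrite -line; apply: cderiv_ext (lift_line_deriv xi c t) => r; exact: line.
Qed.

Lemma flow0 c : flow 0 c = c.
Proof.
have := @flow_ode (fun=> c) 0; move=> <- // t _.
by rewrite linear0; exact: cderiv_cst.
Qed.

Lemma flowK xi c : flow (- xi) (flow xi c) = c.
Proof. by rewrite -scaleN1r -{2}(scale1r xi) -flow_add subrr scale0r flow0. Qed.

Lemma flow_proj xi c : flow (P xi) c = flow xi c.
Proof.
apply/esym; have := @flow_ode (lift_line xi c) (P xi).
rewrite lift_line0; apply=> t _; rewrite proj_liftK; exact: lift_line_deriv.
Qed.

Lemma flow_dist xi c : `|flow xi c - c| <= Mb * `|xi|.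
Proof.
have := @mean_value_cst _ _ (lift_line xi c) _ (Mb * `|xi|) 0 1 ler01
  (fun t _ => lift_line_deriv xi c t).
rewrite lift_line0 subr0 mulr1; apply=> t _; exact: lift_norm.
Qed.

Lemma flow_taylor xi c : `|flow xi c - c - X c xi| <= L * Mb * `|xi| * `|xi|.
Proof.
have D t : cderiv (fun s => lift_line xi c s - (c + s *: X c xi)) t
    (X (lift_line xi c t) xi - X c xi).
  by apply: cderivB; [exact: lift_line_deriv|exact: cderiv_affine].
have := @mean_value_cst _ _ _ _ (L * Mb * `|xi| * `|xi|) 0 1 ler01 (fun t _ => D t).
rewrite lift_line0 scale0r addr0 subrr scale1r !subr0 mulr1 opprD addrA.
apply=> t /andP[t0 t1]; apply: le_trans (lift_lipschitz _ _ _ _) _.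
rewrite ler_wpM2r// -mulrA ler_wpM2l ?(ltW (lift_lip_gt0 X))//.
have := @mean_value_cst _ _ (lift_line xi c) _ (Mb * `|xi|) 0 t t0
  (fun t _ => lift_line_deriv xi c t).
rewrite lift_line0 subr0 => H.
apply: le_trans (H _) _ => [s _|]; first exact: lift_norm.
rewrite ler_piMr// mulr_ge0// ltW// lift_bound_gt0//.
Qed.

(** Lifting does not change the projection, so every flow line projects to a straight line with
    velocity [P xi]. *)
Lemma proj_flow xi c : P (flow xi c) = P c + P xi.
Proof.
have D t : cderiv (fun s => P (lift_line xi c s) - (P c + s *: P xi)) t 0.
  rewrite -[X in cderiv _ _ X](subrr (P xi)); apply: cderivB; last exact: cderiv_affine.
  rewrite -(lift_projK X (lift_line xi c t) xi).
  exact: (cderiv_linear _ (lift_line_deriv xi c t)).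
have := @mean_value_cst _ _ _ _ 0 0 1 ler01 (fun t _ => D t).
rewrite lift_line0 scale0r addr0 subrr scale1r !subr0 mul0r.
move=> H; apply/eqP; rewrite -subr_eq0 -normr_le0; apply: H => t _.
by rewrite normr0.
Qed.

Lemma lift_proj_idem v : P (P v) = P v.
Proof. by rewrite -[LHS](lift_projK X 0) proj_liftK lift_projK. Qed.

(* Loops made of four flow lines of size [e], with base vectors adding up to
   zero, close up to [o(e^2)]: a substitute for the vanishing of the curvature
   of the plane field, which need not be differentiable. *)
Definition loops_close (p0 : V) (r0 : R) := forall eta : R, 0 < eta ->
  exists2 e0 : R, 0 < e0 & forall e q x1 x2 x3 x4, 0 < e < e0 -> `|q - p0| <= r0 ->
    `|x1| <= e -> `|x2| <= e -> `|x3| <= e -> `|x4| <= e ->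
    x1 + x2 + x3 + x4 = 0 ->
    `|flow x4 (flow x3 (flow x2 (flow x1 q))) - q| <= eta * (e * e).

End LiftFlow.

(** * Additivity of the flows when small loops close *)

Section Integrability.
Variables (R : realType) (n : nat) (X : lift_field R n).
Local Notation V := 'rV[R]_n.
Local Notation P := (lift_proj X).
Local Notation L := (lift_lip X).
Local Notation Mb := (lift_bound X).
Variables (p0 : V) (r0 : R).
Hypothesis r0_gt0 : 0 < r0.
Hypothesis closing : loops_close X p0 r0.

(** A point within [rho] of [p0], moved along up to four flow lines with base vectors of size [rho],
    stays within [r0]. The bound [1 / 2] keeps sums of two base vectors in the unit ball, where
    [expR (2 * L)] controls the flows. *)
Definition flow_radius := Num.min (1 / 2) (r0 / (1 + 4 * Mb)).
Local Notation rho := flow_radius.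

Let Mb0 : 0 < Mb := lift_bound_gt0 X.
Let L0 : 0 < L := lift_lip_gt0 X.

Lemma flow_radius_gt0 : 0 < rho.
Proof.
have := Mb0 => Mb1; by rewrite lt_min divr_gt0//= divr_gt0//; lra.
Qed.

Let rho_half : rho <= 1 / 2.
Proof. by rewrite ge_min lexx. Qed.

Let rho_r0 : rho + 4 * (Mb * rho) <= r0.
Proof.
have Mb1 := Mb0; have H : rho <= r0 / (1 + 4 * Mb) by rewrite ge_min lexx orbT.
by move: H; rewrite ler_pdivlMr; lra.
Qed.

(* The thin triangle [0, x, x + h] is cut into [N ~ 1/|h|] quadrilaterals of
   size [|h|], each of which closes up to [o(|h|^2)]. *)
Lemma thin_triangle eta : 0 < eta -> exists2 d : R, 0 < d &
  forall c x h, `|c - p0| <= rho -> `|x| <= rho -> `|h| <= rho -> `|h| < d ->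
    `|flow X h (flow X x c) - flow X (x + h) c| <= eta * `|h|.
Proof.
move=> eta0.
set C := expR (2 * L); have C0 : 0 < C by exact: expR_gt0.
(* The factor 2 comes from [N <= 2 / |h|], and [C] from the growth of the accumulated errors along
   the flow. *)
have eta1 : 0 < eta / (2 * C) by rewrite divr_gt0// mulr_gt0.
have [e0 e00 close] := closing eta1; exists e0 => // c x h cp xr hr hd.
have [->|hn0] := eqVneq h 0.
  by rewrite addr0 flow0 subrr normr0 mulr0.
have h0 : 0 < `|h| by rewrite normr_gt0.
pose N := (Num.truncn (`|h|^-1)).+1.
have N1 : `|h|^-1 < N%:R by rewrite /N truncnS_gt.
have N2 : N%:R <= 2 / `|h|.
  have h1 : 1 <= `|h|^-1 by rewrite invf_ge1//; have := rho_half; lra.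
  have : (Num.truncn (`|h|^-1))%:R <= `|h|^-1 by rewrite truncn_le// invr_ge0.
  by rewrite /N -[_.+1%:R]natr1; lra.
have Npos : 0 < N%:R :> R by rewrite ltr0n.
have Nn0 : N%:R != 0 :> R by rewrite gt_eqF.
have Ninv : N%:R^-1 <= `|h|.
  by rewrite -[leRHS]invrK lef_pV2 ?posrE ?invr_gt0//; exact: ltW.
pose t (i : nat) : R := i%:R / N%:R.
have tS i : t i.+1 = t i + N%:R^-1 by rewrite /t -natr1 mulrDl mul1r.
have t01 i : (i <= N)%N -> 0 <= t i <= 1.
  move=> iN; rewrite /t divr_ge0//= ler_pdivrMr// mul1r ler_nat//.
(* [A i] runs along the side [x], [B i] is reached from it along a segment parallel to [h], and
   [D i] is the gap between [B i] and the third side. *)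
pose A i := flow X (t i *: x) c.
pose B i := flow X (t i *: h) (A i).
pose D i := `|B i - flow X (t i *: (x + h)) c|.
set a := 2 * (L * `|N%:R^-1 *: (x + h)|).
have a0 : 0 <= a by rewrite !mulr_ge0// ltW.
set k := eta / (2 * C) * (`|h| * `|h|).
have k0 : 0 <= k by apply: mulr_ge0; [exact: ltW|exact: mulr_ge0].
have nrm r (v : V) : 0 <= r <= 1 -> `|r *: v| <= `|v|.
  by move=> /andP[r1 r2]; rewrite normrZ ger0_norm// ler_piMl.
have small (v : V) : `|v| <= 1 -> `|N%:R^-1 *: v| <= `|h|.
  move=> v1; rewrite normrZ ger0_norm ?invr_ge0 ?(ltW Npos)//.
  apply: le_trans Ninv; rewrite ler_piMr// invr_ge0 ltW//.
have xh1 : `|x + h| <= 1 by have := ler_normD x h; have := rho_half; lra.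
(* The quadrilateral starts at the right-hand point, returns to [B i] and then to [A i], advances to
   [A i.+1] and climbs to [B i.+1]; its base vectors sum to zero because [t i.+1 = t i + 1 / N]. *)
have step i : (i < N)%N -> `|B i.+1 - flow X (N%:R^-1 *: (x + h)) (B i)| <= k.
  move=> iN.
  have ti := t01 i (ltnW iN); have ti1 := t01 i.+1 iN.
  have := close `|h| (flow X (N%:R^-1 *: (x + h)) (B i))
    (- (N%:R^-1 *: (x + h))) (- (t i *: h)) (N%:R^-1 *: x) (t i.+1 *: h).
  rewrite flowK /B flowK -/(B _).
  rewrite /A -flow_add -tS -/(A _).
  apply.
  - by rewrite h0 hd.
  - have d1 := flow_dist X (t i *: x) c; rewrite -/(A i) in d1.
    have d2 := flow_dist X (t i *: h) (A i).
    have d3 := flow_dist X (N%:R^-1 *: (x + h)) (flow X (t i *: h) (A i)).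
    have s1 : Mb * `|t i *: x| <= Mb * rho.
      by rewrite ler_wpM2l ?(ltW Mb0)// (le_trans (nrm _ _ ti)).
    have s2 : Mb * `|t i *: h| <= Mb * rho.
      by rewrite ler_wpM2l ?(ltW Mb0)// (le_trans (nrm _ _ ti)).
    have s3 : Mb * `|N%:R^-1 *: (x + h)| <= Mb * rho.
      by rewrite ler_wpM2l ?(ltW Mb0)// (le_trans (small _ xh1)).
    have q1 := ler_distD (A i) (flow X (t i *: h) (A i)) p0.
    have q2 := ler_distD c (A i) p0.
    have q3 := ler_distD (flow X (t i *: h) (A i))
       (flow X (N%:R^-1 *: (x + h)) (flow X (t i *: h) (A i))) p0.
    have := rho_r0; have : 0 <= Mb * rho by rewrite mulr_ge0// ltW// flow_radius_gt0.
    lra.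
  - by rewrite normrN small.
  - by rewrite normrN nrm.
  - by rewrite small//; have := rho_half; lra.
  - by rewrite nrm.
  - rewrite tS scalerDr scalerDl; apply/rowP => j; rewrite !mxE; ring.
(* Discrete Gronwall: each step adds the closing error [k] and multiplies the previous gap by at
   most [expR a]. *)
have Dstep i : (i <= N)%N -> D i <= i%:R * k * expR (a * i%:R).
  elim: i => [_|i IH iN].
    rewrite !mul0r /D /B /A /t mul0r !scale0r !flow0 subrr normr0 //.
  have E : flow X (t i.+1 *: (x + h)) c =
     flow X (N%:R^-1 *: (x + h)) (flow X (t i *: (x + h)) c).
    by rewrite tS flow_add.
  have H1 := flow_lipschitz X (N%:R^-1 *: (x + h)) (B i) (flow X (t i *: (x + h)) c).
  have H2 : D i.+1 <= k + expR a * D i.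
    rewrite /D E; apply: le_trans (ler_distD (flow X (N%:R^-1 *: (x + h)) (B i)) _ _) _.
    by apply: lerD H1; exact: step.
  apply: le_trans H2 _.
  have H3 := ler_wpM2l (expR_ge0 a) (IH (ltnW iN)).
  have e1 : expR (a * i.+1%:R) = expR a * expR (a * i%:R).
    by rewrite -expRD -natr1; congr expR; ring.
  have e2 : 1 <= expR (a * i.+1%:R) by rewrite -expR0 ler_expR mulr_ge0.
  have e3 : k <= k * expR (a * i.+1%:R) by rewrite ler_peMr.
  have -> : i.+1%:R * k * expR (a * i.+1%:R) =
     k * expR (a * i.+1%:R) + expR a * (i%:R * k * expR (a * i%:R)).
    by rewrite e1 -natr1; ring.
  exact: lerD.
have := Dstep N (leqnn N).
rewrite /D /B /A /t divff// !scale1r => /le_trans; apply.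
have -> : a * N%:R = 2 * (L * `|x + h|).
  by rewrite /a normrZ ger0_norm ?invr_ge0 ?(ltW Npos)//; field.
have F1 : expR (2 * (L * `|x + h|)) <= C.
  rewrite ler_expR ler_pM2l// ler_piMr// ltW//.
have F2 : N%:R * k <= eta / C * `|h|.
  apply: (@le_trans _ _ (2 / `|h| * k)); first exact: ler_wpM2r.
  rewrite le_eqVlt; apply/orP; left; apply/eqP; rewrite /k; field.
  by rewrite normr_eq0 hn0 gt_eqF.
apply: (@le_trans _ _ (eta / C * `|h| * C)).
  by apply: ler_pM => //; exact: mulr_ge0.
by rewrite mulrAC divfK// gt_eqF.
Qed.

(** By the thin triangle, flowing along [y] agrees to first order with flowing along [x] and then
    along [y - x], and the last flow is its own lifted vector up to a quadratic error. *)
Lemma flow_differentiable c x eta : `|c - p0| <= rho -> `|x| <= rho -> 0 < eta ->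
  \forall y \near x,
    `|flow X y c - flow X x c - X (flow X x c) (y - x)| <= eta * `|y - x|.
Proof.
move=> cp xr eta0.
have eta2 : 0 < eta / 2 by lra.
have [d d0 thin] := thin_triangle eta2.
set K := L * Mb; have K0 : 0 < K by rewrite mulr_gt0.
pose e := Num.min d (Num.min rho (eta / 2 / K)).
have e0 : 0 < e by rewrite lt_min d0 lt_min flow_radius_gt0 divr_gt0.
apply: filterS (near_norm_lt x e0) => y; rewrite lt_min => /andP[yd].
rewrite lt_min => /andP[yr yK].
have H1 := thin c x (y - x) cp xr (ltW yr) yd.
rewrite (addrC x) subrK in H1.
have H2 := flow_taylor X (y - x) (flow X x c).
have H3 : L * Mb * `|y - x| * `|y - x| <= eta / 2 * `|y - x|.
  by rewrite ler_wpM2r// mulrC -ler_pdivlMr// ltW.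
have -> : flow X y c - flow X x c - X (flow X x c) (y - x) =
  (flow X y c - flow X (y - x) (flow X x c)) +
  (flow X (y - x) (flow X x c) - flow X x c - X (flow X x c) (y - x)).
  by rewrite !addrA subrK.
apply: le_trans (ler_normD _ _) _; rewrite (distrC (flow X y c)); lra.
Qed.

(** By [flow_differentiable], the curve [t |-> flow (x + t h) c] solves the equation of the flow
    line of [h] starting at [flow x c]. Uniqueness makes the triangles close exactly. *)
Lemma flow_comp c x h : `|c - p0| <= rho -> `|x| <= rho / 2 -> `|h| <= rho / 2 ->
  flow X h (flow X x c) = flow X (x + h) c.
Proof.
move=> cp xr hr.
have := @flow_ode _ _ X (fun t => flow X (x + t *: h) c) h.
rewrite scale0r addr0 scale1r => -> // t /andP[t0 t1] e e0.
have xt : `|x + t *: h| <= rho.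
  apply: le_trans (ler_normD _ _) _; rewrite normrZ ger0_norm//.
  have : t * `|h| <= `|h| by rewrite ler_piMl.
  lra.
have h1 : 0 < `|h| + 1 by have := normr_ge0 h; lra.
have [d /= d0 Hd] := (@nbhs_ballP _ _ _ _).1 (flow_differentiable cp xt (divr_gt0 e0 h1)).
apply: filterS (@near_norm_lt R R t _ (divr_gt0 d0 h1)) => s.
rewrite ltr_pdivlMr// => st.
have := Hd (x + s *: h).
have E : x + s *: h - (x + t *: h) = (s - t) *: h.
  by rewrite opprD addrACA subrr add0r scalerBl.
have H1 : `|(s - t) *: h| < d.
  rewrite normrZ; apply: le_lt_trans st; rewrite ler_wpM2l//; lra.
rewrite -ball_normE /= distrC E liftZ => /(_ H1) /le_trans; apply.
rewrite normrZ mulrAC ler_pdivrMr// -[leRHS]mulrA.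
by rewrite ler_wpM2l ?(ltW e0)// ler_wpM2l//; lra.
Qed.

(* The transverse coordinate [flow (- (u t - u a)) (u t)] has zero derivative
   along a curve [u] tangent to the plane field. *)
Lemma tangent_curve_flow (u u' : R -> V) a b : a <= b ->
  (forall t, a <= t <= b -> cderiv u t (u' t)) ->
  (forall t, a <= t <= b -> X (u t) (u' t) = u' t) ->
  (forall t, a <= t <= b -> `|u t - p0| <= rho) ->
  (forall t, a <= t <= b -> `|u t - u a| <= rho / 4) ->
  flow X (- (u b - u a)) (u b) = u a.
Proof.
move=> ab Hu Hu' Hp Ha.
have r4 : 0 < rho / 4 by rewrite divr_gt0// flow_radius_gt0.
have D t : a <= t <= b -> cderiv (fun s => flow X (- (u s - u a)) (u s)) t 0.
  move=> tab e e0.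
  set C := expR (2 * L); have C0 : 0 < C by exact: expR_gt0.
  set k := `|u' t| + 1.
  have k0 : 0 < k by rewrite /k; have := normr_ge0 (u' t); lra.
  set K := L * Mb; have K0 : 0 < K by rewrite mulr_gt0.
  have Mb1 := Mb0; set K1 := 1 + Mb; have K10 : 0 < K1 by rewrite /K1; lra.
  have eK : 0 < e / 2 / (C * K1) by rewrite !divr_gt0// mulr_gt0.
  have rk : 0 < rho / 4 / k by rewrite divr_gt0.
  have ek : 0 < e / 2 / (C * K * k * k) by rewrite !divr_gt0// !mulr_gt0.
  have H1 := Hu t tab _ ltr01.
  have H2 := Hu t tab _ eK.
  have H3 := @near_norm_lt R R t _ rk.
  have H4 := @near_norm_lt R R t _ ek.
  near=> s.
  have h1 : `|u s - u t - (s - t) *: u' t| <= 1 * `|s - t| by near: s.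
  have h2 : `|u s - u t - (s - t) *: u' t| <= e / 2 / (C * K1) * `|s - t| by near: s.
  have h3 : `|s - t| < rho / 4 / k by near: s.
  have h4 : `|s - t| < e / 2 / (C * K * k * k) by near: s.
  set y := u s - u t.
  have yk : `|y| <= k * `|s - t|.
    have -> : y = (y - (s - t) *: u' t) + (s - t) *: u' t by rewrite subrK.
    apply: le_trans (ler_normD _ _) _; rewrite normrZ /k mulrDl mul1r addrC mulrC.
    by rewrite lerD2l; rewrite mul1r in h1.
  have y4 : `|y| <= rho / 4.
    apply: le_trans yk _; rewrite mulrC -ler_pdivlMr//; exact: ltW.
  have us : `|u s - u a| <= rho / 2.
    have := ler_distD (u t) (u s) (u a); rewrite -/y; have := Ha t tab; lra.
  (* Both values become images under the same flow: the point at time [t] is first moved along [y],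
     which lands close to [u s]. The radii [rho / 4] leave room for [flow_comp], which requires
     [rho / 2]. *)
  have E : flow X (- (u t - u a)) (u t) = flow X (- (u s - u a)) (flow X y (u t)).
    rewrite flow_comp ?normrN//; first by congr flow; rewrite /y; apply/rowP => j; rewrite !mxE; ring.
      exact: Hp.
    by lra.
  rewrite scaler0 subr0 E.
  apply: le_trans (flow_lipschitz _ _ _ _) _.
  have F1 : expR (2 * (L * `|- (u s - u a)|)) <= C.
    rewrite ler_expR ler_pM2l// ler_piMr ?(ltW L0)// normrN; have := rho_half; lra.
  (* The velocity [u' t] is fixed by the lift, so the first-order terms cancel and only the
     remainder of [u] and a quadratic term are left. *)
  have F2 : `|u s - flow X y (u t)| <= K1 * `|y - (s - t) *: u' t| + K * `|y| * `|y|.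
    have -> : u s - flow X y (u t) = (y - (s - t) *: u' t)
      - X (u t) (y - (s - t) *: u' t) - (flow X y (u t) - u t - X (u t) y).
      rewrite linearB liftZ (Hu' t tab) /y; apply/rowP => j; rewrite !mxE; ring.
    apply: le_trans (ler_normB _ _) _; apply: lerD; last exact: flow_taylor.
    apply: le_trans (ler_normB _ _) _; rewrite /K1 mulrDl mul1r lerD2l.
    exact: lift_norm.
  have F3 : K1 * `|y - (s - t) *: u' t| <= e / 2 / C * `|s - t|.
    have := ler_wpM2l (ltW K10) h2; rewrite -/y => /le_trans; apply.
    rewrite le_eqVlt; apply/orP; left; apply/eqP; field.
    by rewrite !gt_eqF.
  have F4 : K * `|y| * `|y| <= e / 2 / C * `|s - t|.
    apply: (@le_trans _ _ (K * (k * `|s - t|) * (k * `|s - t|))).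
      apply: ler_pM => //; first by rewrite mulr_ge0// ltW.
      by rewrite ler_wpM2l// ltW.
    have -> : K * (k * `|s - t|) * (k * `|s - t|) = (K * k * k * `|s - t|) * `|s - t| by ring.
    rewrite ler_wpM2r//.
    have := ltW h4; rewrite ler_pdivlMr; last by rewrite !mulr_gt0.
    by move=> H5; rewrite (ler_pdivlMr _ _ C0); apply: le_trans H5; rewrite le_eqVlt; apply/orP; left; apply/eqP; ring.
  apply: (@le_trans _ _ (C * (e / C * `|s - t|))).
    apply: ler_pM => //.
    apply: le_trans F2 _; apply: le_trans (lerD F3 F4) _.
    rewrite le_eqVlt; apply/orP; left; apply/eqP; field.
    by rewrite gt_eqF.
  by rewrite mulrA mulrCA mulfV ?gt_eqF// mulr1.
have := @mean_value_cst _ _ _ _ 0 a b ab D.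
rewrite subrr oppr0 flow0 mul0r => H; apply/eqP; rewrite -subr_eq0 -normr_le0.
by apply: H => t _; rewrite normr0.
Unshelve. all: by end_near. Qed.

End Integrability.

(** * A C^1 step function *)

Section SmoothStep.
Variable R : realType.

Let pos2 (x : R) : R := Num.max 0 x * Num.max 0 x.

Let pos2_deriv (x : R) : cderiv pos2 x (2 * Num.max 0 x).
Proof.
have bound y : `|pos2 y - pos2 x - (y - x) *: (2 * Num.max 0 x)| <= `|y - x| * `|y - x|.
  rewrite -normrM [`|(y - x) * _|]ger0_norm; last by rewrite -expr2 sqr_ge0.
  rewrite /pos2 -[_ *: _]/(_ * _) ler_norml.
  have x2 := sqr_ge0 x; have y2 := sqr_ge0 y; rewrite !expr2 in x2 y2.
  have [x0|/ltW x0] := leP 0 x; have [y0|/ltW y0] := leP 0 y.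
  - have := sqr_ge0 (y - x); rewrite expr2; lra.
  - have := mulr_ge0_le0 x0 y0; lra.
  - have := mulr_le0_ge0 x0 y0; lra.
  - have := sqr_ge0 (y - x); rewrite expr2; lra.
move=> e e0; apply: filterS (@near_norm_lt R R x _ e0) => y yx.
by apply: le_trans (bound y) _; rewrite ler_wpM2r// ltW.
Qed.

(** Second differences of the C^1 function [max(0, x)^2]: the derivative is the tent of height 2
    over [[0, 1]]. Reparametrising by [sstep] makes a curve start and stop with zero velocity. *)
Definition sstep (t : R) : R :=
  2 * (pos2 t - 2 * pos2 (t - 1 / 2) + pos2 (t - 1)).

Definition sstep' (t : R) : R :=
  4 * (Num.max 0 t - 2 * Num.max 0 (t - 1 / 2) + Num.max 0 (t - 1)).

Lemma sstep_deriv t : cderiv sstep t (sstep' t).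
Proof.
have sh (a : R) : cderiv (fun s => pos2 (s - a)) t (2 * Num.max 0 (t - a)).
  rewrite -[2 * _]scale1r; apply: (@cderiv_comp _ _ pos2 (fun s => s - a)); last exact: pos2_deriv.
  apply: cderiv_ext (cderiv_lin (- a) 1 t) => s.
  by rewrite mulr1 addrC.
have -> : sstep' t = 2 *: (2 * Num.max 0 t - 2 *: (2 * Num.max 0 (t - 1 / 2)) + 2 * Num.max 0 (t - 1)).
  by rewrite /sstep' /GRing.scale /=; ring.
apply: cderivZ; apply: cderivD; last exact: sh.
by apply: cderivB; [exact: pos2_deriv|apply: cderivZ; exact: sh].
Qed.

Lemma sstep_le0 t : t <= 0 -> sstep t = 0.
Proof.
move=> t0; rewrite /sstep /pos2 !max_l//; first by ring.
all: by lra.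
Qed.

Lemma sstep_ge1 t : 1 <= t -> sstep t = 1.
Proof.
move=> t0; rewrite /sstep /pos2 !max_r; first by field.
all: by lra.
Qed.

Lemma sstep'_le2 t : `|sstep' t| <= 2.
Proof.
rewrite /sstep' ler_norml; have [h1|h1] := leP 0 t; have [h2|h2] := leP 0 (t - 1 / 2);
  have [h3|h3] := leP 0 (t - 1); lra.
Qed.

End SmoothStep.

(** * Germs of tangent paths *)

Section Paths.
Variables (R : realType) (n : nat).
Local Notation V := 'rV[R]_n.
Implicit Types (E : V -> V -> Prop) (c : R -> V).

(** Differentiable paths constant outside [[0, 1]] have zero velocity at their ends. They can
    therefore be concatenated without one-sided derivatives. *)
Definition stopped (T : Type) (c : R -> T) :=
  (forall t, t <= 0 -> c t = c 0) /\ (forall t, 1 <= t -> c t = c 1).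

Lemma cderiv_stop (W : normedModType R) (c : R -> W) t v :
  (forall s, t <= s -> c s = c t) \/ (forall s, s <= t -> c s = c t) ->
  cderiv c t v -> v = 0.
Proof.
move=> Hc H; apply/eqP; rewrite -normr_le0; apply/ler_addgt0Pr => e e0.
rewrite add0r.
have /nbhs_ballP[d /= d0 Hd] := H e e0.
have [s [sd st cst]] : exists s, [/\ `|t - s| < d, s != t & c s = c t].
  case: Hc => Hc.
    exists (t + d / 2); split.
    - by rewrite opprD addrA subrr sub0r normrN ger0_norm; lra.
    - by apply/eqP; lra.
    - by apply: Hc; lra.
  exists (t - d / 2); split.
    - by rewrite opprD addrA subrr sub0r opprK ger0_norm; lra.
    - by apply/eqP; lra.
    - by apply: Hc; lra.
have := Hd s; rewrite /ball /= => /(_ sd).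
rewrite cst subrr sub0r normrN normrZ mulrC ler_pM2r// normr_gt0 subr_eq0.
by [].
Qed.

Lemma stopped_deriv0 (W : normedModType R) (c : R -> W) t v : stopped c ->
  (t <= 0) || (1 <= t) -> cderiv c t v -> v = 0.
Proof.
move=> [c0 c1] /orP[t0|t1]; apply: cderiv_stop.
  by right => s st; rewrite c0 ?(le_trans st)// (c0 t).
by left => s ts; rewrite c1 ?(le_trans t1)// (c1 t).
Qed.

Record tangent_path E c (c' : R -> V) : Prop := TangentPath {
  tp_deriv : forall t, cderiv c t (c' t);
  tp_tangent : forall t, E (c t) (c' t);
  tp_stopped : stopped c
}.

Lemma path_dist E c c' (e : R) t : tangent_path E c c' -> (forall s, `|c' s| <= e) ->
  `|c t - c 0| <= e.
Proof.
move=> cp ce.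
have e0 : 0 <= e by exact: le_trans (normr_ge0 _) (ce 0).
have H s : 0 <= s <= 1 -> `|c s - c 0| <= e.
  move=> /andP[s0 s1]; have := @mean_value_cst _ _ c c' e 0 s s0 (fun t _ => tp_deriv cp t) (fun t _ => ce t).
  by rewrite subr0 => /le_trans; apply; rewrite ler_piMr.
have [t0|/ltW t0] := leP t 0; first by rewrite (tp_stopped cp).1// subrr normr0.
have [t1|/ltW t1] := leP t 1; first by apply: H; rewrite t0.
by rewrite (tp_stopped cp).2//; apply: H; rewrite ler01 lexx.
Qed.

(** For stopped paths with [c 1 = d 0], one of the two moving terms is always constant. A formula
    without cases gives differentiability at the junction from the sum rule. *)
Definition concat c d : R -> V := fun t => c (2 * t) + d (2 * t - 1) - d 0.

Lemma concat_path E c c' d d' (e : R) :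
  (forall q (a : R) v, E q v -> E q (a *: v)) ->
  tangent_path E c c' -> tangent_path E d d' -> c 1 = d 0 ->
  (forall t, `|c' t| <= e) -> (forall t, `|d' t| <= e) ->
  exists f', [/\ tangent_path E (concat c d) f', concat c d 0 = c 0,
    concat c d 1 = d 1 & forall t, `|f' t| <= 2 * e].
Proof.
move=> Escal cp dp cd ce de.
have e0 : 0 <= e by exact: le_trans (normr_ge0 _) (ce 0).
have L t : t <= 1 / 2 -> concat c d t = c (2 * t).
  by move=> t2; rewrite /concat (tp_stopped dp).1 ?addrK//; lra.
have U t : 1 / 2 <= t -> concat c d t = d (2 * t - 1).
  by move=> t2; rewrite /concat (tp_stopped cp).2 ?cd 1?addrC ?addrA ?addNr ?add0r//; lra.
have half (f f' : R -> V) (b : R) : (forall t, cderiv f t (f' t)) ->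
    forall t, cderiv (fun s => f (2 * s + b)) t (2 *: f' (2 * t + b)).
  move=> Hf t; apply: (@cderiv_comp _ _ f (fun s => 2 * s + b)) => //.
  by apply: cderiv_ext (cderiv_lin b 2 t) => s; rewrite addrC mulrC.
pose f' t := 2 *: c' (2 * t + 0) + 2 *: d' (2 * t + -1) - 0.
have Df t : cderiv (concat c d) t (f' t).
  apply: cderivB; last exact: cderiv_cst.
  apply: cderivD; last by apply: half => s; exact: (tp_deriv dp).
  have := half _ _ 0 (tp_deriv cp) t; apply: cderiv_ext => s; by rewrite addr0.
have fE t : (t <= 1 / 2 /\ f' t = 2 *: c' (2 * t)) \/ (1 / 2 <= t /\ f' t = 2 *: d' (2 * t - 1)).
  have [t2|/ltW t2] := leP t (1 / 2); [left|right]; split=> //; rewrite /f' subr0 addr0.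
    rewrite (stopped_deriv0 (tp_stopped dp) _ (tp_deriv dp _)) ?scaler0 ?addr0//.
    by apply/orP; left; lra.
  rewrite (stopped_deriv0 (tp_stopped cp) _ (tp_deriv cp _)) ?scaler0 ?add0r//.
  by apply/orP; right; lra.
exists f'; split.
- split=> //.
    move=> t; have [[t2 ->]|[t2 ->]] := fE t.
      by rewrite L//; apply: Escal; exact: (tp_tangent cp).
    by rewrite U//; apply: Escal; exact: (tp_tangent dp).
  split=> t tt.
    by rewrite !L//; [rewrite mulr0 (tp_stopped cp).1//; lra|lra..].
  by rewrite !U//; [rewrite [RHS](tp_stopped dp).2 ?(tp_stopped dp).2//; lra|lra..].
- by rewrite L ?mulr0//; lra.
- by rewrite U ?mulr1//; [congr d; lra|lra].
- move=> t; have [[_ ->]|[_ ->]] := fE t; rewrite normrZ ger0_norm// ler_wpM2l//.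
Qed.

(* [nu] measures speeds and [N] transverse displacements.  Paths of speed [e]
   are only required to end at distance [O(e^2)] from their origin: the radius
   [r] depends on the implicit constant [K], but [C] does not. *)
Definition germ_bound E x (nu N : V -> R) (C : R) :=
  forall K, 0 < K -> exists2 r, 0 < r & forall c c' e,
    tangent_path E c c' -> (forall t, `|c t - x| < r) -> 0 < e < r ->
    (forall t, nu (c' t) <= e) -> `|c 1 - c 0| <= K * (e * e) ->
    N (c 1 - c 0) <= C * (e * e).

Lemma germ_bound_le E x nu N C D : C <= D -> germ_bound E x nu N C -> germ_bound E x nu N D.
Proof.
move=> CD H K K0; have [r r0 Hr] := H K K0; exists r => // c c' e cp cx er ce cK.
apply: le_trans (Hr c c' e cp cx er ce cK) _; rewrite ler_wpM2r//.
by case/andP: er => /ltW e0 _; exact: mulr_ge0.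
Qed.

End Paths.

(** * Transverse displacement of tangent paths *)

Section LiftPaths.
Variables (R : realType) (n : nat) (X : lift_field R n).
Local Notation V := 'rV[R]_n.
Local Notation P := (lift_proj X).
Local Notation L := (lift_lip X).
Local Notation Mb := (lift_bound X).

Definition fixed_by (q v : V) : Prop := X q v = v.

(** The derivative of [c - X (c 0) c] is [(X (c t) - X (c 0)) (c' t)]: the path moves by at most
    [e], the lift varies by [L e], and the speed contributes the second factor [e]. *)
Lemma lift_path_defect c c' (e : R) : tangent_path fixed_by c c' ->
  (forall t, `|c' t| <= e) ->
  `|c 1 - c 0 - X (c 0) (c 1 - c 0)| <= L * (e * e).
Proof.
move=> cp ce.
have e0 : 0 <= e by exact: le_trans (normr_ge0 _) (ce 0).
have D t : cderiv (fun s => c s - X (c 0) (c s)) t (c' t - X (c 0) (c' t)).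
  by apply: cderivB; [exact: (tp_deriv cp)|exact: (cderiv_linear _ (tp_deriv cp t))].
have := @mean_value_cst _ _ _ _ (L * (e * e)) 0 1 ler01 (fun t _ => D t).
rewrite subr0 mulr1 => H.
have -> : c 1 - c 0 - X (c 0) (c 1 - c 0) = c 1 - X (c 0) (c 1) - (c 0 - X (c 0) (c 0)).
  rewrite linearB; move: (X _ (c 1)) (X _ (c 0)) => y z.
  by apply/rowP => j; rewrite !mxE; ring.
apply: H => t _; rewrite -{1}(tp_tangent cp t).
apply: le_trans (lift_lipschitz _ _ _ _) _.
rewrite -mulrA ler_wpM2l ?(ltW (lift_lip_gt0 X))//.
by apply: ler_pM => //; exact: path_dist cp ce.
Qed.

(** One [L] is the defect measured at [c 0], the other the cost of measuring it at [x]. This cost is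
    [L * |c 0 - x|] times the displacement [K * e^2], so taking [r <= 1 / K] removes [K] from the
    final constant. *)
Lemma lift_germ_bound (E : V -> V -> Prop) x (r0 : R) : 0 < r0 ->
  (forall q v, `|q - x| < r0 -> E q v -> X q v = v) ->
  germ_bound E x Num.norm (fun v => `|v - X x v|) (2 * L).
Proof.
move=> r00 HE K K0.
pose r := Num.min r0 K^-1.
have rpos : 0 < r by rewrite lt_min r00 invr_gt0.
exists r => // c c' e cp cx /andP[e0 er] ce cK.
have cp' : tangent_path fixed_by c c'.
  split; [exact: (tp_deriv cp)| |exact: (tp_stopped cp)] => t.
  by apply: HE; [apply: lt_le_trans (cx t) _; rewrite ge_min lexx|exact: (tp_tangent cp)].
have H1 := lift_path_defect cp' ce.
set d := c 1 - c 0 in cK H1 *.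
have -> : d - X x d = (d - X (c 0) d) + (X (c 0) d - X x d) by rewrite addrA subrK.
apply: le_trans (ler_normD _ _) _.
have H2 := lift_lipschitz X (c 0) x d.
have H3 : L * `|c 0 - x| * `|d| <= L * (e * e).
  rewrite -mulrA ler_wpM2l ?(ltW (lift_lip_gt0 X))//.
  apply: (@le_trans _ _ (K^-1 * (K * (e * e)))).
    apply: ler_pM => //; apply: ltW; apply: lt_le_trans (cx 0) _.
    by rewrite ge_min lexx orbT.
  by rewrite mulKf// gt_eqF.
by lra.
Qed.

Definition flow_path (xi c : V) : R -> V := fun t => flow X (sstep t *: xi) c.

Lemma flow_path_tangent xi c :
  tangent_path fixed_by (flow_path xi c)
    (fun t => sstep' t *: X (flow_path xi c t) xi).
Proof.
split.
- move=> t; apply: (@cderiv_comp _ _ (fun r => flow X (r *: xi) c) (@sstep R)).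
    exact: sstep_deriv.
  exact: flow_line.
- by move=> t; rewrite /fixed_by liftZ -(proj_liftK X _ (X _ _)) lift_projK proj_liftK.
- split=> t tt; rewrite /flow_path.
    by rewrite sstep_le0// (@sstep_le0 _ 0).
  by rewrite sstep_ge1// (@sstep_ge1 _ 1).
Qed.

Lemma flow_path0 xi c : flow_path xi c 0 = c.
Proof. by rewrite /flow_path sstep_le0// scale0r flow0. Qed.

Lemma flow_path1 xi c : flow_path xi c 1 = flow X xi c.
Proof. by rewrite /flow_path sstep_ge1// scale1r. Qed.

(** The radius of a germ bound depends on its centre, whereas the scale [e0] of the closing property
    must be uniform: compactness of the closed ball supplies it. *)
Lemma flow_loop_closing (p0 : V) (r0 : R) : 0 < r0 ->
  (forall y eta, `|y - p0| <= r0 -> 0 < eta ->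
    germ_bound fixed_by y Num.norm (fun v => `|v - X y v|) eta) ->
  loops_close X p0 r0.
Proof.
move=> r00 H eta eta0.
have L0 := lift_lip_gt0 X; have Mb0 := lift_bound_gt0 X.
pose Q (e0 : R) (q : V) := forall e x1 x2 x3 x4, 0 < e < e0 ->
    `|x1| <= e -> `|x2| <= e -> `|x3| <= e -> `|x4| <= e ->
    x1 + x2 + x3 + x4 = 0 ->
    `|flow X x4 (flow X x3 (flow X x2 (flow X x1 q))) - q| <= eta * (e * e).
pose B := [set q : V | `|q - p0| <= r0].
have cB : compact B.
  apply: bounded_closed_compact.
    exists (`|p0| + r0); split; first exact: num_real.
    move=> M HM q; rewrite /B /= => qB; apply: ltW; apply: le_lt_trans HM.
    by rewrite -{1}(subrK p0 q) addrC (le_trans (ler_normD _ _))// lerD2l.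
  have -> : B = (fun q => `|q - p0|) @^-1` [set x | x <= r0] by [].
  apply: closed_comp; last exact: closed_le.
  have cf : continuous (fun q : V => q - p0).
    apply: (@lipschitz_continuous _ _ _ 1) => z w.
    by rewrite mul1r opprB addrA subrK.
  move=> q _; exact: (continuous_comp (cf q) (@norm_continuous _ _ (q - p0))).
have /compact_near_coveringP cov := cB.
have cover : \forall e0 \near 0^'+, B `<=` Q e0.
  apply: cov => y yB.
  (* A flow path has speed at most [2 * Mb * e], since [sstep'] is at most 2, and each of the two
     levels of concatenation doubles the speed. *)
  pose s := 8 * Mb; have s0 : 0 < s by rewrite mulr_gt0.
  have eta1 : 0 < eta / (s * s) by rewrite divr_gt0// mulr_gt0.
  have [r rpos Hr] := H y _ yB eta1 L L0.
  pose d := r / 2; have d0 : 0 < d by rewrite divr_gt0.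
  pose e1 := d / s; have e10 : 0 < e1 by rewrite divr_gt0.
  exists (ball y d, [set e0 : R | e0 < e1]).
    split; first exact: nbhsx_ballx.
    exact: nbhs_right_lt.
  move=> [q e0] /= [yq ee] e x1 x2 x3 x4 /andP[epos elt] h1 h2 h3 h4 hs.
  pose f1 := flow_path x1 q; pose q1 := flow X x1 q.
  pose f2 := flow_path x2 q1; pose q2 := flow X x2 q1.
  pose f3 := flow_path x3 q2; pose q3 := flow X x3 q2.
  pose f4 := flow_path x4 q3.
  have sp x c t : `|x| <= e -> `|sstep' t *: X (flow_path x c t) x| <= 2 * Mb * e.
    move=> xe; rewrite normrZ -mulrA; apply: ler_pM => //; first exact: sstep'_le2.
    by apply: le_trans (lift_norm _ _ _) _; rewrite ler_wpM2l// ltW.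
  have scal q' (a : R) v : fixed_by q' v -> fixed_by q' (a *: v).
    by rewrite /fixed_by liftZ => ->.
  have [f12' [p12 i12 j12 b12]] : exists f', [/\ tangent_path fixed_by (concat f1 f2) f',
     concat f1 f2 0 = f1 0, concat f1 f2 1 = f2 1 & forall t, `|f' t| <= 2 * (2 * Mb * e)].
    apply: (concat_path scal (flow_path_tangent x1 q) (flow_path_tangent x2 q1)).
    - by rewrite flow_path1 flow_path0.
    - by move=> t; exact: sp.
    - by move=> t; exact: sp.
  have [f34' [p34 i34 j34 b34]] : exists f', [/\ tangent_path fixed_by (concat f3 f4) f',
     concat f3 f4 0 = f3 0, concat f3 f4 1 = f4 1 & forall t, `|f' t| <= 2 * (2 * Mb * e)].
    apply: (concat_path scal (flow_path_tangent x3 q2) (flow_path_tangent x4 q3)).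
    - by rewrite flow_path1 flow_path0.
    - by move=> t; exact: sp.
    - by move=> t; exact: sp.
  have glue : concat f1 f2 1 = concat f3 f4 0.
    by rewrite j12 i34 /f2 /f3 flow_path1 flow_path0.
  have [f' [pf i0 i1 bf]] := concat_path scal p12 p34 glue b12 b34.
  set g := concat _ _ in pf i0 i1 *.
  have g0 : g 0 = q by rewrite i0 i12 /f1 flow_path0.
  have g1 : g 1 = flow X x4 q3 by rewrite i1 j34 /f4 flow_path1.
  have se : 2 * (2 * (2 * Mb * e)) = s * e by rewrite /s; ring.
  rewrite se in bf.
  have sed : s * e < d.
    by rewrite mulrC -ltr_pdivlMr//; exact: lt_trans elt ee.
  (* The base vectors sum to zero, so the displacement of the loop is killed by every lift and
     equals its own transverse defect. Hence [lift_path_defect] supplies the condition on the ends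
     with the constant [L], independent of the loop. *)
  have K1 : P (g 1 - g 0) = 0.
    rewrite linearB g1 g0 /q3 /q2 /q1 !proj_flow -[RHS](linear0 P) -hs !linearD.
    by apply/rowP => j; rewrite !mxE; ring.
  have X0 z : X z (g 1 - g 0) = 0 by rewrite -proj_liftK K1 linear0.
  have D1 := lift_path_defect pf bf.
  rewrite X0 subr0 in D1.
  have := Hr g f' (s * e) pf _ _ bf D1.
  rewrite X0 subr0 g1 g0 => Hfin.
  apply: le_trans (Hfin _ _) _ => [t| |].
  - have := path_dist t pf bf; rewrite g0 => h5.
    have := ler_distD q (g t) y.
    move: yq; rewrite -ball_normE /= (distrC y).
    by have : d = r / 2 by []; lra.
  - by rewrite mulr_gt0//= (lt_trans sed)//; have : d = r / 2 by []; lra.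
  - rewrite le_eqVlt; apply/orP; left; apply/eqP; field.
    by rewrite gt_eqF.
have /nbhs_ballP[d /= d0 Hd] : nbhs (0 : R) [set e0 | 0 < e0 -> B `<=` Q e0] := cover.
have d20 : 0 < d / 2 by lra.
exists (d / 2) => // e q x1 x2 x3 x4 ee qB.
have dd : ball (0 : R) d (d / 2) by rewrite /ball /= sub0r normrN ger0_norm; lra.
exact: (Hd _ dd d20 q qB).
Qed.

End LiftPaths.

(** * C1 maps and charts *)

Section C1At.
Variables (R : realType) (n m : nat).
Implicit Types (T : 'rV[R]_n -> 'rV[R]_m).

Definition C1_at T (x : 'rV[R]_n) :=
  (\forall y \near x, differentiable T y) /\
  forall e : R, 0 < e -> \forall y \near x,
    forall v, `|'d T y v - 'd T x v| <= e * `|v|.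

Lemma nbhs_radius (W : normedModType R) (x : W) (Q : W -> Prop) :
  (\forall y \near x, Q y) -> exists2 r : R, 0 < r & forall y, `|y - x| < r -> Q y.
Proof.
move=> /nbhs_ballP[d /= d0 Hd]; exists d => // y yx; apply: Hd.
by rewrite -ball_normE /= distrC.
Qed.

(** Mean value theorem for [T - 'd T x] along the segment from [z] to [y], which stays in the ball
    where the differential is close to ['d T x]. *)
Lemma strict_differentiability T x e : C1_at T x -> 0 < e ->
  exists2 r : R, 0 < r & forall y z, `|y - x| < r -> `|z - x| < r ->
    `|T y - T z - 'd T x (y - z)| <= e * `|y - z|.
Proof.
move=> [dT cT] e0.
have [r1 r10 H1] := nbhs_radius dT; have [r2 r20 H2] := nbhs_radius (cT e e0).
exists (Num.min r1 r2) => [|y z]; first by rewrite lt_min r10.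
rewrite !lt_min => /andP[y1 y2] /andP[z1 z2].
have seg (s r : R) : 0 <= s <= 1 -> `|y - x| < r -> `|z - x| < r -> `|z + s *: (y - z) - x| < r.
  move=> /andP[s0 s1] yr zr.
  have -> : z + s *: (y - z) - x = (1 - s) *: (z - x) + s *: (y - x).
    by apply/rowP => j; rewrite !mxE; ring.
  apply: le_lt_trans (ler_normD _ _) _; rewrite !normrZ !ger0_norm//; last by lra.
  have [s12|s12] := ltP 0 s.
    have h1 : s * `|y - x| < s * r by rewrite ltr_pM2l.
    have h2 : (1 - s) * `|z - x| <= (1 - s) * r by apply: ler_wpM2l; [lra|exact: ltW].
    by lra.
  have -> : s = 0 by lra.
  by rewrite mul0r addr0 subr0 mul1r.
have D s : 0 <= s <= 1 -> cderiv (fun s => T (z + s *: (y - z)) - s *: 'd T x (y - z)) s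
   ('d T (z + s *: (y - z)) (y - z) - 'd T x (y - z)).
  move=> s01; apply: cderivB.
    apply: (@cderiv_diff _ _ _ T (fun s => z + s *: (y - z))); last exact: cderiv_affine.
    by apply: H1; exact: seg.
  apply: cderiv_ext (cderiv_affine 0 ('d T x (y - z)) s) => r; by rewrite add0r.
have := @mean_value_cst _ _ _ _ (e * `|y - z|) 0 1 ler01 D.
rewrite !scale1r !scale0r addr0 !subr0 mulr1 (addrC z) subrK => H.
rewrite addrAC; apply: H => s s01.
by apply: H2; exact: seg.
Qed.

End C1At.

(** * Transfer of germ bounds by C^1 maps *)

Section Transfer.
Variables (R : realType) (n : nat).
Local Notation V := 'rV[R]_n.

Definition subadditive_le (nu : V -> R) (B : R) :=
  (forall u v, nu (u + v) <= nu u + nu v) /\ forall v, nu v <= B * `|v|.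

(* A tangent path of speed [e] is mapped to one of speed [(a + o(1)) e], and
   transverse displacements are divided by at most [b]. *)
Let transfer (D : V -> {linear V -> V}) (E1 E2 : V -> V -> Prop) (T : V -> V) (x : V)
    (nu1 nu2 N1 N2 : V -> R) (B a b C1 C2 : R) :
  0 < B -> 0 < a -> 0 < b -> 0 < C2 ->
  (forall e : R, 0 < e -> exists2 r : R, 0 < r & forall y z,
    `|y - x| < r -> `|z - x| < r -> `|T y - T z - D x (y - z)| <= e * `|y - z|) ->
  (forall e : R, 0 < e -> \forall y \near x, forall v, `|D y v - D x v| <= e * `|v|) ->
  (\forall y \near x, forall (c : R -> V) t v, c t = y -> cderiv c t v ->
     cderiv (T \o c) t (D y v)) ->
  (\forall y \near x, forall v, E1 y v -> E2 (T y) (D y v)) ->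
  (forall e : R, 0 < e -> \forall y \near x, forall v, E1 y v ->
     exists2 w, E1 x w & `|v - w| <= e * `|v|) ->
  subadditive_le nu1 B -> subadditive_le nu2 B -> subadditive_le N2 B ->
  (forall v, `|v| <= B * nu1 v) ->
  (forall w, E1 x w -> nu2 (D x w) <= a * nu1 w) ->
  (forall v, N1 v <= b * N2 (D x v)) ->
  b * (C2 * (a * a)) < C1 ->
  germ_bound E2 (T x) nu2 N2 C2 -> germ_bound E1 x nu1 N1 C1.
Proof.
move=> B0 a0 b0 C20 SD TC2 TC1 E12 Econt [nu1D nu1B] [nu2D nu2B] [N2D N2B] nu1e Ha Hb HC H2 K K0.
have [KT KT0 HKT] := linear_bounded (D x).
pose gap := C1 - b * (C2 * (a * a)).
have gap0 : 0 < gap by rewrite /gap; lra.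
(* [d * S] bounds what the relaxed rate [a + d] and the strict differentiability error add to
   [b * (C2 * (a * a))]; [d] keeps it below the strict gap to [C1]. *)
pose S := b * (C2 * (2 * a + 1)) + b * (B * K).
have S0 : 0 < S by rewrite addr_gt0// !mulr_gt0//; lra.
pose d := Num.min 1 (gap / S).
have d0 : 0 < d by rewrite lt_min ltr01 divr_gt0.
have d1 : d <= 1 by rewrite ge_min lexx.
have dgap : d * S <= gap by rewrite -ler_pdivlMr// ge_min lexx orbT.
have ad0 : 0 < a + d by lra.
pose q := a * B + B * (KT + 1).
have q0 : 0 < q by apply: addr_gt0; apply: mulr_gt0 => //; lra.
pose Q := q * B.
have Q0 : 0 < Q by exact: mulr_gt0.
(* Tolerance for replacing the differential and the plane at a nearby point by those at [x]: [q]
   adds up the resulting speed errors, and the extra [B] in [Q] converts [|v|] into [nu1 v]. *)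
pose h := d / Q; have h0 : 0 < h by rewrite divr_gt0.
(* The ends of the image path are within [(KT + 1) * K * (e * e)]; dividing by the square of the new
   speed bound gives the constant to request from the target germ. *)
pose K2 := (KT + 1) * K / ((a + d) * (a + d)).
have K20 : 0 < K2.
  by rewrite divr_gt0// mulr_gt0//; lra.
have [r2 r20 G2] := H2 K2 K20.
have [s1 s10 S1] := SD d d0.
have [t1 t10 T1] := nbhs_radius TC1.
have [t2 t20 T2] := nbhs_radius (TC2 h h0).
have [t3 t30 T3] := nbhs_radius E12.
have [t4 t40 T4] := nbhs_radius (Econt h h0).
have KT1 : 0 < KT + 1 by lra.
pose ra := Num.min s1 (Num.min (r2 / (KT + 1)) (r2 / (a + d))).
pose rb := Num.min (Num.min t1 t2) (Num.min t3 t4).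
pose r := Num.min ra rb.
have r0 : 0 < r.
  by rewrite /r /ra /rb !lt_min s10 t10 t20 t30 t40 !divr_gt0.
exists r => // c c' e cp cx /andP[e0 er] ce cK.
have {}cx t : [/\ `|c t - x| < s1, `|c t - x| < r2 / (KT + 1), `|c t - x| < t1,
    `|c t - x| < t2 & `|c t - x| < t3 /\ `|c t - x| < t4].
  by move: (cx t); rewrite !lt_min => /andP[/and3P[? ? _] /andP[/andP[? ?] /andP[? ?]]].
have er2 : e < r2 / (a + d).
  by apply: lt_le_trans er _; rewrite /r /ra !ge_min lexx !orbT.
have dlt u v : `|u - x| < s1 -> `|v - x| < s1 -> `|T u - T v| <= (KT + 1) * `|u - v|.
  move=> us vs; have := S1 u v us vs => H.
  have -> : T u - T v = T u - T v - D x (u - v) + D x (u - v) by rewrite subrK.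
  apply: le_trans (ler_normD _ _) _; rewrite mulrDl mul1r addrC lerD//.
  by apply: le_trans H _; rewrite ler_piMl.
have Tp : tangent_path E2 (T \o c) (fun t => D (c t) (c' t)).
  split.
  - move=> t; have [_ _ ct _ _] := cx t.
    by apply: T1 => //; exact: (tp_deriv cp).
  - by move=> t; have [_ _ _ _ [ct _]] := cx t; apply: T3 => //; exact: (tp_tangent cp).
  - split=> t tt; congr (T _); [exact: (tp_stopped cp).1|exact: (tp_stopped cp).2].
have [x0s _ _ _ _] := cx 0; have [x1s _ _ _ _] := cx 1.
have res := G2 _ _ ((a + d) * e) Tp.
have nuT t : nu2 (D (c t) (c' t)) <= (a + d) * e.
  have [_ _ _ ct2 [_ ct4]] := cx t.
  (* The rate [a] is available only on the plane at [x], so the velocity is compared with a nearby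
     vector [w] of that plane. *)
  have [w Ew vw] := T4 _ ct4 _ (tp_tangent cp t).
  have n0 : 0 <= nu1 (c' t) by rewrite -(pmulr_rge0 _ B0) (le_trans _ (nu1e _)).
  set v := c' t in vw n0 *.
  have -> : D (c t) v = D x w + (D x (v - w) + (D (c t) v - D x v)).
    rewrite (linearB (D x) v w); move: (D (c t) v) (D x v) (D x w) => u1 u2 u3.
    by apply/rowP => j; rewrite !mxE; ring.
  apply: le_trans (nu2D _ _) _; apply: le_trans (lerD (Ha w Ew) (nu2D _ _)) _.
  have h1 : nu2 (D x (v - w)) <= B * (KT * (h * `|v|)).
    apply: le_trans (nu2B _) _; rewrite ler_wpM2l ?(ltW B0)//.
    by apply: le_trans (HKT _) _; rewrite ler_wpM2l// ltW.
  have h2 : nu2 (D (c t) v - D x v) <= B * (h * `|v|).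
    by apply: le_trans (nu2B _) _; rewrite ler_wpM2l ?(ltW B0)//; exact: T2.
  have h3 : nu1 w <= nu1 v + B * (h * `|v|).
    have -> : w = v + (w - v) by rewrite addrC subrK.
    apply: le_trans (nu1D _ _) _; rewrite lerD2l; apply: le_trans (nu1B _) _.
    by rewrite ler_wpM2l ?(ltW B0)// distrC.
  have h4 : a * nu1 w <= a * (nu1 v + B * (h * `|v|)) by rewrite ler_wpM2l// ltW.
  have h5 : h * `|v| <= h * (B * nu1 v) by rewrite ler_wpM2l ?nu1e// ltW.
  have h6 : h * (B * nu1 v) * q = d * nu1 v.
    by rewrite /h /Q; field; rewrite !gt_eqF.
  have h7 : h * `|v| * q <= d * nu1 v by rewrite -h6 ler_wpM2r// ltW.
  rewrite /q in h7.
  have h8 : (a + d) * nu1 v <= (a + d) * e by rewrite ler_wpM2l ?(ltW ad0)//; exact: ce.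
  by lra.
have res1 : N2 (T (c 1) - T (c 0)) <= C2 * ((a + d) * e * ((a + d) * e)).
  apply: (res _ _ nuT) => [t||].
  - have [cs ct _ _ _] := cx t.
    apply: le_lt_trans (dlt _ _ cs _) _; first by rewrite subrr normr0.
    by rewrite mulrC -ltr_pdivlMr.
  - by rewrite mulr_gt0//= mulrC -ltr_pdivlMr.
  - apply: le_trans (dlt _ _ x1s x0s) _.
    apply: le_trans (ler_wpM2l (ltW KT1) cK) _.
    rewrite le_eqVlt; apply/orP; left; apply/eqP; rewrite /K2; field.
    by rewrite gt_eqF.
apply: le_trans (Hb _) _.
have sd := S1 _ _ x1s x0s.
set y := c 1 - c 0 in cK sd *.
(* The linearisation error is [d] times the displacement, and the displacement is at most
   [K * (e * e)]: here the condition on the ends makes the error second order. *)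
have h1 : N2 (D x y) <= C2 * ((a + d) * e * ((a + d) * e)) + B * (d * (K * (e * e))).
  have -> : D x y = (T (c 1) - T (c 0)) + (D x y - (T (c 1) - T (c 0))).
    by rewrite addrC subrK.
  apply: le_trans (N2D _ _) _; apply: lerD => //.
  apply: le_trans (N2B _) _; rewrite ler_wpM2l ?(ltW B0)// distrC.
  by apply: le_trans sd _; rewrite ler_wpM2l// ltW.
apply: le_trans (ler_wpM2l (ltW b0) h1) _.
have ee : 0 < e * e by rewrite mulr_gt0.
have -> : b * (C2 * ((a + d) * e * ((a + d) * e)) + B * (d * (K * (e * e)))) =
  (b * (C2 * (a * a)) + d * (b * (C2 * (2 * a + d)) + b * (B * K))) * (e * e) by ring.
rewrite ler_wpM2r ?(ltW ee)//.
have h2 : d * (b * (C2 * (2 * a + d)) + b * (B * K)) <= d * S.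
  rewrite ler_wpM2l ?(ltW d0)// lerD2r ler_wpM2l ?(ltW b0)// ler_wpM2l ?(ltW C20)//; lra.
by move: dgap h2; rewrite /gap; lra.
Qed.

Lemma germ_bound_transfer (E1 E2 : V -> V -> Prop) (T : V -> V) (x : V)
    (nu1 nu2 N1 N2 : V -> R) (B a b C1 C2 : R) :
  0 < B -> 0 < a -> 0 < b -> 0 < C2 -> C1_at T x ->
  (\forall y \near x, forall v, E1 y v -> E2 (T y) ('d T y v)) ->
  (forall e : R, 0 < e -> \forall y \near x, forall v, E1 y v ->
     exists2 w, E1 x w & `|v - w| <= e * `|v|) ->
  subadditive_le nu1 B -> subadditive_le nu2 B -> subadditive_le N2 B ->
  (forall v, `|v| <= B * nu1 v) ->
  (forall w, E1 x w -> nu2 ('d T x w) <= a * nu1 w) ->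
  (forall v, N1 v <= b * N2 ('d T x v)) ->
  b * (C2 * (a * a)) < C1 ->
  germ_bound E2 (T x) nu2 N2 C2 -> germ_bound E1 x nu1 N1 C1.
Proof.
move=> B0 a0 b0 C20 TC.
apply: (@transfer (fun y => 'd T y)) => //.
- by move=> e; exact: strict_differentiability.
- exact: TC.2.
- apply: filterS TC.1 => y dT c t v cty; rewrite -cty in dT *.
  by exact: cderiv_diff.
Qed.

End Transfer.

(** * Calculus of maps that are C^1 at a point *)

Section C1Calculus.
Variables (R : realType).

Lemma near_all (T : topologicalType) (x : T) (Q : T -> Prop) :
  (forall y, Q y) -> \forall y \near x, Q y.
Proof. exact: (@filterE _ (nbhs x) (nbhs_filter x)). Qed.

Lemma near_forall_ord (T : topologicalType) (x : T) n (Q : 'I_n -> T -> Prop) :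
  (forall i, \forall y \near x, Q i y) -> \forall y \near x, forall i, Q i y.
Proof. by move=> H; apply: filter_forall. Qed.

Lemma linear_row_sum (n : nat) (W : normedModType R) (f : {linear 'rV[R]_n -> W}) v :
  f v = \sum_i v 0 i *: f (delta_mx 0 i).
Proof.
rewrite {1}(row_sum_delta v) linear_sum; apply: eq_bigr => i _.
by rewrite linearZ.
Qed.

Let norm_sub_eq (W : normedModType R) (a b c d : W) (r : R) :
  a = b -> c = d -> `|b - d| <= r -> `|a - c| <= r.
Proof. by move=> -> ->. Qed.

Let comp_bound n m k (p q r : 'rV[R]_k) (s t : 'rV[R]_m) (v : 'rV[R]_n) (K J e : R) :
  0 < K -> 0 < J -> 0 < e ->
  `|p - q| <= e / 2 / (K + 1) * `|s| -> `|s - t| <= Num.min 1 (e / 2 / J) * `|v| ->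
  `|t| <= K * `|v| -> `|q - r| <= J * `|s - t| -> `|p - r| <= e * `|v|.
Proof.
move=> K0 J0 e0 b1 b2 b3 b4.
have K1 : 0 < K + 1 by lra.
have e1 : 0 < e / 2 / (K + 1) by rewrite !divr_gt0.
have v0 := normr_ge0 v.
have m1 : Num.min 1 (e / 2 / J) * `|v| <= `|v| by rewrite ler_piMl// ge_min lexx.
have m2 : Num.min 1 (e / 2 / J) * `|v| <= e / 2 / J * `|v|.
  by rewrite ler_wpM2r// ge_min lexx orbT.
have s1 : `|s| <= (K + 1) * `|v|.
  have -> : s = (s - t) + t by rewrite subrK.
  by apply: le_trans (ler_normD _ _) _; lra.
have c1 : `|p - q| <= e / 2 * `|v|.
  apply: le_trans b1 _; apply: le_trans (ler_wpM2l (ltW e1) s1) _.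
  by rewrite mulrA divfK// gt_eqF.
have c2 : `|q - r| <= e / 2 * `|v|.
  apply: le_trans b4 _; apply: le_trans (ler_wpM2l (ltW J0) (le_trans b2 m2)) _.
  by rewrite mulrA mulrCA mulfV ?mulr1// gt_eqF.
have := ler_distD q p r; lra.
Qed.

Lemma near_eq_diff (n : nat) (W : normedModType R) (f g : 'rV[R]_n -> W) x :
  (\forall y \near x, f y = g y) -> differentiable f x ->
  differentiable g x /\ forall v, 'd g x v = 'd f x v.
Proof.
move=> fg df.
have [|dg E] := @eps_diff _ _ _ g x ('d f x).
  move=> e e0; have fgx := nbhs_singleton fg.
  have H := diff_eps df e0.
  by apply: filterS2 fg H => y <-; rewrite -fgx.
by split; [exact: dg|move=> v; exact: (congr1 (fun h => h v) E)].
Qed.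

Lemma near_nbhs (T : topologicalType) (x : T) (Q : T -> Prop) :
  (\forall y \near x, Q y) -> \forall y \near x, \forall z \near y, Q z.
Proof. exact: nbhs_interior. Qed.

Lemma C1_at_near n m (f g : 'rV[R]_n -> 'rV[R]_m) x :
  (\forall y \near x, f y = g y) -> C1_at f x -> C1_at g x.
Proof.
move=> /near_nbhs fg [df cf].
have H : \forall y \near x, differentiable g y /\ forall v, 'd g y v = 'd f y v.
  by apply: filterS2 fg df => y; exact: near_eq_diff.
split; first by apply: filterS H => y [].
move=> e e0; have [_ Hx] := nbhs_singleton H.
apply: filterS2 H (cf e e0) => y [_ Hy] cy v.
exact: (norm_sub_eq (Hy v) (Hx v) (cy v)).
Qed.

Lemma C1_at_diff n m (f : 'rV[R]_n -> 'rV[R]_m) x : C1_at f x -> differentiable f x.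
Proof. by move=> [/nbhs_singleton]. Qed.

Lemma C1_at_comp n m k (f : 'rV[R]_n -> 'rV[R]_m) (g : 'rV[R]_m -> 'rV[R]_k) x :
  C1_at f x -> C1_at g (f x) -> C1_at (g \o f) x.
Proof.
move=> fx gx; have dfx := C1_at_diff fx; have dgx := C1_at_diff gx.
have cfx : {for x, continuous f} := differentiable_continuous dfx.
have Hg : \forall y \near x, differentiable g (f y) by exact: (cfx _ gx.1).
split; first by apply: filterS2 fx.1 Hg => y; exact: differentiable_comp.
move=> e e0.
have [K K0 HK] := linear_bounded ('d f x).
have [J J0 HJ] := linear_bounded ('d g (f x)).
have K1 : 0 < K + 1 by lra.
have e1 : 0 < e / 2 / (K + 1) by rewrite !divr_gt0.
have e2 : 0 < Num.min 1 (e / 2 / J) by rewrite lt_min ltr01 !divr_gt0.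
have H1 := fx.2 _ e2.
have H2 : \forall y \near x, forall v, `|'d g (f y) v - 'd g (f x) v| <= e / 2 / (K + 1) * `|v|.
  exact: (cfx _ (gx.2 _ e1)).
have H3 : \forall y \near x, differentiable f y /\ differentiable g (f y).
  by apply: filterS2 fx.1 Hg.
apply: filterS3 H3 H1 H2 => y [dfy dgy] h1 h2 v.
have ey : 'd (g \o f) y v = 'd g (f y) ('d f y v).
  exact: (congr1 (fun h => h v) (diff_comp dfy dgy)).
have ex : 'd (g \o f) x v = 'd g (f x) ('d f x v).
  exact: (congr1 (fun h => h v) (diff_comp dfx dgx)).
apply: (norm_sub_eq ey ex).
have lb := linearB ('d g (f x)) ('d f y v) ('d f x v).
have h4 := HJ ('d f y v - 'd f x v).
have h5 := eq_ind _ (fun z => `|z| <= J * `|'d f y v - 'd f x v|) h4 _ lb.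
have h6 := h2 ('d f y v); have h7 := h1 v; have h8 := HK v.
exact: (comp_bound K0 J0 e0 h6 h7 h8 h5).
Qed.

Lemma diff_compE n m k (f : 'rV[R]_n -> 'rV[R]_m) (g : 'rV[R]_m -> 'rV[R]_k) x v :
  C1_at f x -> C1_at g (f x) -> 'd (g \o f) x v = 'd g (f x) ('d f x v).
Proof.
move=> fx gx.
exact: (congr1 (fun h => h v) (diff_comp (C1_at_diff fx) (C1_at_diff gx))).
Qed.

Lemma eps_C1_at n m (f : 'rV[R]_n -> 'rV[R]_m) x
    (D : 'rV[R]_n -> {linear 'rV[R]_n -> 'rV[R]_m}) :
  (\forall y \near x, forall e : R, 0 < e ->
     \forall z \near y, `|f z - f y - D y (z - y)| <= e * `|z - y|) ->
  (forall e : R, 0 < e -> \forall y \near x, forall v, `|D y v - D x v| <= e * `|v|) ->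
  C1_at f x /\ forall v, 'd f x v = D x v.
Proof.
move=> H HD.
have K : \forall y \near x, differentiable f y /\ forall v, 'd f y v = D y v.
  by apply: filterS H => y /eps_diff[dy E]; split; [exact: dy|move=> v; exact: (congr1 (fun h => h v) E)].
have [_ Kx] := nbhs_singleton K.
split; last exact: Kx.
split; first by apply: filterS K => y [].
move=> e e0; apply: filterS2 K (HD e e0) => y [_ Ky] cy v.
exact: (norm_sub_eq (Ky v) (Kx v) (cy v)).
Qed.

Lemma C1_at_id n (x : 'rV[R]_n) : C1_at id x /\ forall v, 'd id x v = v.
Proof.
pose D := fun _ : 'rV[R]_n => (idfun : {linear 'rV[R]_n -> 'rV[R]_n}).
apply: (@eps_C1_at _ _ id x D) => [|e e0]; apply: near_all => y.
  move=> e e0; apply: near_all => z.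
  by rewrite /D /= subrr normr0 mulr_ge0// ltW.
by move=> v; rewrite /D /= subrr normr0 mulr_ge0// ltW.
Qed.

Lemma C1_at_lin n m (L : {linear 'rV[R]_n -> 'rV[R]_m}) (a : 'rV[R]_n) (b : 'rV[R]_m) x :
  C1_at (fun y => b + L (y - a)) x /\ forall v, 'd (fun y => b + L (y - a)) x v = L v.
Proof.
apply: (@eps_C1_at _ _ _ x (fun _ => L)) => [|e e0]; apply: near_all => y.
  move=> e e0; apply: near_all => z.
  rewrite opprD addrACA subrr add0r -linearB opprB addrA subrK.
  by rewrite subrr normr0 mulr_ge0// ltW.
by move=> v; rewrite subrr normr0 mulr_ge0// ltW.
Qed.

(** [Ck] controls each directional derivative separately; a uniform bound over all directions
    follows by expanding the differential in the finitely many coordinate directions. *)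
Lemma Ck1_C1_at n m (f : 'rV[R]_n -> 'rV[R]_m) (U : set 'rV[R]_n) x :
  open U -> Ck 1 f U -> U x -> C1_at f x.
Proof.
move=> oU [df cf] Ux.
have nU : \forall y \near x, U y by exact: open_nbhs_nbhs.
split; first by apply: filterS nU.
move=> e e0.
(* The successor avoids dividing by zero in dimension 0. *)
pose e1 := e / n.+1%:R; have e10 : 0 < e1 by rewrite divr_gt0.
have H i : \forall y \near x, `|'D_(delta_mx 0 i) f x - 'D_(delta_mx 0 i) f y| <= e1.
  exact: ((@cvgrPdist_le _ _ _ _ (nbhs_filter x) _ _).1 (cf (delta_mx 0 i) x Ux) _ e10).
have {}H := near_forall_ord H.
have E z : U z -> forall v, 'd f z v = \sum_i v 0 i *: 'D_(delta_mx 0 i) f z.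
  move=> Uz v; apply: etrans (linear_row_sum ('d f z) v) _; apply: eq_bigr => i _.
  by rewrite (deriveE _ (df z Uz)).
have key (v : 'rV[R]_n) (a b : 'I_n -> 'rV[R]_m) : (forall i, `|a i - b i| <= e1) ->
    `|\sum_i v 0 i *: b i - \sum_i v 0 i *: a i| <= e * `|v|.
  move=> ab; rewrite distrC -sumrB; apply: le_trans (ler_norm_sum _ _ _) _.
  apply: (@le_trans _ _ (\sum_(i < n) e1 * `|v|)).
    apply: ler_sum => i _; rewrite -scalerBr normrZ mulrC; apply: ler_pM => //.
    exact: coord_le_norm.
  rewrite sumr_const card_ord -mulrnAl ler_wpM2r//.
  by rewrite -mulr_natr /e1 mulrAC ler_pdivrMr// ler_wpM2l ?(ltW e0)// ler_nat.
apply: filterS2 nU H => y Uy Hy v.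
exact: (norm_sub_eq (E y Uy v) (E x Ux v) (key v _ _ Hy)).
Qed.

Lemma C1_at_Ck1 n m (f : 'rV[R]_n -> 'rV[R]_m) (U : set 'rV[R]_n) :
  (forall x, U x -> C1_at f x) -> Ck 1 f U.
Proof.
move=> H; split=> [x Ux|v x Ux]; first exact: C1_at_diff (H x Ux).
have [dx cx] := H x Ux.
apply/(@cvgrPdist_le _ _ _ _ (nbhs_filter x)) => e e0.
have v1 : 0 < `|v| + 1 by have := normr_ge0 v; lra.
have key (a b : 'rV[R]_m) : `|a - b| <= e / (`|v| + 1) * `|v| -> `|b - a| <= e.
  rewrite distrC => /le_trans; apply.
  by rewrite mulrAC ler_pdivrMr// ler_wpM2l ?(ltW e0)//; lra.
apply: filterS2 dx (cx _ (divr_gt0 e0 v1)) => y dy cy.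
apply: (norm_sub_eq (deriveE v (C1_at_diff (H x Ux))) (deriveE v dy)).
exact: (key _ _ (cy v)).
Qed.

End C1Calculus.

(** * Maps, vectors and curves in coordinates *)

Section ChartCalculus.
Variables (R : realType) (n : nat) (M : topologicalType).
Variable A : smooth_atlas R n M.
Implicit Types (p q z : M) (h : M -> M) (E : M -> {vspace 'rV[R]_n}).
Local Notation V := 'rV[R]_n.
Local Notation dom p := (chart_dom (chart_at A p)).

Lemma near_chart (B : chart R n M) (Q : M -> Prop) z :
  chart_dom B z -> (\forall y \near z, Q y) ->
  \forall x \near B z, [/\ chart_dom B (chart_inv B x), B (chart_inv B x) = x & Q (chart_inv B x)].
Proof.
move=> Bz Qz.
have Bx : (B @` chart_dom B) (B z) by exists z.
have ci := chart_inv_cont Bx.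
have N1 : \forall x \near B z, (B @` chart_dom B) x.
  exact: open_nbhs_nbhs (conj (@chart_cod_open _ _ _ B) Bx).
have N2 : \forall x \near B z, Q (chart_inv B x).
  by apply: (ci); rewrite chart_funK.
apply: filterS2 N1 N2 => x [y By <-].
by rewrite chart_funK.
Qed.

Lemma chart_image_open (B : chart R n M) (O : set M) :
  open O -> open (B @` (chart_dom B `&` O)).
Proof.
move=> oO; rewrite openE => _ [z [Bz Oz] <-].
have Oz' : \forall y \near z, O y by exact: open_nbhs_nbhs.
apply: filterS (near_chart Bz Oz') => x [h1 h2 h3].
by exists (chart_inv B x).
Qed.

(** With [h = id] these are the changes of charts, so the dynamics and the coordinate changes obey
    the same lemmas. *)
Definition loc h p q : V -> V := chart_at A q \o h \o chart_inv (chart_at A p).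

Lemma locE h p q z : dom p z -> loc h p q (chart_at A p z) = chart_at A q (h z).
Proof. by move=> pz; rewrite /loc /= chart_funK. Qed.

Lemma C1_map_continuous h : C1_map A h -> continuous h.
Proof. by case. Qed.

Lemma loc_C1 h p q z : C1_map A h -> dom p z -> dom q (h z) ->
  C1_at (loc h p q) (chart_at A p z).
Proof.
move=> [ch Ch] pz qz; apply: Ck1_C1_at (Ch p q) _; last by exists z.
apply: chart_image_open; apply: open_comp; last exact: chart_dom_open.
by move=> x _; exact: ch.
Qed.

Lemma C1_map_id : C1_map A id.
Proof.
split=> [x|p q]; first by [].
exact: (@chart_at_smooth _ _ _ A 1 p q).
Qed.

Lemma loc_comp h1 h2 h3 p q r z v : h2 \o h1 =1 h3 -> C1_map A h1 -> C1_map A h2 ->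
  dom p z -> dom q (h1 z) -> dom r (h2 (h1 z)) ->
  'd (loc h3 p r) (chart_at A p z) v =
  'd (loc h2 q r) (chart_at A q (h1 z)) ('d (loc h1 p q) (chart_at A p z) v).
Proof.
move=> H3 H1 H2 pz qz rz.
have c1 := loc_C1 H1 pz qz.
have c2 := loc_C1 H2 qz rz; rewrite -(locE h1 q pz) in c2.
have Hn : \forall x \near chart_at A p z,
    (loc h2 q r \o loc h1 p q) x = loc h3 p r x.
  have oq : \forall y \near z, dom q (h1 y).
    apply: (C1_map_continuous H1); apply: open_nbhs_nbhs; split => //.
    exact: chart_dom_open.
  apply: filterS (near_chart pz oq) => x [_ _ qx].
  by rewrite /loc /= chart_funK// -H3.
have [_ E] := near_eq_diff Hn (C1_at_diff (C1_at_comp c1 c2)).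
apply: etrans (E v) _; apply: etrans (diff_compE v c1 c2) _.
exact: (congr1 (fun x => 'd (loc h2 q r) x ('d (loc h1 p q) (chart_at A p z) v)) (locE h1 q pz)).
Qed.

Lemma loc_id p z v : dom p z -> 'd (loc id p p) (chart_at A p z) v = v.
Proof.
move=> pz.
have Hn : \forall x \near chart_at A p z, id x = loc id p p x.
  have T : \forall y \near z, True by exact: near_all.
  by apply: filterS (near_chart pz T) => x [_ h _]; rewrite /loc /= h.
have [_ E] := near_eq_diff Hn (C1_at_diff (C1_at_id (chart_at A p z)).1).
by apply: etrans (E v) _; exact: (C1_at_id _).2.
Qed.

Lemma dchart_invE p z v :
  dchart_inv A (chart_at A p) z v = 'd (loc id p z) (chart_at A p z) v.
Proof. by []. Qed.

Lemma dchartE p z v :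
  dchart A (chart_at A p) z v = 'd (loc id z p) (chart_at A z z) v.
Proof. by []. Qed.

Lemma DfE h z v : Df A h z v = 'd (loc h z (h z)) (chart_at A z z) v.
Proof. by []. Qed.

Let idid : id \o id =1 id :> (M -> M).
Proof. by []. Qed.

Lemma dchart_invK p z v : dom p z ->
  dchart A (chart_at A p) z (dchart_inv A (chart_at A p) z v) = v.
Proof.
move=> pz; have zz := chart_at_dom A z.
apply: etrans (dchartE p z _) _.
apply: etrans (congr1 _ (dchart_invE p z v)) _.
apply: etrans (esym (loc_comp v idid C1_map_id C1_map_id pz zz pz)) _.
exact: loc_id.
Qed.

Lemma dchartK p z v : dom p z ->
  dchart_inv A (chart_at A p) z (dchart A (chart_at A p) z v) = v.
Proof.
move=> pz; have zz := chart_at_dom A z.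
apply: etrans (dchart_invE p z _) _.
apply: etrans (congr1 _ (dchartE p z v)) _.
apply: etrans (esym (loc_comp v idid C1_map_id C1_map_id zz pz zz)) _.
exact: loc_id.
Qed.

Definition in_chart E p (x v : V) : Prop :=
  dchart_inv A (chart_at A p) (chart_inv (chart_at A p) x) v
    \in E (chart_inv (chart_at A p) x).

Lemma in_chartE E p z v : dom p z ->
  in_chart E p (chart_at A p z) v <-> dchart_inv A (chart_at A p) z v \in E z.
Proof. by move=> pz; rewrite /in_chart chart_funK. Qed.

Lemma dchart_inv_loc h p q z v : C1_map A h -> dom p z -> dom q (h z) ->
  dchart_inv A (chart_at A q) (h z) ('d (loc h p q) (chart_at A p z) v) =
  Df A h z (dchart_inv A (chart_at A p) z v).
Proof.
move=> Ch pz qz; have zz := chart_at_dom A z; have hz := chart_at_dom A (h z).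
have h1 : id \o h =1 h by [].
have h2 : h \o id =1 h by [].
apply: etrans (dchart_invE q (h z) _) _.
apply: etrans (esym (loc_comp v h1 Ch C1_map_id pz qz hz)) _.
apply: etrans (loc_comp v h2 C1_map_id Ch pz zz hz) _.
apply: etrans (congr1 _ (esym (dchart_invE p z v))) _.
exact: (esym (DfE h z _)).
Qed.

Lemma in_chart_loc E h p q z v : C1_map A h ->
  (forall y w, w \in E y -> Df A h y w \in E (h y)) ->
  dom p z -> dom q (h z) -> in_chart E p (chart_at A p z) v ->
  in_chart E q (chart_at A q (h z)) ('d (loc h p q) (chart_at A p z) v).
Proof.
move=> Ch hE pz qz /(in_chartE E v pz) H; apply/(in_chartE E _ qz).
by rewrite dchart_inv_loc//; exact: hE.
Qed.

Lemma Df_id z v : Df A id z v = v.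
Proof. exact: (etrans (DfE id z v) (loc_id v (chart_at_dom A z))). Qed.

Lemma Df_comp h1 h2 h3 z v : h2 \o h1 =1 h3 -> C1_map A h1 -> C1_map A h2 ->
  Df A h2 (h1 z) (Df A h1 z v) = 'd (loc h3 z (h2 (h1 z))) (chart_at A z z) v.
Proof.
move=> H3 H1 H2.
apply: esym; apply: etrans (loc_comp v H3 H1 H2 (chart_at_dom A z) (chart_at_dom A _) (chart_at_dom A _)) _.
apply: etrans (congr1 _ (esym (DfE h1 z v))) _.
exact: (esym (DfE h2 _ _)).
Qed.

(** Continuity is a separate requirement: the chart function is arbitrary outside its domain, so a
    derivative of its composite with [c] does not prevent [c] from leaving that domain. *)
Definition tangent_at E (c : R -> M) (t : R) : Prop :=
  {for t, continuous c} /\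
  exists2 v, cderiv (chart_at A (c t) \o c) t v & v \in E (c t).

Lemma cderiv_loc h p q (c : R -> M) t v : C1_map A h -> {for t, continuous c} ->
  dom p (c t) -> dom q (h (c t)) -> cderiv (chart_at A p \o c) t v ->
  cderiv (chart_at A q \o h \o c) t ('d (loc h p q) (chart_at A p (c t)) v).
Proof.
move=> Ch cc pc qc cv.
have D := cderiv_diff (C1_at_diff (loc_C1 Ch pc qc)) cv.
apply: cderiv_near D.
have : \forall s \near t, dom p (c s).
  apply: cc; apply: open_nbhs_nbhs; split => //; exact: chart_dom_open.
by apply: filterS => s ps; rewrite /loc /= chart_funK.
Qed.

Lemma tangent_at_chart E p (c : R -> M) t : tangent_at E c t -> dom p (c t) ->
  exists2 v, cderiv (chart_at A p \o c) t v & in_chart E p (chart_at A p (c t)) v.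
Proof.
move=> [cc [v cv Ev]] pc; have cd := chart_at_dom A (c t).
exists ('d (loc id (c t) p) (chart_at A (c t) (c t)) v).
  exact: (cderiv_loc C1_map_id cc cd pc cv).
apply/(in_chartE E _ pc); rewrite -[c t in X in X \in _]/(id (c t)).
have -> : dchart_inv A (chart_at A p) (id (c t))
    ('d (loc id (c t) p) (chart_at A (c t) (c t)) v) = v.
  apply: etrans (dchart_inv_loc v C1_map_id cd pc) _.
  apply: etrans (Df_id _ _) _; exact: (etrans (dchart_invE _ _ _) (loc_id v cd)).
by [].
Qed.

Lemma chart_tangent_at E p (c : R -> V) t z v : dom p z -> c t = chart_at A p z ->
  cderiv c t v -> in_chart E p (c t) v ->
  tangent_at E (chart_inv (chart_at A p) \o c) t.
Proof.
move=> pz ctz cv Ev.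
have ct : chart_inv (chart_at A p) (c t) = z by rewrite ctz chart_funK.
have cc : {for t, continuous c} := cderiv_continuous cv.
have zz := chart_at_dom A z.
split.
  apply: continuous_comp; first exact: cc.
  by apply: (@chart_inv_cont _ _ _ (chart_at A p)); rewrite ctz; exists z.
rewrite /= ct; exists (dchart_inv A (chart_at A p) z v).
  rewrite dchart_invE -ctz.
  have D := loc_C1 C1_map_id pz zz; rewrite -ctz in D.
  exact: (cderiv_diff (C1_at_diff D) cv).
by apply/(in_chartE E v pz); rewrite -ctz.
Qed.

Lemma tangent_at_map E h (c : R -> M) t : C1_map A h ->
  (forall y w, w \in E y -> Df A h y w \in E (h y)) ->
  tangent_at E c t -> tangent_at E (h \o c) t.
Proof.
move=> Ch hE [cc [v cv Ev]].
split; first by apply: continuous_comp => //; exact: (C1_map_continuous Ch).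
exists (Df A h (c t) v); last exact: hE.
exact: (cderiv_loc Ch cc (chart_at_dom A _) (chart_at_dom A _) cv).
Qed.

End ChartCalculus.

(** * Lipschitz distributions as lifted plane fields *)

Section MatrixBounds.
Variable R : realType.

Lemma mulmx_bounded m n (B : 'M[R]_(m, n)) :
  exists2 K, 0 < K & forall v : 'rV[R]_m, `|v *m B| <= K * `|v|.
Proof. exact: (linear_bounded (mulmxr B)). Qed.

Lemma mulmx_rows_le m n (B : 'M[R]_(m, n)) (c : R) (u : 'rV[R]_m) :
  (forall i, `|row i B| <= c) -> `|u *m B| <= m%:R * c * `|u|.
Proof.
move=> H; rewrite mulmx_sum_row; apply: le_trans (ler_norm_sum _ _ _) _.
apply: (@le_trans _ _ (\sum_(i < m) c * `|u|)).
  apply: ler_sum => i _; rewrite normrZ mulrC; apply: ler_pM => //.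
  exact: coord_le_norm.
by rewrite sumr_const card_ord -mulrA mulr_natl.
Qed.

Lemma row_free_lower m n (B : 'M[R]_(m, n)) : row_free B ->
  exists2 K, 0 < K & forall v : 'rV[R]_m, `|v| <= K * `|v *m B|.
Proof.
move=> /row_freeP[C BC]; have [K K0 H] := mulmx_bounded C; exists K => // v.
by have := H (v *m B); rewrite -mulmxA BC mulmx1.
Qed.

Lemma perturb_lower m n (B C : 'M[R]_(m, n)) (K d : R) : 0 < K ->
  (forall v : 'rV[R]_m, `|v| <= K * `|v *m B|) ->
  (forall v : 'rV[R]_m, `|v *m C - v *m B| <= d * `|v|) -> K * d <= 1 / 2 ->
  forall v : 'rV[R]_m, `|v| <= 2 * K * `|v *m C|.
Proof.
move=> K0 HB HC Kd v.
have h1 : `|v *m B| <= `|v *m C| + d * `|v|.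
  apply: le_trans (lerD (lexx _) (HC v)).
  have := ler_normB (v *m C) (v *m C - v *m B).
  by rewrite opprB (addrC (v *m C) (v *m B - v *m C)) subrK.
have h2 := ler_wpM2l (ltW K0) h1; have h3 := HB v.
have h4 : K * d * `|v| <= 1 / 2 * `|v| by rewrite ler_wpM2r.
by lra.
Qed.

Lemma lower_row_free m n (B : 'M[R]_(m, n)) (K : R) :
  (forall v : 'rV[R]_m, `|v| <= K * `|v *m B|) -> row_free B.
Proof.
move=> H; apply: inj_row_free => v vB; apply/eqP.
by rewrite -normr_le0; have := H v; rewrite vB normr0 mulr0.
Qed.

End MatrixBounds.

Section Clamp.
Variables (R : realType) (n : nat) (x0 : 'rV[R]_n) (r : R).
Hypothesis r_ge0 : 0 <= r.

(** Coordinatewise retraction onto the closed cube of radius [r]. It is 1-Lipschitz for the sup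
    norm, so composing with it extends local data to the whole space without changing the constants;
    complete flows then exist. *)
Definition clamp (x : 'rV[R]_n) : 'rV[R]_n :=
  \row_i Num.max (x0 0 i - r) (Num.min (x0 0 i + r) (x 0 i)).

Lemma clamp_lip x y : `|clamp x - clamp y| <= `|x - y|.
Proof.
apply: norm_le_coord => // i; have := coord_le_norm (x - y) i; rewrite !mxE.
apply: le_trans; move: (x 0 i) (y 0 i) (x0 0 i) => a b c.
have h (u v : R) : u <= v -> Num.max (c - r) (Num.min (c + r) u) <= Num.max (c - r) (Num.min (c + r) v)
  /\ Num.max (c - r) (Num.min (c + r) v) - Num.max (c - r) (Num.min (c + r) u) <= v - u.
  have [] := leP (c + r) u; have [] := leP (c + r) v; have [] := leP (c - r) u;
  have [] := leP (c - r) v; have [] := leP (c - r) (c + r); lra.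
have [ab|/ltW ab] := leP a b; have [h1 h2] := h _ _ ab.
  by rewrite !ler0_norm ?subr_le0// !opprB.
by rewrite !ger0_norm ?subr_ge0.
Qed.

Lemma clamp_near x : `|clamp x - x0| <= r.
Proof.
apply: norm_le_coord => // i; rewrite !mxE; move: (x 0 i) (x0 0 i) => a c.
rewrite ler_norml.
have r0 := r_ge0.
have [] := leP (c + r) a; have [] := leP (c - r) a; have [] := leP (c - r) (c + r); lra.
Qed.

Lemma clamp_id x : `|x - x0| <= r -> clamp x = x.
Proof.
move=> xr; apply/rowP => i; rewrite !mxE.
have := le_trans (coord_le_norm (x - x0) i) xr; rewrite !mxE ler_norml.
move: (x 0 i) (x0 0 i) => a c.
have r0 := r_ge0.
have [] := leP (c + r) a; have [] := leP (c - r) a; have [] := leP (c - r) (c + r); lra.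
Qed.

End Clamp.

Section Frames.
Variables (R : realType) (n : nat) (M : topologicalType).
Variable A : smooth_atlas R n M.
Implicit Types (E : M -> {vspace 'rV[R]_n}).
Local Notation V := 'rV[R]_n.
Local Notation dom p := (chart_dom (chart_at A p)).

Definition frame_mx k (X : 'I_k -> V -> V) (x : V) : 'M[R]_(k, n) := \matrix_i X i x.

Lemma frame_basis E k (X : 'I_k -> V -> V) p q : dom p q ->
  basis_of (E q) [seq dchart_inv A (chart_at A p) q (X i (chart_at A p q)) | i <- enum 'I_k] ->
  (forall v, in_chart A E p (chart_at A p q) v <-> exists a, v = a *m frame_mx X (chart_at A p q))
  /\ row_free (frame_mx X (chart_at A p q)).
Proof.
move=> pq; set D := dchart_inv A (chart_at A p) q; set x := chart_at A p q.
have Dinj u v : D u = D v -> u = v.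
  move=> uv; apply: etrans (esym (dchart_invK u pq)) _.
  exact: etrans (congr1 (dchart A (chart_at A p) q) uv) (dchart_invK v pq).
have IE v : in_chart A E p x v <-> D v \in E q by exact: in_chartE.
clearbody D.
pose T := [tuple D (X i x) | i < k].
rewrite (_ : [seq _ | i <- _] = T :> seq _) // => bT.
have TE (i : 'I_k) : T`_i = D (X i x) by rewrite -tnth_nth tnth_mktuple.
have DE (a : 'rV[R]_k) : D (a *m frame_mx X x) = \sum_i a 0 i *: T`_i.
  rewrite mulmx_sum_row linear_sum; apply: eq_bigr => i _.
  by rewrite linearZ TE rowK.
split.
  move=> v; rewrite IE; split=> [/(coord_basis bT) Dv|[a ->]].
    exists (\row_i coord T i (D v)); apply: Dinj.
    by rewrite Dv DE; apply: eq_bigr => i _; rewrite mxE -Dv.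
  rewrite DE rpred_sum// => i _; rewrite rpredZ//.
  have /andP[/eqP <- _] := bT.
  by apply: memv_span; rewrite TE; apply/mapP; exists i; rewrite ?mem_enum.
apply: inj_row_free => a a0; apply/rowP => i; rewrite mxE.
have fT := basis_free bT.
by move/freeP : fT => /(_ (fun i => a 0 i)); apply; rewrite -DE a0 linear0.
Qed.

Lemma lipschitz_onP (X : V -> V) (D : set V) : [lipschitz X x | x in D] ->
  exists2 L, 0 < L & forall x y, D x -> D y -> `|X x - X y| <= L * `|x - y|.
Proof.
move=> /pinfty_ex_gt0[L L0 H]; exists L => // x y Dx Dy.
exact: (H (x, y)).
Qed.

(** Near [p] the planes are graphs over the plane at [p], and the lift is the graph map, Lipschitz
    because frames and matrix inversion are. It is globalised by clamping to a cube on which this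
    description holds. *)
Lemma lipschitz_lift_field E k :
  has_local_frames A (fun U X => [lipschitz X x | x in U]) k E ->
  forall p, exists (X : lift_field R n) (Q : 'M[R]_n) (r : R),
    [/\ (k <= n)%N, Q \in unitmx,
        lift_proj X =1 (fun v => v *m (invmx Q *m pid_mx k *m Q)), 0 < r &
        forall x, `|x - chart_at A p p| <= r -> (chart_at A p @` dom p) x /\
          forall v, in_chart A E p x v <-> X x v = v].
Proof.
move=> hE p; have [U [X [oU Up UB HL HX]]] := hE p.
set B := chart_at A p in UB HL HX *; set x0 := B p.
have /choice[Li LiP] : forall i : 'I_k, exists L : R, 0 < L /\
    forall x y, (B @` U) x -> (B @` U) y -> `|X i x - X i y| <= L * `|x - y|.
  by move=> i; have [L L0 H] := lipschitz_onP (HL i); exists L.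
pose Lf := 1 + \sum_i Li i.
have Lf0 : 0 < Lf.
  by rewrite /Lf; apply: ltr_wpDr => //; apply: sumr_ge0 => i _; exact: ltW (LiP i).1.
have LiLf i : Li i <= Lf.
  rewrite /Lf (bigD1 i)//=; have : 0 <= \sum_(j | j != i) Li j.
    by apply: sumr_ge0 => j _; exact: ltW (LiP j).1.
  by lra.
pose F := frame_mx X.
pose c1 := k%:R * Lf.
have Flip x y (u : 'rV[R]_k) : (B @` U) x -> (B @` U) y ->
    `|u *m F x - u *m F y| <= c1 * `|x - y| * `|u|.
  move=> Ux Uy; rewrite -mulmxBr /c1 -[k%:R * Lf * _]mulrA.
  apply: mulmx_rows_le => i.
  have -> : row i (F x - F y) = X i x - X i y by apply/rowP => j; rewrite !mxE.
  by apply: le_trans ((LiP i).2 x y Ux Uy) _; rewrite ler_wpM2r.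
have c10 : 0 <= c1 by rewrite mulr_ge0// ltW.
have F0 := frame_basis (UB p Up) (HX p Up); rewrite -/x0 -/F in F0.
have rF0 := F0.2.
have kn : (k <= n)%N by have := rF0; rewrite /row_free => /eqP <-; exact: rank_leq_col.
(* The first [k] rows of [Q] span the plane at [x0]. [W] reads off the first [k] coordinates in the
   basis [Q] and [Z] embeds them back, so [W *m Z] is the matrix of the base projection. *)
pose Q := row_ebase (F x0).
have Qu : Q \in unitmx by exact: row_ebase_unit.
pose W : 'M[R]_(n, k) := invmx Q *m pid_mx k.
pose Z : 'M[R]_(k, n) := pid_mx k *m Q.
have WZ : W *m Z = invmx Q *m pid_mx k *m Q.
  have e : (pid_mx k : 'M[R]_(n, k)) *m (pid_mx k : 'M[R]_(k, n)) = pid_mx k.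
    by rewrite mul_pid_mx !minnn.
  by rewrite -e /W /Z !mulmxA.
have ZW : Z *m W = 1%:M.
  by rewrite /W /Z -mulmxA (mulmxA Q) mulmxV// mul1mx pid_mx_id// pid_mx_1.
pose a x := F x *m W.
have a0u : row_free (a x0).
  have e := mulmx_ebase (F x0); rewrite -/Q in e.
  have rk : \rank (F x0) = k by apply/eqP.
  rewrite rk in e.
  rewrite /a -e /W !mulmxA mulmxK// -mulmxA pid_mx_id// pid_mx_1 mulmx1.
  by rewrite row_free_unit col_ebase_unit.
have [K K0 HK] := row_free_lower a0u.
have [c3 c30 Hc3] := mulmx_bounded W.
have oBU : \forall x \near x0, (B @` U) x.
  apply: open_nbhs_nbhs; split; last by exists p.
  have -> : B @` U = B @` (chart_dom B `&` U).
    by apply/seteqP; split=> _ [z Uz <-]; exists z => //; [split=> //; exact: UB|case: Uz].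
  exact: chart_image_open.
have [r1 r10 Hr1] := nbhs_radius oBU.
(* The first bound keeps the clamped points in the domain of the frame; the second makes
   [K * (c3 * (c1 * r))] at most one half, so that [a] remains invertible there. The [+ 1] covers
   [k = 0], where [c1] vanishes. *)
pose r := Num.min (r1 / 2) (1 / 2 / (K * (c3 * c1) + 1)).
have d1 : 0 < K * (c3 * c1) + 1.
  by apply: ltr_wpDl => //; rewrite !mulr_ge0// ltW.
have r0 : 0 < r by rewrite lt_min !divr_gt0.
pose rho := clamp x0 r.
have rhoU x : (B @` U) (rho x).
  apply: Hr1; apply: le_lt_trans (clamp_near x0 (ltW r0) x) _.
  have : r <= r1 / 2 by rewrite ge_min lexx.
  by lra.
have x0U : (B @` U) x0 by exists p.
have alip x y (u : 'rV[R]_k) : (B @` U) x -> (B @` U) y ->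
    `|u *m a x - u *m a y| <= c3 * (c1 * `|x - y| * `|u|).
  move=> Ux Uy.
  have -> : u *m a x - u *m a y = (u *m F x - u *m F y) *m W by rewrite mulmxBl /a !mulmxA.
  apply: le_trans (Hc3 _) _.
  by rewrite ler_wpM2l ?(ltW c30)//; exact: Flip.
have aK x (u : 'rV[R]_k) : `|u| <= 2 * K * `|u *m a (rho x)|.
  apply: (perturb_lower (d := c3 * (c1 * r)) K0 HK) => [v|].
    apply: le_trans (alip _ _ v (rhoU x) x0U) _.
    rewrite -[leRHS]mulrA ler_wpM2l ?(ltW c30)// ler_wpM2r// ler_wpM2l//.
    exact: clamp_near (ltW r0) x.
  have h : r <= 1 / 2 / (K * (c3 * c1) + 1) by rewrite ge_min lexx orbT.
  rewrite ler_pdivlMr// in h.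
  by lra.
have au x : a (rho x) \in unitmx by rewrite -row_free_unit; exact: lower_row_free (aK x).
pose K2 := 2 * K; have K20 : 0 < K2 by rewrite mulr_gt0.
have aiK x (u : 'rV[R]_k) : `|u *m invmx (a (rho x))| <= K2 * `|u|.
  by have := aK x (u *m invmx (a (rho x))); rewrite mulmxKV.
(* [v] is sent to the only vector of the plane at [rho x] with the same image under [W]. *)
pose N x := W *m invmx (a (rho x)) *m F (rho x).
have vN x (v : V) : v *m N x = v *m W *m invmx (a (rho x)) *m F (rho x).
  by rewrite /N !mulmxA.
have [c4 c40 Hc4] := mulmx_bounded (F x0).
pose c2 := c4 + c1 * r.
have c20 : 0 < c2 by rewrite ltr_wpDr// mulr_ge0// ltW.
have Fb x (u : 'rV[R]_k) : `|u *m F (rho x)| <= c2 * `|u|.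
  have -> : u *m F (rho x) = u *m F x0 + (u *m F (rho x) - u *m F x0) by rewrite addrC subrK.
  apply: le_trans (ler_normD _ _) _; rewrite /c2 mulrDl lerD//.
  apply: le_trans (Flip _ _ u (rhoU x) x0U) _; rewrite ler_wpM2r// ler_wpM2l//.
  exact: clamp_near (ltW r0) x.
pose Mb := c2 * (K2 * c3).
have Mb0 : 0 < Mb by rewrite !mulr_gt0.
(* The first term is the variation of the frame with fixed coefficients, the second that of the
   coefficients through [invmx (a _)]; [1] ensures positivity. *)
pose L := c1 * (K2 * c3) + c2 * (K2 * (c3 * (c1 * (K2 * c3)))) + 1.
have L0 : 0 < L.
  by apply: ltr_wpDl => //; apply: addr_ge0; rewrite !mulr_ge0// ltW.
have Nn x (v : V) : `|mulmxr (N x) v| <= Mb * `|v|.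
  rewrite /= vN; apply: le_trans (Fb _ _) _.
  have -> : Mb * `|v| = c2 * (K2 * (c3 * `|v|)) by rewrite /Mb; ring.
  apply: ler_wpM2l; first exact: ltW.
  apply: le_trans (aiK _ _) _; apply: ler_wpM2l; first exact: ltW.
  exact: Hc3.
have Nl x y (v : V) : `|mulmxr (N x) v - mulmxr (N y) v| <= L * `|x - y| * `|v|.
  rewrite /= !vN; set u := v *m W.
  have uv : `|u| <= c3 * `|v| by exact: Hc3.
  set s := u *m invmx (a (rho x)); set t := u *m invmx (a (rho y)).
  have sb : `|s| <= K2 * (c3 * `|v|).
    by apply: le_trans (aiK _ _) _; apply: ler_wpM2l => //; exact: ltW.
  have rr := clamp_lip x0 r x y; rewrite -/rho in rr.
  have e1 : `|s *m F (rho x) - s *m F (rho y)| <= c1 * `|x - y| * (K2 * (c3 * `|v|)).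
    apply: le_trans (Flip _ _ s (rhoU x) (rhoU y)) _.
    apply: ler_pM => //; first by rewrite mulr_ge0.
    by rewrite ler_wpM2l.
  (* Resolvent identity: a difference of inverses is controlled by the difference of the
     matrices. *)
  have st : s - t = (s *m a (rho y) - s *m a (rho x)) *m invmx (a (rho y)).
    by rewrite mulmxBl mulmxK// /s mulmxKV.
  have e2 : `|s - t| <= K2 * (c3 * (c1 * `|x - y| * (K2 * (c3 * `|v|)))).
    rewrite st; apply: le_trans (aiK _ _) _; rewrite ler_wpM2l ?(ltW K20)//.
    apply: le_trans (alip _ _ s (rhoU y) (rhoU x)) _; rewrite ler_wpM2l ?(ltW c30)//.
    apply: ler_pM => //; first by rewrite mulr_ge0.
    by rewrite ler_wpM2l// distrC.
  have -> : s *m F (rho x) - t *m F (rho y) =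
     (s *m F (rho x) - s *m F (rho y)) + (s - t) *m F (rho y).
    by rewrite mulmxBl addrA subrK.
  apply: le_trans (ler_normD _ _) _.
  have e3 : `|(s - t) *m F (rho y)| <= c2 * (K2 * (c3 * (c1 * `|x - y| * (K2 * (c3 * `|v|))))).
    by apply: le_trans (Fb _ _) _; rewrite ler_wpM2l ?(ltW c20).
  apply: le_trans (lerD e1 e3) _.
  have -> : c1 * `|x - y| * (K2 * (c3 * `|v|)) +
    c2 * (K2 * (c3 * (c1 * `|x - y| * (K2 * (c3 * `|v|))))) = (L - 1) * `|x - y| * `|v|.
    by rewrite /L; ring.
  by rewrite ler_wpM2r// ler_wpM2r//; lra.
have NW x : N x *m W = W.
  by rewrite /N -mulmxA -/(a (rho x)) mulmxKV.
have WN x : W *m Z *m N x = N x.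
  have -> : N x = W *m (invmx (a (rho x)) *m F (rho x)) by rewrite /N mulmxA.
  by rewrite -(mulmxA W Z) (mulmxA Z W) ZW mul1mx.
pose LF := @LiftField R n (fun x => mulmxr (N x)) (mulmxr (W *m Z)) Mb L Mb0 L0 Nn Nl.
have pL q (v : V) : mulmxr (W *m Z) (mulmxr (N q) v) = mulmxr (W *m Z) v.
  by rewrite /= (mulmxA (v *m N q) W Z) -(mulmxA v (N q) W) NW -(mulmxA v W Z).
have Lp q (v : V) : mulmxr (N q) (mulmxr (W *m Z) v) = mulmxr (N q) v.
  by rewrite /= -(mulmxA v (W *m Z) (N q)) WN.
exists (LF pL Lp), Q, r; split=> //.
  by move=> v /=; rewrite WZ.
move=> x xr.
have cx : rho x = x by apply: clamp_id => //; exact: ltW.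
have [z Uz zx] : (B @` U) x by have := rhoU x; rewrite cx.
split; first by exists z => //; exact: UB.
have [Fz _] := frame_basis (UB z Uz) (HX z Uz); rewrite -/F -/B zx in Fz.
move=> v; rewrite Fz /= vN cx.
have auz := au x; rewrite cx in auz.
split=> [[b ->]|<-].
  by rewrite -(mulmxA b) -/(a x) mulmxK.
by exists (v *m W *m invmx (a x)).
Qed.

End Frames.

(** * Riemannian norms and splittings *)

Section InnerProduct.
Variables (R : realType) (n : nat).
Local Notation V := 'rV[R]_n.
Implicit Types (S : 'M[R]_n) (u v w : V).

Definition ip S v w : R := (v *m S *m w^T) 0 0.

Lemma ipDl S u v w : ip S (u + v) w = ip S u w + ip S v w.
Proof. by rewrite /ip !mulmxDl mxE. Qed.

Lemma ipZl S (a : R) v w : ip S (a *: v) w = a * ip S v w.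
Proof. by rewrite /ip -!scalemxAl mxE. Qed.

Lemma ipDm S S' v w : ip (S + S') v w = ip S v w + ip S' v w.
Proof. by rewrite /ip mulmxDr mulmxDl mxE. Qed.

Lemma ip_sym S v w : S^T = S -> ip S v w = ip S w v.
Proof.
move=> sS; rewrite /ip.
have -> : (w *m S *m v^T) = (v *m S *m w^T)^T by rewrite !trmx_mul trmxK sS mulmxA.
by rewrite [RHS]mxE.
Qed.

Definition ipnorm S v : R := Num.sqrt (ip S v v).

Definition posdef S := S^T = S /\ forall v, v != 0 -> 0 < ip S v v.

Lemma ip_ge0 S v : posdef S -> 0 <= ip S v v.
Proof.
move=> [_ pS]; have [->|v0] := eqVneq v 0; last exact/ltW/pS.
by rewrite /ip !mul0mx mxE.
Qed.

Lemma ipnorm_ge0 S v : 0 <= ipnorm S v.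
Proof. exact: sqrtr_ge0. Qed.

Lemma ipnorm_sqr S v : posdef S -> ipnorm S v ^+ 2 = ip S v v.
Proof. by move=> pS; rewrite sqr_sqrtr// ip_ge0. Qed.

Lemma ipnormZ S (a : R) v : S^T = S -> ipnorm S (a *: v) = `|a| * ipnorm S v.
Proof.
move=> sS; rewrite /ipnorm ipZl ip_sym// ipZl mulrA -expr2.
by rewrite sqrtrM ?sqr_ge0// sqrtr_sqr.
Qed.

(** Cauchy-Schwarz, from the nonnegativity of the form at [b v + a w] and [b v - a w], where [a] and
    [b] are the norms of [v] and [w]. *)
Lemma ip_le S v w : posdef S -> `|ip S v w| <= ipnorm S v * ipnorm S w.
Proof.
move=> pS; have [sS _] := pS.
set a := ipnorm S v; set b := ipnorm S w.
have a0 : 0 <= a by exact: ipnorm_ge0.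
have b0 : 0 <= b by exact: ipnorm_ge0.
have aE : ip S v v = a * a by rewrite -expr2 ipnorm_sqr.
have bE : ip S w w = b * b by rewrite -expr2 ipnorm_sqr.
have H (s t : R) : 0 <= s * s * (a * a) + 2 * (s * t) * ip S v w + t * t * (b * b).
  have := ip_ge0 (s *: v + t *: w) pS.
  rewrite ipDl !ipZl ![ip S _ (_ + _)]ip_sym// !ipDl !ipZl (ip_sym w v sS) aE bE.
  set c := ip S v w; have -> : s * (s * (a * a) + t * c) + t * (s * c + t * (b * b)) =
    s * s * (a * a) + 2 * (s * t) * c + t * t * (b * b) by ring.
  by [].
have [a00|an0] := eqVneq a 0.
  have v0 : v = 0.
    apply/eqP; apply: contraT => vn0; have := pS.2 v vn0.
    by rewrite aE a00 mulr0 ltxx.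
  by rewrite v0 /ip !mul0mx mxE normr0 mulr_ge0.
have [b00|bn0] := eqVneq b 0.
  have w0 : w = 0.
    apply/eqP; apply: contraT => vn0; have := pS.2 w vn0.
    by rewrite bE b00 mulr0 ltxx.
  by rewrite w0 /ip trmx0 mulmx0 mxE normr0 mulr_ge0.
have ap : 0 < a by rewrite lt_neqAle eq_sym an0.
have bp : 0 < b by rewrite lt_neqAle eq_sym bn0.
have ab : 0 < a * b by rewrite mulr_gt0.
rewrite ler_norml; apply/andP; split.
  have := H b a; set c := ip S v w.
  have -> : b * b * (a * a) + 2 * (b * a) * c + a * a * (b * b) = (a * b) * (2 * (a * b + c)) by ring.
  by rewrite pmulr_rge0//; lra.
have := H b (- a); set c := ip S v w.
have -> : b * b * (a * a) + 2 * (b * - a) * c + (- a) * (- a) * (b * b) = (a * b) * (2 * (a * b - c)) by ring.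
by rewrite pmulr_rge0//; lra.
Qed.

Lemma ipnormD S v w : posdef S -> ipnorm S (v + w) <= ipnorm S v + ipnorm S w.
Proof.
move=> pS; have sS := pS.1.
rewrite -(@ler_pXn2r _ 2)// ?nnegrE ?addr_ge0 ?ipnorm_ge0//.
rewrite ipnorm_sqr// sqrrD !ipnorm_sqr// ipDl ![ip S _ (_ + _)]ip_sym// !ipDl (ip_sym w v sS).
have := le_trans (ler_norm _) (ip_le v w pS).
move: (ip S v v) (ip S w w) (ip S v w) => a b c; lra.
Qed.

Lemma ip_upper S c v : (forall i, `|row i S| <= c) -> `|ip S v v| <= n%:R * (n%:R * c) * (`|v| * `|v|).
Proof.
move=> H; rewrite /ip mxE.
apply: le_trans (ler_norm_sum _ _ _) _.
apply: (@le_trans _ _ (\sum_(i < n) n%:R * c * `|v| * `|v|)).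
  apply: ler_sum => i _; rewrite [v^T _ _]mxE normrM; apply: ler_pM => //; last exact: coord_le_norm.
  apply: le_trans (coord_le_norm _ i) _; exact: mulmx_rows_le.
by rewrite sumr_const card_ord -mulr_natl; lra.
Qed.

(** Each coordinate of [v] is the inner product of [v] with a fixed vector [w i], so Cauchy-Schwarz
    gives the bound without a compactness argument on the sphere. *)
Lemma posdef_lower S : posdef S -> exists2 K, 0 < K & forall v, `|v| <= K * ipnorm S v.
Proof.
move=> pS; have [sS p] := pS.
have uS : S \in unitmx.
  rewrite -row_free_unit; apply: inj_row_free => v vS; apply/eqP; apply: contraT => v0.
  by have := p v v0; rewrite /ip vS mul0mx mxE ltxx.
pose w i : V := (delta_mx 0 i) *m invmx S.
exists (1 + \sum_i ipnorm S (w i)) => [|v].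
  by apply: ltr_wpDr => //; apply: sumr_ge0 => i _; exact: ipnorm_ge0.
apply: norm_le_coord => [|i].
  by rewrite mulr_ge0 ?ipnorm_ge0// addr_ge0// sumr_ge0// => i _; exact: ipnorm_ge0.
have -> : v 0 i = ip S v (w i).
  rewrite ip_sym// /ip /w mulmxKV// -rowE.
  by rewrite !mxE.
apply: le_trans (ip_le _ _ pS) _; rewrite mulrC ler_wpM2r ?ipnorm_ge0//.
rewrite (bigD1 i)//=.
have : 0 <= \sum_(j | j != i) ipnorm S (w j) by apply: sumr_ge0 => j _; exact: ipnorm_ge0.
by lra.
Qed.

Lemma posdef_perturb S : posdef S -> exists d K : R, [/\ 0 < d, 0 < K &
  forall S', (forall i, `|row i (S' - S)| <= d) -> forall v,
    `|v| <= K * ipnorm S' v /\ ipnorm S' v <= K * `|v|].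
Proof.
move=> pS; have [K K0 HK] := posdef_lower pS.
pose cS := \sum_i `|row i S|.
have cS0 : 0 <= cS by apply: sumr_ge0.
have cSi i : `|row i S| <= cS.
  rewrite /cS (bigD1 i)//=; have : 0 <= \sum_(j | j != i) `|row j S| by exact: sumr_ge0.
  by lra.
pose N : R := n%:R * n%:R.
have N0 : 0 <= N by rewrite mulr_ge0.
(* Makes [K * K * N * d] at most one half, so a perturbed form keeps half of the lower bound; the
   [+ 1] covers dimension 0. *)
pose d := 1 / 2 / (K * K * N + 1).
have kn : 0 < K * K * N + 1 by have := mulr_ge0 (mulr_ge0 (ltW K0) (ltW K0)) N0; lra.
have d0 : 0 < d by rewrite !divr_gt0.
pose K2 := 2 * K + (N * (cS + d) + 1).
have K20 : 0 < K2.
  have : 0 <= N * (cS + d) by rewrite mulr_ge0// addr_ge0// ltW.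
  by rewrite /K2; lra.
exists d, K2; split=> // S' HS' v.
have v0 := normr_ge0 v; have vv0 : 0 <= `|v| * `|v| by rewrite mulr_ge0.
have E : ip S' v v = ip S v v + ip (S' - S) v v.
  by rewrite -ipDm addrC subrK.
have H1 : `|ip (S' - S) v v| <= N * d * (`|v| * `|v|).
  by have := ip_upper v HS'; rewrite /N; lra.
have H2 : `|ip S v v| <= N * cS * (`|v| * `|v|).
  by have := ip_upper v cSi; rewrite /N; lra.
have H3 : `|v| * `|v| <= K * K * ip S v v.
  rewrite -ipnorm_sqr// expr2; have := ler_pM v0 v0 (HK v) (HK v); lra.
have H4 : K * K * (N * d * (`|v| * `|v|)) <= 1 / 2 * (`|v| * `|v|).
  have -> : K * K * (N * d * (`|v| * `|v|)) = K * K * (N * d) * (`|v| * `|v|) by ring.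
  apply: ler_wpM2r => //.
  have : d * (K * K * N + 1) <= 1 / 2 by rewrite /d divfK// gt_eqF.
  move: d0; move: (d) => d' d0; lra.
have KK : 0 < K * K by rewrite mulr_gt0.
have H5 : `|v| * `|v| <= 2 * (K * K) * ip S' v v.
  have h : K * K * - (N * d * (`|v| * `|v|)) <= K * K * ip (S' - S) v v.
    by rewrite ler_pM2l//; move: H1; rewrite ler_norml => /andP[].
  by rewrite E; lra.
have ip0 : 0 <= ip S' v v.
  have : 0 <= 2 * (K * K) * ip S' v v by exact: le_trans vv0 H5.
  by rewrite pmulr_rge0//; lra.
have sq : ipnorm S' v * ipnorm S' v = ip S' v v by rewrite -expr2 sqr_sqrtr.
have nn := ipnorm_ge0 S' v.
split.
  apply: (@le_trans _ _ (2 * K * ipnorm S' v)).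
    rewrite -(@ler_pXn2r _ 2)// ?nnegrE ?mulr_ge0 ?(ltW K0)//.
    rewrite !expr2; have -> : 2 * K * ipnorm S' v * (2 * K * ipnorm S' v) =
      4 * (K * K) * (ipnorm S' v * ipnorm S' v) by ring.
    rewrite sq; have := mulr_ge0 (ltW KK) ip0; lra.
  rewrite ler_wpM2r// /K2.
  have : 0 <= N * (cS + d) by rewrite mulr_ge0// addr_ge0// ltW.
  by lra.
apply: (@le_trans _ _ ((N * (cS + d) + 1) * `|v|)).
  have Nc : 0 <= N * (cS + d) by rewrite mulr_ge0// addr_ge0// ltW.
  rewrite -(@ler_pXn2r _ 2)// ?nnegrE ?mulr_ge0 ?addr_ge0//.
  rewrite !expr2 sq; have -> : (N * (cS + d) + 1) * `|v| * ((N * (cS + d) + 1) * `|v|) =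
    (N * (cS + d) + 1) * (N * (cS + d) + 1) * (`|v| * `|v|) by ring.
  apply: (@le_trans _ _ (N * (cS + d) * (`|v| * `|v|))).
    rewrite E; move: H1 H2; rewrite !ler_norml => /andP[_ h1] /andP[_ h2]; lra.
  rewrite ler_wpM2r//; move: Nc; move: (N * (cS + d)) => z z0; nra.
by rewrite ler_wpM2r// /K2; lra.
Qed.

End InnerProduct.

(** * Projections of a splitting into three subspaces *)

Section Projections.
Variables (R : realType) (n : nat).
Local Notation V := 'rV[R]_n.
Implicit Types (U : {vspace V}).

Definition is_split (U1 U2 U3 : {vspace V}) (p1 p2 p3 : {linear V -> V}) :=
  [/\ forall v, [/\ p1 v \in U1, p2 v \in U2 & p3 v \in U3],
      forall v, v = p1 v + p2 v + p3 v &
      forall v1 v2 v3, v1 \in U1 -> v2 \in U2 -> v3 \in U3 ->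
        [/\ p1 (v1 + v2 + v3) = v1, p2 (v1 + v2 + v3) = v2 & p3 (v1 + v2 + v3) = v3]].

Lemma cap0_unique U1 U2 u1 v1 u2 v2 : (U1 :&: U2 = 0)%VS ->
  u1 \in U1 -> v1 \in U1 -> u2 \in U2 -> v2 \in U2 -> u1 + u2 = v1 + v2 ->
  u1 = v1 /\ u2 = v2.
Proof.
move=> /directv_addP/directv_add_unique H h1 h2 h3 h4 /eqP.
by rewrite H// => /eqP[-> ->].
Qed.

Lemma exists_split U1 U2 U3 :
  (U1 + U2 + U3)%VS = fullv -> directv (U1 + U2 + U3) ->
  exists p1 p2 p3, is_split U1 U2 U3 p1 p2 p3.
Proof.
move=> full; rewrite directv_addE /= => /and3P[d12 _ /eqP d3].
have {}d12 : (U1 :&: U2 = 0)%VS by apply/directv_addP.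
pose q := daddv_pi (U1 + U2)%VS U3.
pose p1 : {linear V -> V} := (daddv_pi U1 U2 \o q)%VF.
pose p2 : {linear V -> V} := (daddv_pi U2 U1 \o q)%VF.
pose p3 : {linear V -> V} := daddv_pi U3 (U1 + U2)%VS.
have d21 : (U2 :&: U1 = 0)%VS by rewrite capvC.
have d3' : (U3 :&: (U1 + U2) = 0)%VS by rewrite capvC.
have e1 v : p1 v = daddv_pi U1 U2 (q v) by exact: comp_lfunE.
have e2 v : p2 v = daddv_pi U2 U1 (q v) by exact: comp_lfunE.
have dec v : v = p1 v + p2 v + p3 v.
  rewrite e1 e2 daddv_pi_add ?memv_pi//.
  by rewrite /p3 daddv_pi_add// full memvf.
have mem v : [/\ p1 v \in U1, p2 v \in U2 & p3 v \in U3].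
  by rewrite e1 e2 /p3 !memv_pi.
exists p1, p2, p3; split=> // v1 v2 v3 h1 h2 h3.
have [m1 m2 m3] := mem (v1 + v2 + v3).
have h12 : v1 + v2 \in (U1 + U2)%VS by rewrite memv_add.
have := dec (v1 + v2 + v3).
have m12 : p1 (v1 + v2 + v3) + p2 (v1 + v2 + v3) \in (U1 + U2)%VS by rewrite memv_add.
move=> e.
have [e12 <-] := cap0_unique d3 h12 m12 h3 m3 e.
have [<- <-] := cap0_unique d12 h1 m1 h2 m2 e12.
by split.
Qed.

End Projections.

Section ManifoldNorms.
Variables (R : realType) (n : nat) (M : topologicalType).
Variable A : smooth_atlas R n M.
Implicit Types (E : M -> {vspace 'rV[R]_n}) (g : M -> 'M[R]_n).
Local Notation V := 'rV[R]_n.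
Local Notation dom p := (chart_dom (chart_at A p)).

Lemma riemannian_posdef g p : riemannian_metric A g -> posdef (g p).
Proof. by move=> [sg pg _]; split; [exact: sg|exact: pg]. Qed.

Lemma near_pull (B : chart R n M) (p : M) (Q : V -> Prop) : chart_dom B p ->
  (\forall x \near B p, Q x) -> \forall q \near p, chart_dom B q /\ Q (B q).
Proof.
move=> Bp H.
have H1 : \forall q \near p, Q (B q) by exact: (chart_fun_cont Bp).
have H2 : \forall q \near p, chart_dom B q.
  by apply: open_nbhs_nbhs; split=> //; exact: chart_dom_open.
by apply: filterS2 H1 H2.
Qed.

Let dist_eq (a b c d r : R) : a = c -> b = d -> `|d - c| <= r -> `|a - b| <= r.
Proof. by move=> -> ->; rewrite distrC. Qed.

(** The Gram matrix of the metric in the fixed chart at [p] has continuous entries, so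
    [posdef_perturb] gives one constant for all nearby points. *)
Lemma metric_local g : riemannian_metric A g -> forall p, exists2 K, 0 < K &
  \forall q \near p, dom p q /\ forall u,
    `|u| <= K * gnorm g q (dchart_inv A (chart_at A p) q u) /\
    gnorm g q (dchart_inv A (chart_at A p) q u) <= K * `|u|.
Proof.
move=> rg p; have [_ _ cg] := rg.
set B := chart_at A p.
have pp : chart_dom B p by exact: chart_at_dom.
pose S q := lin1_mx (dchart_inv A B q) *m g q *m (lin1_mx (dchart_inv A B q))^T.
have ipS q u w : ip (S q) u w = inner g q (dchart_inv A B q u) (dchart_inv A B q w).
  by rewrite /ip /S /inner -!(mul_rV_lin1 (dchart_inv A B q)) trmx_mul !mulmxA.
have pS : posdef (S p).
  have [sg pg _] := rg; split.
    by rewrite /S !trmx_mul trmxK sg mulmxA.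
  move=> v v0; rewrite ipS; apply: pg.
  apply/eqP => e; move/eqP: v0; apply.
  apply: etrans (esym (dchart_invK v pp)) _; rewrite -/B.
  by apply: etrans (congr1 (dchart A B p) e) _; exact: linear0.
have [d [K [d0 K0 HK]]] := posdef_perturb pS.
exists K => //.
have entry q i j : S q i j = inner g q (dchart_inv A B q (delta_mx 0 i)) (dchart_inv A B q (delta_mx 0 j)).
  by rewrite -ipS /ip -rowE trmx_delta -colE !mxE.
clearbody S.
have cS i j : \forall x \near B p, `|S (chart_inv B x) i j - S p i j| <= d.
  have Bp : (B @` chart_dom B) (B p) by exists p.
  have := cg 0%N p (delta_mx 0 i) (delta_mx 0 j) (B p) Bp.
  move=> /(@cvgrPdist_le _ _ _ _ (nbhs_filter (B p))) /(_ _ d0).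
  apply: filterS => x; apply: dist_eq; first exact: entry.
  apply: etrans (entry p i j) _.
  exact: (congr1 (fun q => inner g q (dchart_inv A B q (delta_mx 0 i)) (dchart_inv A B q (delta_mx 0 j))) (esym (chart_funK pp))).
have {}cS : \forall x \near B p, forall i j, `|S (chart_inv B x) i j - S p i j| <= d.
  by apply: near_forall_ord => i; exact: near_forall_ord.
apply: filterS (near_pull pp cS) => q [Bq H]; split=> // u.
rewrite chart_funK// in H.
have [|h1 h2] := HK (S q) _ u.
  by move=> i; apply: norm_le_coord (ltW d0) _ => j; rewrite !mxE; exact: H.
have E : ipnorm (S q) u = gnorm g q (dchart_inv A B q u) by rewrite /ipnorm ipS.
by rewrite -E.
Qed.

Lemma gnormD g p u v : riemannian_metric A g -> gnorm g p (u + v) <= gnorm g p u + gnorm g p v.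
Proof. by move=> rg; exact: (ipnormD _ _ (riemannian_posdef p rg)). Qed.

Lemma gnormZ g p (a : R) v : riemannian_metric A g -> gnorm g p (a *: v) = `|a| * gnorm g p v.
Proof. by move=> rg; apply: ipnormZ; have [] := rg. Qed.

Lemma gnorm_gt0 g p v : riemannian_metric A g -> v != 0 -> 0 < gnorm g p v.
Proof. by move=> [_ pg _] v0; rewrite sqrtr_gt0; exact: pg. Qed.

Lemma gnorm0 g p : riemannian_metric A g -> gnorm g p 0 = 0.
Proof. by move=> rg; rewrite -(scale0r 0) gnormZ// normr0 mul0r. Qed.

Lemma lsub_norm m k (v : 'rV[R]_(m + k)) : `|lsubmx v| <= `|v|.
Proof. by apply: norm_le_coord => // i; rewrite mxE coord_le_norm. Qed.

Lemma rsub_norm m k (v : 'rV[R]_(m + k)) : `|rsubmx v| <= `|v|.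
Proof. by apply: norm_le_coord => // i; rewrite mxE coord_le_norm. Qed.

Let frame_near E k (p : M) :
  has_local_frames A (fun U X => forall x, U x -> {for x, continuous X}) k E ->
  exists F : V -> 'M[R]_(k, n),
    [/\ row_free (F (chart_at A p p)),
       \forall q \near p, dom p q /\ forall v, in_chart A E p (chart_at A p q) v <->
          exists a, v = a *m F (chart_at A p q) &
       forall e : R, 0 < e -> \forall x \near chart_at A p p, forall a : 'rV[R]_k,
          `|a *m F x - a *m F (chart_at A p p)| <= k%:R * e * `|a|].
Proof.
move=> hE; have [U [X [oU Up UB cX HX]]] := hE p.
exists (frame_mx X); split.
- exact: (frame_basis (UB p Up) (HX p Up)).2.
- have : \forall q \near p, U q by exact: open_nbhs_nbhs.
  apply: filterS => q Uq; split; first exact: UB.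
  exact: (frame_basis (UB q Uq) (HX q Uq)).1.
- move=> e e0.
  have H i : \forall x \near chart_at A p p, `|X i (chart_at A p p) - X i x| <= e.
    have Bp : (chart_at A p @` U) (chart_at A p p) by exists p.
    exact: ((@cvgrPdist_le _ _ _ _ (nbhs_filter (chart_at A p p)) _ _).1 (cX i _ Bp) _ e0).
  apply: filterS (near_forall_ord H) => x Hx a.
  rewrite -mulmxBr; apply: mulmx_rows_le => i.
  have -> : row i (frame_mx X x - frame_mx X (chart_at A p p)) = X i x - X i (chart_at A p p).
    by apply/rowP => j; rewrite !mxE.
  by rewrite distrC.
Qed.

Variables (E1 E2 E3 : M -> {vspace V}) (p1 p2 p3 : M -> {linear V -> V}).
Hypothesis sE : [/\ subbundle A E1, subbundle A E2 & subbundle A E3].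
Hypothesis sp : forall p, is_split (E1 p) (E2 p) (E3 p) (p1 p) (p2 p) (p3 p).

(** The three continuous frames, stacked in one matrix, are independent at [p]. The lower bound on
    this matrix survives near [p] and controls the frame coefficients of [u], hence each of its
    components. The components are allowed to have any ranks [k1], [k2], [k3]. *)
Lemma projection_local p : exists2 K, 0 < K & \forall q \near p, dom p q /\
  forall u w, let D := dchart_inv A (chart_at A p) q in
    [\/ D w = p1 q (D u), D w = p2 q (D u) | D w = p3 q (D u)] -> `|w| <= K * `|u|.
Proof.
have [[k1 f1] [k2 f2] [k3 f3]] := sE.
have [F1 [r1 s1 c1]] := frame_near p f1.
have [F2 [r2 s2 c2]] := frame_near p f2.
have [F3 [r3 s3 c3]] := frame_near p f3.
set B := chart_at A p in r1 s1 c1 r2 s2 c2 r3 s3 c3 *.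
have pp : chart_dom B p by exact: chart_at_dom.
pose FF x := col_mx (F1 x) (col_mx (F2 x) (F3 x)).
have FFE x v : v *m FF x = lsubmx v *m F1 x + (lsubmx (rsubmx v) *m F2 x + rsubmx (rsubmx v) *m F3 x).
  by rewrite -{1}(hsubmxK v) -{1}(hsubmxK (rsubmx v)) !mul_row_col.
have rFF : row_free (FF (B p)).
  apply: inj_row_free => v; rewrite FFE addrA.
  set a1 := lsubmx v; set a2 := lsubmx (rsubmx v); set a3 := rsubmx (rsubmx v).
  move=> v0.
  have [_ t1] := nbhs_singleton s1; have [_ t2] := nbhs_singleton s2.
  have [_ t3] := nbhs_singleton s3.
  have Dp w : dchart_inv A B p w = w.
    exact: (etrans (dchart_invE _ _ _ _) (loc_id w pp)).
  have m1 : a1 *m F1 (B p) \in E1 p.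
    exact: (eq_ind _ (fun z => z \in E1 p) ((in_chartE E1 _ pp).1 ((t1 _).2 (ex_intro _ a1 erefl))) _ (Dp _)).
  have m2 : a2 *m F2 (B p) \in E2 p.
    exact: (eq_ind _ (fun z => z \in E2 p) ((in_chartE E2 _ pp).1 ((t2 _).2 (ex_intro _ a2 erefl))) _ (Dp _)).
  have m3 : a3 *m F3 (B p) \in E3 p.
    exact: (eq_ind _ (fun z => z \in E3 p) ((in_chartE E3 _ pp).1 ((t3 _).2 (ex_intro _ a3 erefl))) _ (Dp _)).
  have [_ _ /(_ _ _ _ m1 m2 m3)] := sp p.
  rewrite v0 !linear0 => -[e1 e2 e3].
  have z1 : a1 = 0 by apply: (row_free_inj r1); rewrite mul0mx.
  have z2 : a2 = 0 by apply: (row_free_inj r2); rewrite mul0mx.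
  have z3 : a3 = 0 by apply: (row_free_inj r3); rewrite mul0mx.
  rewrite -(hsubmxK v) -(hsubmxK (rsubmx v)) -/a1 -/a2 -/a3 z1 z2 z3.
  by rewrite !row_mx0.
have [K K0 HK] := row_free_lower rFF.
pose kk : R := k1%:R + (k2%:R + k3%:R).
have kk0 : 0 <= kk by rewrite !addr_ge0.
pose e := 1 / 2 / (K * kk + 1).
have Kk : 0 < K * kk + 1 by have := mulr_ge0 (ltW K0) kk0; lra.
have e0 : 0 < e by rewrite !divr_gt0.
have [b1 b10 hb1] := mulmx_bounded (F1 (B p)).
have [b2 b20 hb2] := mulmx_bounded (F2 (B p)).
have [b3 b30 hb3] := mulmx_bounded (F3 (B p)).
pose b := b1 + b2 + b3 + kk * e.
have b0 : 0 < b by have := mulr_ge0 kk0 (ltW e0); rewrite /b; lra.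
exists (b * (2 * K)); first by rewrite !mulr_gt0.
have near1 : \forall x \near B p, (forall a : 'rV[R]_k1, `|a *m F1 x - a *m F1 (B p)| <= k1%:R * e * `|a|) /\
   ((forall a : 'rV[R]_k2, `|a *m F2 x - a *m F2 (B p)| <= k2%:R * e * `|a|) /\
   (forall a : 'rV[R]_k3, `|a *m F3 x - a *m F3 (B p)| <= k3%:R * e * `|a|)).
  by apply: filterS3 (c1 _ e0) (c2 _ e0) (c3 _ e0).
have near2 : \forall q \near p, (forall v, in_chart A E1 p (B q) v <-> exists a, v = a *m F1 (B q)) /\
   ((forall v, in_chart A E2 p (B q) v <-> exists a, v = a *m F2 (B q)) /\
   (forall v, in_chart A E3 p (B q) v <-> exists a, v = a *m F3 (B q))).
  by apply: filterS3 s1 s2 s3 => q [_ h1] [_ h2] [_ h3].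
apply: filterS2 (near_pull pp near1) near2 => q [Bq [n1 [n2 n3]]] [t1 [t2 t3]].
split=> // u w /=; set D := dchart_inv A B q.
have Dinj x y : D x = D y -> x = y.
  move=> xy; apply: etrans (esym (dchart_invK x Bq)) _.
  exact: etrans (congr1 (dchart A B q) xy) (dchart_invK y Bq).
have [mem dec _] := sp q; have [m1 m2 m3] := mem (D u).
have DK v : D (dchart A B q v) = v by exact: dchartK.
have [a1 A1] := (t1 (dchart A B q (p1 q (D u)))).1
  ((in_chartE E1 _ Bq).2 (eq_ind_r (fun z => z \in E1 q) m1 (DK _))).
have [a2 A2] := (t2 (dchart A B q (p2 q (D u)))).1
  ((in_chartE E2 _ Bq).2 (eq_ind_r (fun z => z \in E2 q) m2 (DK _))).
have [a3 A3] := (t3 (dchart A B q (p3 q (D u)))).1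
  ((in_chartE E3 _ Bq).2 (eq_ind_r (fun z => z \in E3 q) m3 (DK _))).
have P1 : p1 q (D u) = D (a1 *m F1 (B q)) by rewrite -A1 DK.
have P2 : p2 q (D u) = D (a2 *m F2 (B q)) by rewrite -A2 DK.
have P3 : p3 q (D u) = D (a3 *m F3 (B q)) by rewrite -A3 DK.
pose v := row_mx a1 (row_mx a2 a3).
have l1 : lsubmx v = a1 by rewrite row_mxKl.
have l2 : lsubmx (rsubmx v) = a2 by rewrite row_mxKr row_mxKl.
have l3 : rsubmx (rsubmx v) = a3 by rewrite !row_mxKr.
have uv : u = v *m FF (B q).
  apply: Dinj; rewrite FFE l1 l2 l3 (dec (D u)) P1 P2 P3.
  by rewrite (linearD D) (linearD D) addrA.
have a1v : `|a1| <= `|v| by rewrite -l1 lsub_norm.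
have a2v : `|a2| <= `|v| by rewrite -l2 (le_trans (lsub_norm _))// rsub_norm.
have a3v : `|a3| <= `|v| by rewrite -l3 (le_trans (rsub_norm _))// rsub_norm.
have vu : `|v| <= 2 * K * `|u|.
  rewrite uv; apply: (perturb_lower (d := kk * e) K0 HK) => [z|].
    rewrite !FFE opprD [- (_ + _)]opprD addrACA (addrACA (lsubmx (rsubmx z) *m _)).
    have h1 := n1 (lsubmx z); have h2 := n2 (lsubmx (rsubmx z)); have h3 := n3 (rsubmx (rsubmx z)).
    have g1 : k1%:R * e * `|lsubmx z| <= k1%:R * e * `|z|.
      by apply: ler_wpM2l; [rewrite mulr_ge0// ltW|exact: lsub_norm].
    have g2 : k2%:R * e * `|lsubmx (rsubmx z)| <= k2%:R * e * `|z|.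
      by apply: ler_wpM2l; [rewrite mulr_ge0// ltW|rewrite (le_trans (lsub_norm _))// rsub_norm].
    have g3 : k3%:R * e * `|rsubmx (rsubmx z)| <= k3%:R * e * `|z|.
      by apply: ler_wpM2l; [rewrite mulr_ge0// ltW|rewrite (le_trans (rsub_norm _))// rsub_norm].
    apply: le_trans (ler_normD _ _) _; apply: le_trans (lerD (lexx _) (ler_normD _ _)) _.
    rewrite /kk; lra.
  have : e * (K * kk + 1) <= 1 / 2 by rewrite /e divfK// gt_eqF.
  move: e0; move: (e) => e' e0; lra.
have wb (k : nat) (a : 'rV[R]_k) (F : V -> 'M[R]_(k, n)) (c : R) : 0 <= c -> `|a| <= `|v| ->
    (forall a : 'rV[R]_k, `|a *m F (B p)| <= c * `|a|) ->
    (forall a : 'rV[R]_k, `|a *m F (B q) - a *m F (B p)| <= k%:R * e * `|a|) ->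
    c + k%:R * e <= b -> `|a *m F (B q)| <= b * (2 * K) * `|u|.
  move=> c0 av h1 h2 cb.
  have -> : a *m F (B q) = a *m F (B p) + (a *m F (B q) - a *m F (B p)) by rewrite addrC subrK.
  apply: le_trans (ler_normD _ _) _; apply: le_trans (lerD (h1 a) (h2 a)) _.
  rewrite -mulrDl -(mulrA b); apply: ler_pM => //.
    by rewrite addr_ge0// mulr_ge0// ltW.
  exact: le_trans av vu.
have ke1 : 0 <= k1%:R * e by rewrite mulr_ge0// ltW.
have ke2 : 0 <= k2%:R * e by rewrite mulr_ge0// ltW.
have ke3 : 0 <= k3%:R * e by rewrite mulr_ge0// ltW.
have bE : b = b1 + b2 + b3 + (k1%:R * e + k2%:R * e + k3%:R * e) by rewrite /b /kk; ring.
move=> [e1|e1|e1]; [rewrite (Dinj _ _ (etrans e1 P1))|rewrite (Dinj _ _ (etrans e1 P2))|rewrite (Dinj _ _ (etrans e1 P3))].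
- by apply: (wb _ _ _ b1) => //; [exact: ltW|rewrite bE; lra].
- by apply: (wb _ _ _ b2) => //; [exact: ltW|rewrite bE; lra].
- by apply: (wb _ _ _ b3) => //; [exact: ltW|rewrite bE; lra].
Qed.

End ManifoldNorms.

(** * Contraction of the transverse defect by the dynamics *)

Section Dynamics.
Variables (R : realType) (n : nat) (M : topologicalType).
Variable A : smooth_atlas R n M.
Local Notation V := 'rV[R]_n.
Local Notation dom p := (chart_dom (chart_at A p)).

Variables (h : M -> M) (E1 E2 E3 : M -> {vspace V}) (p1 p2 p3 : M -> {linear V -> V}).
Variables (g : M -> 'M[R]_n) (a b : M -> R) (lam : R) (k : nat).
Hypothesis cM : compact [set: M].
Hypothesis hC1 : C1_map A h.
Hypothesis sE : [/\ subbundle A E1, subbundle A E2 & subbundle A E3].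
Hypothesis sp : forall p, is_split (E1 p) (E2 p) (E3 p) (p1 p) (p2 p) (p3 p).
Hypothesis hE : forall y w, [/\ w \in E1 y -> Df A h y w \in E1 (h y),
  w \in E2 y -> Df A h y w \in E2 (h y) & w \in E3 y -> Df A h y w \in E3 (h y)].
Hypothesis rg : riemannian_metric A g.
Hypothesis ab_gt0 : forall q, 0 < a q /\ 0 < b q.
Hypothesis growth : forall q v,
  [/\ v \in E1 q -> gnorm g (h q) (Df A h q v) <= a q * gnorm g q v,
      v \in E2 q -> gnorm g (h q) (Df A h q v) <= a q * gnorm g q v &
      v \in E3 q -> gnorm g q v <= b q * gnorm g (h q) (Df A h q v)].
Hypothesis lam_lt1 : 0 < lam < 1.
Hypothesis bunching : forall q, b q * (a q * a q) < lam.
Hypothesis lipE : has_local_frames A (fun U X => [lipschitz X x | x in U]) k (dsum E1 E2).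

Local Notation E := (dsum E1 E2).

(* The sum of the norms of the components makes the growth rate on [E1 + E2]
   exactly [a]: no orthogonality of the splitting is assumed. *)
Let nu q v := gnorm g q (p1 q v) + gnorm g q (p2 q v) + gnorm g q (p3 q v).
Let N q v := gnorm g q (p3 q v).

Let gn0 q v : 0 <= gnorm g q v.
Proof. exact: sqrtr_ge0. Qed.

Let N_nu q v : N q v <= nu q v.
Proof. by rewrite /N /nu lerDr addr_ge0. Qed.

Let gn_nu q v : gnorm g q v <= nu q v.
Proof.
have [_ dec _] := sp q; rewrite {1}(dec v).
apply: le_trans (gnormD _ _ _ rg) _; rewrite lerD2r; exact: (gnormD q _ _ rg).
Qed.

Let nuD q u v : nu q (u + v) <= nu q u + nu q v.
Proof.
rewrite /nu (linearD (p1 q)) (linearD (p2 q)) (linearD (p3 q)).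
have := gnormD q (p1 q u) (p1 q v) rg; have := gnormD q (p2 q u) (p2 q v) rg.
have := gnormD q (p3 q u) (p3 q v) rg; lra.
Qed.

Let ND q u v : N q (u + v) <= N q u + N q v.
Proof. by rewrite /N (linearD (p3 q)); exact: (gnormD q _ _ rg). Qed.

Let mem_E q v : v \in E q <-> p3 q v = 0.
Proof.
have [mem dec uni] := sp q; have [m1 m2 _] := mem v; split=> [|p0].
  move=> /memv_addP[v1 h1 [v2 h2 ->]].
  have [_ _] := uni v1 v2 0 h1 h2 (mem0v _); by rewrite addr0.
by rewrite (dec v) p0 addr0 memv_add.
Qed.

Let N_E q u v : v \in E q -> N q (u + v) = N q u.
Proof. by move=> /mem_E v0; rewrite /N (linearD (p3 q)) v0 addr0. Qed.

Let norms_local p : exists2 K, 0 < K & \forall q \near p, dom p q /\ forall u,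
    `|u| <= K * nu q (dchart_inv A (chart_at A p) q u) /\
    nu q (dchart_inv A (chart_at A p) q u) <= K * `|u|.
Proof.
have [K1 K10 H1] := metric_local rg p.
have [K2 K20 H2] := projection_local sE sp p.
exists (K1 + 3 * (K1 * K2)) => [|]; first by rewrite addr_gt0// !mulr_gt0.
apply: filterS2 H1 H2 => q [Bq h1] [_ h2]; split=> // u.
set D := dchart_inv A (chart_at A p) q in h1 h2 *.
have DK pv : D (dchart A (chart_at A p) q pv) = pv by exact: dchartK.
have {}h2 u' w : [\/ D w = p1 q (D u'), D w = p2 q (D u') | D w = p3 q (D u')] -> `|w| <= K2 * `|u'|.
  exact: h2.
clearbody D.
have KK : 0 < K1 * K2 by rewrite mulr_gt0.
split.
  apply: (@le_trans _ _ (K1 * gnorm g q (D u))); first exact: (h1 u).1.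
  apply: ler_pM => //; first exact: ltW.
  by rewrite lerDl !mulr_ge0// ltW.
have bound pv : ([\/ pv = p1 q (D u), pv = p2 q (D u) | pv = p3 q (D u)]) ->
    gnorm g q pv <= K1 * K2 * `|u|.
  move=> hpv; have := (h1 (dchart A (chart_at A p) q pv)).2; rewrite DK => /le_trans; apply.
  rewrite -mulrA; apply: ler_wpM2l; first exact: ltW.
  by apply: h2; rewrite DK.
have := bound (p1 q (D u)) (Or31 _ _ erefl).
have := bound (p2 q (D u)) (Or32 _ _ erefl).
have := bound (p3 q (D u)) (Or33 _ _ erefl).
have := mulr_ge0 (ltW K10) (normr_ge0 u).
rewrite /nu; lra.
Qed.

Let norms_at q : exists2 B, 0 < B & [/\ subadditive_le (nu q) B, subadditive_le (N q) B &
  forall v, `|v| <= B * nu q v].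
Proof.
have [B B0 H] := norms_local q; have [qq Hq] := nbhs_singleton H.
have D v : dchart_inv A (chart_at A q) q v = v.
  exact: (etrans (dchart_invE _ _ _ _) (loc_id v qq)).
have h1 v : nu q v <= B * `|v|.
  exact: (eq_ind _ (fun z => nu q z <= B * `|v|) (Hq v).2 _ (D v)).
exists B => //; split.
- by split; [exact: nuD|exact: h1].
- by split; [exact: ND|move=> v; exact: le_trans (N_nu q v) (h1 v)].
- move=> v; exact: (eq_ind _ (fun z => `|v| <= B * nu q z) (Hq v).1 _ (D v)).
Qed.

Let germ q C := germ_bound (in_chart A E q) (chart_at A q q) (nu q) (N q) C.

Let in_chart_cont q (e : R) : 0 < e -> \forall y \near chart_at A q q, forall v,
  in_chart A E q y v -> exists2 w, in_chart A E q (chart_at A q q) w & `|v - w| <= e * `|v|.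
Proof.
move=> e0; have [X [Q [r [_ _ _ r0 HX]]]] := lipschitz_lift_field lipE q.
set x := chart_at A q q in HX *.
have L0 := lift_lip_gt0 X.
have d0 : 0 < Num.min r (e / lift_lip X) by rewrite lt_min r0 divr_gt0.
apply: filterS (near_norm_lt x d0) => y; rewrite lt_min => /andP[yr ye] v.
move=> /((HX y (ltW yr)).2 v).1 Xv.
have xr : `|x - x| <= r by rewrite subrr normr0 ltW.
exists (X x v).
  by apply/((HX x xr).2 _); rewrite -(proj_liftK X x (X x v)) lift_projK proj_liftK.
rewrite -{1}Xv; apply: le_trans (lift_lipschitz _ _ _ _) _.
rewrite ler_wpM2r// mulrC -ler_pdivlMr//; exact: ltW.
Qed.

Let Df_E y w : w \in E y -> Df A h y w \in E (h y).
Proof.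
move=> /memv_addP[w1 m1 [w2 m2 ->]]; rewrite (linearD (Df A h y)).
have [h1 _ _] := hE y w1; have [_ h2 _] := hE y w2.
by rewrite memv_add ?h1 ?h2.
Qed.

Let chart_map p q h' z : C1_map A h' -> (forall y w, w \in E y -> Df A h' y w \in E (h' y)) ->
  dom p z -> dom q (h' z) ->
  \forall y \near chart_at A p z, forall v, in_chart A E p y v ->
     in_chart A E q (loc A h' p q y) ('d (loc A h' p q) y v).
Proof.
move=> Ch hE' pz qz.
have oq : \forall y \near z, dom q (h' y).
  apply: (C1_map_continuous Ch); apply: open_nbhs_nbhs; split => //.
  exact: chart_dom_open.
apply: filterS (near_chart pz oq) => y [py yE qy] v.
rewrite -yE => Ev.
have H := in_chart_loc Ch hE' py qy Ev.
exact: (eq_ind_r (fun z => in_chart A E q z _) H (locE h' q py)).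
Qed.

Let id_E y w : w \in E y -> Df A id y w \in E (id y).
Proof. by move=> Ew; exact: (eq_ind_r (fun z => z \in E y) Ew (Df_id A y w)). Qed.

(** All points near [p] share one lift field in the chart at [p], whose germ bound [2 L] is the same
    everywhere; only the equivalence constants between the chart norm and the norms at [q]
    intervene. *)
Let uniform_local (p : M) : exists2 C : R, 0 < C & \forall q \near p, germ q C.
Proof.
have [K K0 HK] := norms_local p.
have [X [Q [r [_ _ _ r0 HX]]]] := lipschitz_lift_field lipE p.
set x0 := chart_at A p p in HX *.
have pp : dom p p by exact: chart_at_dom.
have L0 := lift_lip_gt0 X.
pose C2 := 2 * lift_lip X; have C20 : 0 < C2 by rewrite mulr_gt0.
(* Speeds and transverse displacements each cost a factor [K] under the change of norm, the speed
   being squared; [+ 1] provides the strict inequality. *)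
exists (K * (C2 * (K * K)) + 1); first by rewrite addr_gt0// !mulr_gt0.
have HB := near_pull pp (near_norm_lt x0 r0).
apply: filterS2 HK HB => q [pq Hq] [_ qr].
have qq : dom q q by exact: chart_at_dom.
have [B B0 [nB NB lB]] := norms_at q.
set y := chart_at A p q in qr.
have [KX KX0 HKX] := linear_bounded (X y).
pose B' := B + 1 + KX.
have BB' : B <= B' by rewrite /B'; lra.
have sub_le (nu' : V -> R) : subadditive_le nu' B -> subadditive_le nu' B'.
  by move=> [s1 s2]; split=> // v; apply: le_trans (s2 v) _; rewrite ler_wpM2r.
have DD v : dchart_inv A (chart_at A p) q ('d (loc A id q p) (chart_at A q q) v) = v.
  apply: etrans (dchart_inv_loc v (C1_map_id A) qq pq) _.
  apply: etrans (Df_id _ _ _) _; exact: (etrans (dchart_invE _ _ _ _) (loc_id v qq)).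
have Ty : loc A id q p (chart_at A q q) = y by exact: locE.
have B'0 : 0 < B' by rewrite /B'; lra.
have Tc : C1_at (loc A id q p) (chart_at A q q) := loc_C1 (C1_map_id A) qq pq.
have Te := chart_map (C1_map_id A) id_E qq pq.
have germy : germ_bound (in_chart A E p) (loc A id q p (chart_at A q q)) Num.norm (fun v => `|v - X y v|) C2.
  rewrite Ty; apply: (@lift_germ_bound _ _ X _ _ (r - `|y - x0|)); first by rewrite subr_gt0.
  move=> z v zy; apply: ((HX z _).2 v).1.
  by have := ler_distD y z x0; lra.
apply: (germ_bound_transfer B'0 K0 K0 C20 Tc Te (in_chart_cont q) (sub_le _ nB) _ _ _ _ _ _ germy).
- by split=> [u v|v]; [exact: ler_normD|rewrite ler_peMl// /B'; lra].
- split=> [u v|v].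
    rewrite (linearD (X y)) opprD addrACA; exact: ler_normD.
  apply: le_trans (ler_normB _ _) _; have := HKX v; rewrite /B'.
  have := mulr_ge0 (ltW B0) (normr_ge0 v); lra.
- move=> v; apply: le_trans (lB v) _; rewrite ler_wpM2r//.
  by apply: le_trans (gn0 q v) (gn_nu q v).
- move=> w _; have := (Hq ('d (loc A id q p) (chart_at A q q) w)).1.
  exact: (eq_ind_r (fun z => `|_| <= K * nu q z -> _) id (DD w)).
- move=> v; set u := 'd (loc A id q p) (chart_at A q q) v.
  have Eu : dchart_inv A (chart_at A p) q (X y u) \in E q.
    have hx : X y (X y u) = X y u by rewrite -(proj_liftK X y (X y u)) lift_projK proj_liftK.
    exact: ((in_chartE E (X y u) pq).1 (((HX y (ltW qr)).2 (X y u)).2 hx)).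
  have e1 : N q v = N q (dchart_inv A (chart_at A p) q (u - X y u)).
    rewrite -(N_E (dchart_inv A (chart_at A p) q (u - X y u)) Eu).
    have s : u = (u - X y u) + X y u by exact: (esym (subrK _ _)).
    have t := linearD (dchart_inv A (chart_at A p) q) (u - X y u) (X y u).
    exact: (congr1 (N q) (etrans (etrans (esym (DD v)) (congr1 (dchart_inv A (chart_at A p) q) s)) t)).
  rewrite e1; apply: le_trans (N_nu _ _) _; exact: (Hq _).2.
- by rewrite ltrDl.
Qed.

Let uniform : exists2 C : R, 0 < C & forall q, germ q C.
Proof.
have /compact_near_coveringP cov := cM.
have H : \forall C \near +oo, [set: M] `<=` (fun q => germ q C).
  apply: cov => p _; have [C C0 HC] := uniform_local p.
  exists ([set q | germ q C], [set D | C <= D]).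
    by split; [exact: HC|exists C; split; [exact: num_real|move=> x /ltW]].
  by move=> [q D] /= [Hq CD]; exact: germ_bound_le CD Hq.
have [C C0 HC] := pinfty_ex_gt0 H.
by exists C => // q; exact: HC.
Qed.

(** Invariance of the three subbundles makes the differential of [h] commute with the projections,
    so speeds grow by at most [a] and transverse displacements shrink by at most [b]; then
    [b * (C * (a * a)) < lam * C]. *)
Let step q C : 0 < C -> germ (h q) C -> germ q (lam * C).
Proof.
move=> C0 H.
have qq : dom q q by exact: chart_at_dom.
have hh : dom (h q) (h q) by exact: chart_at_dom.
have [B1 B10 [n1 N1 l1]] := norms_at q; have [B2 B20 [n2 N2 l2]] := norms_at (h q).
pose B := B1 + B2; have B0 : 0 < B by rewrite addr_gt0.
have BB1 : B1 <= B by rewrite /B; lra.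
have BB2 : B2 <= B by rewrite /B; lra.
have sub_le (nu' : V -> R) B' : B' <= B -> subadditive_le nu' B' -> subadditive_le nu' B.
  by move=> BB [s1 s2]; split=> // v; apply: le_trans (s2 v) _; rewrite ler_wpM2r.
have [a0 b0] := ab_gt0 q.
have Tc : C1_at (loc A h q (h q)) (chart_at A q q) := loc_C1 hC1 qq hh.
have Te := chart_map hC1 Df_E qq hh.
have Ty : loc A h q (h q) (chart_at A q q) = chart_at A (h q) (h q) by exact: locE.
have H' : germ_bound (in_chart A E (h q)) (loc A h q (h q) (chart_at A q q)) (nu (h q)) (N (h q)) C.
  by rewrite Ty.
have [mem dec uni] := sp q.
have pD v : [/\ p1 (h q) (Df A h q v) = Df A h q (p1 q v),
    p2 (h q) (Df A h q v) = Df A h q (p2 q v) & p3 (h q) (Df A h q v) = Df A h q (p3 q v)].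
  have [m1 m2 m3] := mem v.
  have [_ _ uni'] := sp (h q).
  have [d1 _ _] := hE q (p1 q v); have [_ d2 _] := hE q (p2 q v); have [_ _ d3] := hE q (p3 q v).
  have -> : Df A h q v = Df A h q (p1 q v) + Df A h q (p2 q v) + Df A h q (p3 q v).
    rewrite {1}(dec v); apply: etrans (linearD (Df A h q) _ _) _; congr (_ + _).
    exact: (linearD (Df A h q)).
  by apply: uni'; [exact: d1|exact: d2|exact: d3].
apply: (germ_bound_transfer B0 a0 b0 C0 Tc Te (in_chart_cont q) (sub_le _ _ BB1 n1)
   (sub_le _ _ BB2 n2) (sub_le _ _ BB2 N2) _ _ _ _ H').
- move=> v; apply: le_trans (l1 v) _; rewrite ler_wpM2r//.
  by apply: le_trans (gn0 q v) (gn_nu q v).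
- move=> w Ew.
  have {}Ew : w \in E q.
    have := (in_chartE E w qq).1 Ew.
    by move=> Ew'; exact: (eq_ind _ (fun z => z \in E q) Ew' _ (etrans (dchart_invE _ _ _ _) (loc_id w qq))).
  have p30 : p3 q w = 0 by exact/mem_E.
  rewrite -/(Df A h q w); have [e1 e2 e3] := pD w.
  rewrite /nu e1 e2 e3 p30 (linear0 (Df A h q)) !(gnorm0 _ rg) !addr0 mulrDr.
  have [m1 m2 _] := mem w.
  have [g1 _ _] := growth q (p1 q w); have [_ g2 _] := growth q (p2 q w).
  by apply: lerD; [exact: g1|exact: g2].
- move=> v; rewrite -/(Df A h q v); have [_ _ e3] := pD v.
  rewrite /N e3; have [_ _ m3] := mem v; have [_ _ g3] := growth q (p3 q v).
  exact: g3.
- by rewrite mulrCA mulrC ltr_pM2r.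
Qed.

(** The initial constant is the same at every point, so the bound at [z] can be drawn from a point
    arbitrarily far along its forward orbit. Only the radius of the germ deteriorates with the
    number of steps. *)
Let all_germs q eta : 0 < eta -> germ q eta.
Proof.
move=> eta0; have [C C0 HC] := uniform.
have /andP[l0 l1] := lam_lt1.
have Hn m z : germ z (lam ^+ m * C).
  elim: m z => [|m IH] z; first by rewrite expr0 mul1r.
  by rewrite exprS -mulrA; apply: step; [rewrite mulr_gt0// exprn_gt0|exact: IH].
have eC : 0 < eta / C by rewrite divr_gt0.
have lim : (fun m => lam ^+ m) @ \oo --> (0 : R) by apply: cvg_expr; rewrite ger0_norm// ltW.
have [m _ Hm] := (@cvgrPdist_le _ _ _ _ _ _ _).1 lim _ eC.
apply: germ_bound_le (Hn m q).
have := Hm m (leqnn m); rewrite /= sub0r normrN ger0_norm ?exprn_ge0 ?(ltW l0)//.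
by rewrite ler_pdivlMr.
Qed.

Lemma local_integrability p : exists (X : lift_field R n) (Q : 'M[R]_n) (r : R),
    [/\ (k <= n)%N, Q \in unitmx,
        lift_proj X =1 (fun v => v *m (invmx Q *m pid_mx k *m Q)), 0 < r &
        (forall x, `|x - chart_at A p p| <= r -> (chart_at A p @` dom p) x /\
          forall v, in_chart A E p x v <-> X x v = v) /\
        forall y eta, `|y - chart_at A p p| <= r -> 0 < eta ->
          germ_bound (fixed_by X) y Num.norm (fun v => `|v - X y v|) eta].
Proof.
have [X [Q [r [kn Qu XP r0 HX]]]] := lipschitz_lift_field lipE p.
set x0 := chart_at A p p in HX *.
(* Halving the radius leaves every admissible [y] in the interior of the region where the lift
   describes the planes. *)
exists X, Q, (r / 2); split=> //; first by lra.
have r2 : r / 2 <= r by lra.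
split; first by move=> x xr; apply: HX; exact: le_trans r2.
move=> y eta yr eta0.
have yr' : `|y - x0| <= r by exact: le_trans r2.
have [q pq qy] := (HX y yr').1.
have qq : dom q q by exact: chart_at_dom.
have [B B0 [nB NB lB]] := norms_at q.
set T := loc A id p q.
have Tc : C1_at T (chart_at A p q) := loc_C1 (C1_map_id A) pq qq.
have Ty : T (chart_at A p q) = chart_at A q q by exact: locE.
have Te0 := chart_map (C1_map_id A) id_E pq qq.
rewrite qy in Tc Ty Te0.
have [K K0 HK] := linear_bounded ('d T y).
have [J J0 HJ] := linear_bounded (dchart A (chart_at A p) q).
have [KX KX0 HKX] := linear_bounded (X y).
have DE v : 'd T y v = dchart_inv A (chart_at A p) q v.
  by rewrite -qy dchart_invE.
pose al := B * K; have al0 : 0 < al by rewrite mulr_gt0.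
pose be := (1 + KX) * (J * B).
have be0 : 0 < be by apply: mulr_gt0; [lra|exact: mulr_gt0].
(* Half of what the change of norms allows, because the transfer needs a strict inequality. *)
pose C2 := eta / (2 * (be * (al * al))).
have C20 : 0 < C2.
  apply: divr_gt0 => //; apply: mulr_gt0 => //; apply: mulr_gt0 => //.
  exact: mulr_gt0.
pose B' := B + 1 + KX.
have B'0 : 0 < B' by rewrite /B'; lra.
have BB' : B <= B' by rewrite /B'; lra.
have sub_le (nu' : V -> R) : subadditive_le nu' B -> subadditive_le nu' B'.
  by move=> [s1 s2]; split=> // v; apply: le_trans (s2 v) _; rewrite ler_wpM2r.
have H' : germ_bound (in_chart A E q) (T y) (nu q) (N q) C2.
  by rewrite Ty; exact: all_germs.
have dr : 0 < r - `|y - x0| by lra.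
have near_r : \forall z \near y, `|z - x0| <= r.
  apply: filterS (near_norm_lt y dr) => z zy.
  by have := ler_distD y z x0; lra.
have Te : \forall z \near y, forall v, fixed_by X z v -> in_chart A E q (T z) ('d T z v).
  apply: filterS2 Te0 near_r => z H zr v Xv.
  by apply: H; apply/((HX z zr).2 v).
have L0 := lift_lip_gt0 X.
have cont (e : R) : 0 < e -> \forall z \near y, forall v, fixed_by X z v ->
    exists2 w, fixed_by X y w & `|v - w| <= e * `|v|.
  move=> e0; have d0 : 0 < e / lift_lip X by rewrite divr_gt0.
  apply: filterS (near_norm_lt y d0) => z zy v Xv; exists (X y v).
    by rewrite /fixed_by -(proj_liftK X y (X y v)) lift_projK proj_liftK.
  rewrite -{1}Xv; apply: le_trans (lift_lipschitz _ _ _ _) _.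
  rewrite ler_wpM2r// mulrC -ler_pdivlMr//; exact: ltW.
have nB1 : subadditive_le (Num.norm : V -> R) B'.
  by split=> [u v|v]; [exact: ler_normD|rewrite ler_peMl// /B'; lra].
apply: (germ_bound_transfer B'0 al0 be0 C20 Tc Te cont nB1 (sub_le _ nB) (sub_le _ NB) _ _ _ _ H').
- by move=> v; rewrite ler_peMl// /B'; lra.
- move=> w _; rewrite /al -mulrA; apply: le_trans (nB.2 _) _.
  by apply: ler_wpM2l; [exact: ltW|exact: HK].
- move=> v.
  have [mem dec uni] := sp q; set v' := 'd T y v.
  have [m1 m2 m3] := mem v'.
  (* [w] is the transverse component of [v] read in the chart at [p]. Since [v - w] lies in the
     plane, it is fixed by the lift, and the defect of [v] is that of [w]. *)
  pose w := dchart A (chart_at A p) q (p3 q v').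
  have Ew : X y (v - w) = v - w.
    have e1 : dchart_inv A (chart_at A p) q (v - w) = p1 q v' + p2 q v'.
      apply: etrans (linearB (dchart_inv A (chart_at A p) q) v w) _.
      apply: etrans (congr2 (fun s t => s - t) (esym (DE v)) (dchartK (p3 q v') pq)) _.
      exact: (etrans (congr1 (fun z => z - p3 q v') (dec v')) (addrK _ _)).
    have e2 : p1 q v' + p2 q v' \in E q by rewrite memv_add.
    have e3 := (in_chartE E (v - w) pq).2 (eq_ind_r (fun z => z \in E q) e2 e1).
    exact: (((HX y yr').2 (v - w)).1 (eq_ind _ (fun z => in_chart A E p z (v - w)) e3 _ qy)).
  have -> : v - X y v = w - X y w.
    have -> : v - X y v = (v - w) + w - X y (v - w + w) by rewrite subrK.
    by rewrite (linearD (X y)) Ew opprD addrACA subrr add0r.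
  have h1 : `|w - X y w| <= (1 + KX) * `|w|.
    by apply: le_trans (ler_normB _ _) _; have := HKX w; lra.
  have h2 : `|w| <= J * `|p3 q v'| by exact: HJ.
  have h3 : `|p3 q v'| <= B * nu q (p3 q v') by exact: lB.
  have h4 : nu q (p3 q v') = N q v'.
    have [e1 e2 e3] := uni 0 0 (p3 q v') (mem0v _) (mem0v _) m3.
    rewrite !add0r in e1 e2 e3.
    by rewrite /nu e1 e2 e3 !(gnorm0 _ rg) !add0r.
  have nN : 0 <= N q v' by exact: gn0.
  apply: le_trans h1 _.
  have h5 : `|w| <= J * (B * N q v').
    by apply: le_trans h2 _; rewrite ler_wpM2l ?(ltW J0)// -h4.
  have h6 : (1 + KX) * `|w| <= (1 + KX) * (J * (B * N q v')).
    by rewrite ler_wpM2l//; lra.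
  apply: le_trans h6 _; rewrite /be le_eqVlt; apply/orP; left; apply/eqP; ring.
- rewrite /C2; have -> : be * (eta / (2 * (be * (al * al))) * (al * al)) = eta / 2.
    by field; rewrite !gt_eqF.
  by lra.
Qed.

End Dynamics.

(** * Foliation boxes *)

Section LocalLeaves.
Variables (R : realType) (n : nat) (X : lift_field R n).
Local Notation V := 'rV[R]_n.
Local Notation P := (lift_proj X).
Local Notation L := (lift_lip X).
Local Notation Mb := (lift_bound X).
Variables (x0 : V) (r : R).
Hypothesis r_gt0 : 0 < r.
Hypothesis closing : loops_close X x0 r.
Local Notation rho := (flow_radius X r).

Let rho0 : 0 < rho.
Proof. exact: flow_radius_gt0. Qed.

Lemma flow_radius_le : rho <= r.
Proof.
have Mb0 := lift_bound_gt0 X.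
apply: (@le_trans _ _ (r / (1 + 4 * Mb))); first by rewrite ge_min lexx orbT.
have r0 := r_gt0; rewrite ler_pdivrMr; last by lra.
by rewrite ler_peMr ?(ltW r0)//; lra.
Qed.

(* The leaf of [y] is followed back to the point over the base point of [x0]. *)
Definition transversal (y : V) : V := flow X (- (y - x0)) y.
(** [v - P v] selects the leaf through its point over [P x0], and [flow X v], which depends only on
    [P v], selects the position in that leaf. *)
Definition box_map (v : V) : V := flow X v (x0 + (v - P v)).
Definition box_inv (y : V) : V := P (y - x0) + (transversal y - x0).

Lemma proj_transversal y : P (transversal y) = P x0.
Proof.
rewrite /transversal proj_flow linearN linearB opprB addrC subrK.
by [].
Qed.

Lemma flowKV xi c : flow X xi (flow X (- xi) c) = c.
Proof. by have := flowK X (- xi) c; rewrite opprK. Qed.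

Lemma flow_transversal y : flow X (y - x0) (transversal y) = y.
Proof. exact: flowKV. Qed.

Lemma transversal_flow xi c : P c = P x0 -> transversal (flow X xi c) = c.
Proof.
move=> Pc; rewrite /transversal -(flow_proj X (- _)).
have -> : P (- (flow X xi c - x0)) = - P xi.
  by rewrite linearN linearB proj_flow Pc addrAC subrr add0r.
by rewrite -linearN flow_proj flowK.
Qed.

Lemma proj_box_center v : P (x0 + (v - P v)) = P x0.
Proof. by rewrite linearD linearB lift_proj_idem subrr addr0. Qed.

Lemma transversal_box_map v : transversal (box_map v) = x0 + (v - P v).
Proof. by apply: transversal_flow; exact: proj_box_center. Qed.

Lemma proj_box_inv y : P (box_inv y) = P (y - x0).
Proof.
rewrite /box_inv linearD lift_proj_idem [P (transversal y - x0)]linearB proj_transversal.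
by rewrite subrr addr0.
Qed.

Lemma box_mapK v : box_inv (box_map v) = v.
Proof.
have E : P (box_map v - x0) = P v.
  by rewrite (linearB P (box_map v) x0) /box_map proj_flow proj_box_center addrAC subrr add0r.
by rewrite /box_inv transversal_box_map E [x0 + _]addrC addrK addrC subrK.
Qed.

Lemma box_invK y : box_map (box_inv y) = y.
Proof.
rewrite /box_map proj_box_inv.
have -> : x0 + (box_inv y - P (y - x0)) = transversal y.
  by rewrite /box_inv addrAC subrr add0r addrC subrK.
by rewrite -flow_proj proj_box_inv flow_proj flow_transversal.
Qed.

(** Differentiability in the base vector at fixed [c], combined with a Lipschitz bound in the
    starting point that is uniform for [xi'] near [xi], gives joint continuity. *)
Lemma flow_near xi c (e : R) : `|c - x0| <= rho -> `|xi| <= rho -> 0 < e ->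
  exists2 d : R, 0 < d & forall xi' c', `|xi' - xi| < d -> `|c' - c| < d ->
    `|flow X xi' c' - flow X xi c| < e.
Proof.
move=> cr xr e0.
have [K K0 HK] := linear_bounded (X (flow X xi c)).
have [d1 d10 H1] := nbhs_radius (flow_differentiable r_gt0 closing cr xr ltr01).
have K1 : 0 < K + 1 by lra.
set C := expR (2 * (L * (rho + 1))); have C0 : 0 < C by exact: expR_gt0.
have L0 := lift_lip_gt0 X.
pose d := Num.min 1 (Num.min d1 (Num.min (e / 2 / (K + 1)) (e / 2 / C))).
have d0 : 0 < d by rewrite /d !lt_min ltr01 d10 !divr_gt0.
exists d => // xi' c' hx hc.
have {hx} [x1 xd1 x3] : [/\ `|xi' - xi| < 1, `|xi' - xi| < d1 & `|xi' - xi| < e / 2 / (K + 1)].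
  by move: hx; rewrite /d !lt_min => /and4P[].
have {}hc : `|c' - c| < e / 2 / C by move: hc; rewrite /d !lt_min => /and4P[].
have a1 := H1 xi' xd1; rewrite mul1r in a1.
have a2 := HK (xi' - xi).
have a3 : `|flow X xi' c - flow X xi c| < e / 2.
  apply: (@le_lt_trans _ _ ((K + 1) * `|xi' - xi|)); last by rewrite mulrC -ltr_pdivlMr.
  have -> : flow X xi' c - flow X xi c =
    (flow X xi' c - flow X xi c - X (flow X xi c) (xi' - xi)) + X (flow X xi c) (xi' - xi).
    by rewrite subrK.
  by apply: le_trans (ler_normD _ _) _; lra.
have a4 : `|flow X xi' c' - flow X xi' c| <= C * `|c' - c|.
  apply: le_trans (flow_lipschitz _ _ _ _) _; rewrite ler_wpM2r// ler_expR.
  rewrite ler_pM2l// ler_pM2l//.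
  have := ler_normD (xi' - xi) xi; rewrite subrK; lra.
have a5 : C * `|c' - c| < e / 2 by rewrite mulrC -ltr_pdivlMr.
have := ler_distD (flow X xi' c) (flow X xi' c') (flow X xi c); lra.
Qed.

Lemma flow_C1 c x : `|c - x0| <= rho -> `|x| < rho ->
  C1_at (fun y => flow X y c) x /\ forall v, 'd (fun y => flow X y c) x v = X (flow X x c) v.
Proof.
move=> cr xr; have dr : 0 < rho - `|x| by rewrite subr_gt0.
apply: (@eps_C1_at _ _ _ _ x (fun y => X (flow X y c))) => [|e e0].
  apply: filterS (near_norm_lt x dr) => y yx e e0.
  have yd := ler_normD (y - x) x; rewrite subrK in yd; apply: (flow_differentiable r_gt0 closing cr _ e0); lra.
have L0 := lift_lip_gt0 X.
have [d d0 H] := flow_near cr (ltW xr) (divr_gt0 e0 L0).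
apply: filterS (near_norm_lt x d0) => y yx v.
apply: le_trans (lift_lipschitz _ _ _ _) _; rewrite ler_wpM2r//.
rewrite mulrC -ler_pdivlMr//; apply/ltW/H => //.
by rewrite subrr normr0.
Qed.

Lemma box_map_continuous v : `|v| <= rho -> `|v - P v| <= rho -> {for v, continuous box_map}.
Proof.
move=> vr cr; apply/(@cvgrPdist_lt _ _ _ _ (nbhs_filter v)) => e e0.
have cr' : `|x0 + (v - P v) - x0| <= rho by rewrite addrAC subrr add0r.
have [d d0 H] := flow_near cr' vr e0.
have [K K0 HK] := linear_bounded P.
have d1 : 0 < Num.min d (d / (1 + K)) by rewrite lt_min d0 divr_gt0//; lra.
apply: filterS (near_norm_lt v d1) => w; rewrite lt_min => /andP[w1 w2].
rewrite distrC; apply: H => //.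
have -> : x0 + (w - P w) - (x0 + (v - P v)) = (w - v) - P (w - v).
  rewrite (linearB P w v); move: (P w) (P v) => a b; apply/rowP => i; rewrite !mxE; ring.
apply: le_lt_trans (ler_normB _ _) _; have := HK (w - v).
move: w2; rewrite ltr_pdivlMr; last by lra.
by lra.
Qed.

Lemma transversal_near y (e : R) : `|y - x0| <= rho -> 0 < e ->
  exists2 d : R, 0 < d & forall z, `|z - y| < d -> `|transversal z - transversal y| < e.
Proof.
move=> yr e0; have yr' : `|- (y - x0)| <= rho by rewrite normrN.
have [d d0 H] := flow_near yr yr' e0.
exists d => // z zy; apply: H => //.
have -> : - (z - x0) - - (y - x0) = - (z - y) by apply/rowP => i; rewrite !mxE; ring.
by rewrite normrN.
Qed.

Lemma box_inv_continuous y : `|y - x0| <= rho -> {for y, continuous box_inv}.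
Proof.
move=> yr; apply/(@cvgrPdist_lt _ _ _ _ (nbhs_filter y)) => e e0.
have e2 : 0 < e / 2 by lra.
have [d d0 H] := transversal_near yr e2.
have [K K0 HK] := linear_bounded P.
have d1 : 0 < Num.min d (e / 2 / K) by rewrite lt_min d0 divr_gt0.
apply: filterS (near_norm_lt y d1) => w; rewrite lt_min => /andP[w1 w2].
have -> : box_inv y - box_inv w = - (P (w - y) + (transversal w - transversal y)).
  rewrite /box_inv !linearB; apply/rowP => i; rewrite !mxE; ring.
rewrite normrN; apply: le_lt_trans (ler_normD _ _) _.
have h1 := H w w1; have h2 := HK (w - y).
by move: w2; rewrite ltr_pdivlMr//; lra.
Qed.

(** The end of a short tangent curve is reached from its origin by a flow line, and [flow_comp]
    merges this flow line with the one leading back over the base point. *)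
Lemma transversal_const (u u' : R -> V) a b : a <= b ->
  (forall t, a <= t <= b -> cderiv u t (u' t)) ->
  (forall t, a <= t <= b -> X (u t) (u' t) = u' t) ->
  (forall t, a <= t <= b -> `|u t - x0| <= rho / 2) ->
  (forall t, a <= t <= b -> `|u t - u a| <= rho / 4) ->
  transversal (u b) = transversal (u a).
Proof.
move=> ab Hu Hu' H2 H4; have r0 := rho0.
have aa : a <= a <= b by rewrite lexx ab.
have bb : a <= b <= b by rewrite lexx ab.
have E : flow X (- (u b - u a)) (u b) = u a.
  apply: (tangent_curve_flow r_gt0 closing ab Hu Hu') => // t tab.
  by have := H2 t tab; lra.
have {}E : u b = flow X (u b - u a) (u a) by rewrite -{2}E flowKV.
rewrite {1}/transversal {2}E (flow_comp r_gt0 closing).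
- by congr flow; apply/rowP => i; rewrite !mxE; ring.
- by have := H2 a aa; lra.
- by have := H4 b bb; lra.
- by rewrite normrN; exact: H2.
Qed.

Lemma box_sizes : exists2 m : R, 0 < m & forall v, `|v| <= m ->
  [/\ `|v| <= rho / 4, `|v - P v| <= rho / 4, `|box_map v - x0| <= rho / 4 &
      `|transversal (box_map v) - x0| <= rho / 4].
Proof.
have [K K0 HK] := linear_bounded P.
have Mb0 := lift_bound_gt0 X; have r0 := rho0.
pose S := 2 + K + Mb * K.
have MK : 0 < Mb * K by rewrite mulr_gt0.
have S0 : 0 < S by rewrite /S; lra.
exists (rho / 4 / S); first by rewrite !divr_gt0.
move=> v; rewrite ler_pdivlMr// /S => vm.
have v0 := normr_ge0 v; have h1 := HK v.
have h2 : `|v - P v| <= `|v| + K * `|v| by apply: le_trans (ler_normB _ _) _; rewrite lerD2l.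
have Kv : 0 <= K * `|v| by rewrite mulr_ge0// ltW.
have MKv : 0 <= Mb * (K * `|v|) by rewrite mulr_ge0// ltW.
have h3 : `|box_map v - (x0 + (v - P v))| <= Mb * (K * `|v|).
  rewrite /box_map -flow_proj; apply: le_trans (flow_dist _ _ _) _.
  by rewrite ler_wpM2l// ltW.
have h4 : `|x0 + (v - P v) - x0| = `|v - P v| by rewrite addrAC subrr add0r.
split; first by lra.
- by lra.
- have := ler_distD (x0 + (v - P v)) (box_map v) x0; rewrite h4; lra.
- by rewrite transversal_box_map h4; lra.
Qed.

End LocalLeaves.

(** * Slices and coordinate projections *)

Section Slices.
Variables (R : realType) (n k : nat).
Local Notation V := 'rV[R]_n.

Lemma mul_pid_mxE (v : V) j : (v *m pid_mx k) 0 j = if (j < k)%N then v 0 j else 0.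
Proof.
rewrite mxE (bigD1 j)//= big1 ?addr0 => [|i ij].
  by rewrite mxE eqxx /=; case: ifP; rewrite ?mulr1 ?mulr0.
by rewrite mxE (negbTE (_ : (i : nat) != j)) ?mulr0.
Qed.

Lemma slice_pid (x y : V) : slice k y x <-> (x - y) *m pid_mx k = x - y.
Proof.
split=> [H|H j kj].
  apply/rowP => j; rewrite mul_pid_mxE; case: ltnP => // kj.
  by rewrite !mxE H// subrr.
have := congr1 (fun w : V => w 0 j) H; rewrite mul_pid_mxE ltnNge kj /= !mxE.
by move=> /esym/subr0_eq.
Qed.

Lemma slice_proj (Q : 'M[R]_n) (x y : V) : Q \in unitmx ->
  slice k (y *m invmx Q) (x *m invmx Q) <->
  (x - y) *m (invmx Q *m pid_mx k *m Q) = x - y.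
Proof.
move=> Qu; rewrite slice_pid -mulmxBl !mulmxA; split=> [->|H].
  by rewrite mulmxKV.
by rewrite -{2}H mulmxK.
Qed.

Lemma slice_scale (a : R) (x y : V) : a != 0 -> slice k (a *: y) (a *: x) <-> slice k y x.
Proof.
move=> a0; split=> H j kj; last by rewrite !mxE H.
by have := H j kj; rewrite !mxE => /(mulfI a0).
Qed.

Lemma slice_line (x y : V) z : slice k x y -> slice k x (x + z *: (y - x)).
Proof. by move=> H j kj; rewrite !mxE (H j kj) subrr mulr0 addr0. Qed.

Lemma plaque_eq (M : topologicalType) (B : chart R n M) q q' :
  plaque k B q q' -> plaque k B q = plaque k B q'.
Proof.
move=> [_ qq']; apply/seteqP; split=> z [Bz qz]; split=> // j kj.
  by rewrite (qz j kj) (qq' j kj).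
by rewrite (qz j kj) (qq' j kj).
Qed.

End Slices.

Section C1Sums.
Variables (R : realType) (n m : nat).
Local Notation V := 'rV[R]_n.
Local Notation W := 'rV[R]_m.
Implicit Types f g : V -> W.

Lemma C1_at_addZ (a : R) f g x : C1_at f x -> C1_at g x ->
  C1_at (fun y => f y + a *: g y) x /\
  forall v, 'd (fun y => f y + a *: g y) x v = 'd f x v + a *: 'd g x v.
Proof.
move=> fx gx.
have E y : differentiable f y -> differentiable g y ->
    differentiable (fun y => f y + a *: g y) y /\
    forall v, 'd (fun y => f y + a *: g y) y v = 'd f y v + a *: 'd g y v.
  move=> df dg; have dg' : differentiable (a \*: g) y by exact: differentiableZ.
  split=> [|v]; first exact: (differentiableD df dg').
  apply: etrans (congr1 (fun h => h v) (diffD df dg')) _.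
  have e2 := congr1 (fun h : V -> W => h v) (diffZ a dg).
  exact: (congr1 (fun w => 'd f y v + w) e2).
have [dx Ex] := E x (C1_at_diff fx) (C1_at_diff gx).
split; last exact: Ex.
split; first by apply: filterS2 fx.1 gx.1 => y df dg; exact: (E y df dg).1.
move=> e e0; have a0 : 0 < 1 + `|a| by have := normr_ge0 a; lra.
have e1 : 0 < e / (1 + `|a|) by rewrite divr_gt0.
apply: filterS3 fx.1 (fx.2 _ e1) (filterI gx.1 (gx.2 _ e1)) => y df H1 [dg H2] v.
have aux (p q u w : W) (t : R) : `|p - u| <= t -> `|q - w| <= t ->
    `|p + a *: q - (u + a *: w)| <= t + `|a| * t.
  move=> h1 h2; rewrite opprD addrACA -scalerBr; apply: le_trans (ler_normD _ _) _.
  by rewrite normrZ lerD// ler_wpM2l.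
have h := aux _ _ _ _ _ (H1 v) (H2 v).
have e2 := congr2 (fun p q : W => p - q) ((E y df dg).2 v) (Ex v).
rewrite e2; apply: le_trans h _.
have -> : e / (1 + `|a|) * `|v| + `|a| * (e / (1 + `|a|) * `|v|) =
  e / (1 + `|a|) * (1 + `|a|) * `|v| by ring.
by rewrite divfK// gt_eqF.
Qed.

End C1Sums.

Lemma sstep_01 (R : realType) (t : R) : 0 <= sstep t <= 1.
Proof.
have [t0|/ltW t0] := leP t 0; first by rewrite sstep_le0// lexx ler01.
have [t1|/ltW t1] := leP 1 t; first by rewrite sstep_ge1// lexx ler01.
rewrite /sstep (max_r t0) (max_l (_ : t - 1 <= 0)); last by lra.
have h0 := sqr_ge0 t; have h1 := sqr_ge0 (1 - t); rewrite !expr2 in h0 h1.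
have [t2|/ltW t2] := leP 0 (t - 1 / 2); last by nra.
by nra.
Qed.

Lemma ball_convex (R : realType) (n : nat) (u v : 'rV[R]_n) (z : R) :
  `|u| < 1 -> `|v| < 1 -> 0 <= z <= 1 -> `|u + z *: (v - u)| < 1.
Proof.
move=> u1 v1 /andP[z0 z1].
have -> : u + z *: (v - u) = (1 - z) *: u + z *: v by apply/rowP => j; rewrite !mxE; ring.
apply: le_lt_trans (ler_normD _ _) _; rewrite !normrZ !ger0_norm ?subr_ge0//.
have [->|zn] := eqVneq z 1; first by rewrite subrr mul0r add0r mul1r.
have z3 : 0 < 1 - z by rewrite subr_gt0 lt_neqAle zn.
have a1 : (1 - z) * `|u| < (1 - z) * 1 by rewrite ltr_pM2l.
have a2 : z * `|v| <= z * 1 by rewrite ler_wpM2l// ltW.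
lra.
Qed.

(** * Charts adapted to the local leaves *)

Section BoxCharts.
Variables (R : realType) (n : nat) (M : topologicalType).
Variable A : smooth_atlas R n M.
Local Notation V := 'rV[R]_n.
Local Notation dom p := (chart_dom (chart_at A p)).
Variables (E : M -> {vspace V}) (k : nat).
Variables (p : M) (X : lift_field R n) (Q : 'M[R]_n) (r : R).
Local Notation P := (lift_proj X).
Local Notation Bp := (chart_at A p).
Local Notation x0 := (chart_at A p p).
Local Notation rho := (flow_radius X r).
Hypothesis Qu : Q \in unitmx.
Hypothesis PE : P =1 (fun v => v *m (invmx Q *m pid_mx k *m Q)).
Hypothesis r_gt0 : 0 < r.
Hypothesis XE : forall x, `|x - x0| <= r -> (Bp @` dom p) x /\
  forall v, in_chart A E p x v <-> X x v = v.
Hypothesis closing : loops_close X x0 r.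

Let W := invmx Q.

Variable s : R.
Hypothesis s_gt0 : 0 < s.
Hypothesis sizes : forall u : V, `|u| < 1 -> let v := s *: (u *m Q) in
  [/\ `|v| <= rho / 4, `|v - P v| <= rho / 4, `|box_map X x0 v - x0| <= rho / 4 &
      `|transversal X x0 (box_map X x0 v) - x0| <= rho / 4].

Let rho0 : 0 < rho.
Proof. exact: flow_radius_gt0. Qed.

Let rho_r : rho <= r.
Proof. exact: flow_radius_le. Qed.

Let sn0 : s != 0.
Proof. by rewrite gt_eqF. Qed.

(** [Q] turns the projection [P] into the projection on the first [k] coordinates, so leaves become
    slices; [s] shrinks the unit cube into the region where the flow estimates hold. *)
Definition box_point (u : V) : V := box_map X x0 (s *: (u *m Q)).
Definition box_coord (y : V) : V := s^-1 *: (box_inv X x0 y *m W).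

Lemma box_pointK u : box_coord (box_point u) = u.
Proof.
rewrite /box_coord /box_point box_mapK -scalemxAl mulmxK//.
by rewrite scalerA mulVf// scale1r.
Qed.

Lemma box_coordK y : box_point (box_coord y) = y.
Proof.
rewrite /box_coord /box_point -scalemxAl mulmxKV// scalerA mulfV// scale1r.
exact: box_invK.
Qed.

Lemma box_coord_size y : `|box_coord y| < 1 ->
  [/\ `|y - x0| <= rho / 4 & `|transversal X x0 y - x0| <= rho / 4].
Proof. by move=> /sizes /=; rewrite -/(box_point _) box_coordK => -[]. Qed.

Lemma box_coord_dom y : `|box_coord y| < 1 -> (Bp @` dom p) y.
Proof.
move=> /box_coord_size[yr _]; have r1 := rho0; have r2 := rho_r.
by apply: (XE _).1; lra.
Qed.

Lemma box_coord_slice y z : slice k (box_coord y) (box_coord z) <->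
  transversal X x0 z = transversal X x0 y.
Proof.
rewrite /box_coord slice_scale ?invr_eq0// slice_proj// -PE linearB !proj_box_inv.
rewrite /box_inv; move: (P (y - x0)) (P (z - x0)) => a b.
have -> : b + (transversal X x0 z - x0) - (a + (transversal X x0 y - x0)) =
    b - a + (transversal X x0 z - transversal X x0 y).
  by apply/rowP => j; rewrite !mxE; ring.
split=> [/esym/eqP|->]; last by rewrite subrr addr0.
by rewrite addrC -subr_eq0 addrK subr_eq0 => /eqP.
Qed.

Let bdom : set M := dom p `&` [set q | `|box_coord (Bp q)| < 1].

Lemma box_coord_continuous y : `|y - x0| <= rho -> {for y, continuous box_coord}.
Proof.
move=> yr; apply/(@cvgrPdist_lt _ _ _ _ (nbhs_filter y)) => e e0.
have [K K0 HK] := mulmx_bounded W.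
have e1 : 0 < e * s / K by rewrite divr_gt0// mulr_gt0.
have := (@cvgrPdist_lt _ _ _ _ (nbhs_filter y) _ _).1 (box_inv_continuous r_gt0 closing yr) _ e1.
apply: filterS => z; rewrite ltr_pdivlMr// => H.
rewrite /box_coord -scalerBr -mulmxBl normrZ gtr0_norm ?invr_gt0//.
rewrite mulrC ltr_pdivrMr//; apply: le_lt_trans (HK _) _; lra.
Qed.

Lemma box_point_continuous u : `|u| < 1 -> {for u, continuous box_point}.
Proof.
move=> u1; have [h1 h2 _ _] := sizes u1; have r1 := rho0.
have c2 : {for s *: (u *m Q), continuous (box_map X x0)}.
  by apply: (box_map_continuous r_gt0 closing); lra.
have c1 : {for u, continuous (fun u : V => s *: (u *m Q))}.
  apply/(@cvgrPdist_lt _ _ _ _ (nbhs_filter u)) => e e0.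
  have [K K0 HK] := mulmx_bounded Q.
  have e1 : 0 < e / s / K by rewrite !divr_gt0.
  apply: filterS (near_norm_lt u e1) => z; rewrite distrC ltr_pdivlMr// ltr_pdivlMr// => H.
  rewrite -scalerBr -mulmxBl normrZ gtr0_norm// mulrC.
  by apply: le_lt_trans H; rewrite ler_wpM2r ?(ltW s_gt0)// mulrC; exact: HK.
exact: (continuous_comp c1 c2).
Qed.

Let bdom_open : open bdom.
Proof.
rewrite openE => q [dq bq].
have Nd : \forall z \near q, dom p z.
  by apply: open_nbhs_nbhs; split => //; exact: chart_dom_open.
have r1 := rho0; have [h1 _] := box_coord_size bq.
have c : {for q, continuous (box_coord \o Bp)}.
  apply: continuous_comp; first exact: chart_fun_cont.
  by apply: box_coord_continuous; lra.
have d0 : 0 < 1 - `|box_coord (Bp q)| by rewrite subr_gt0.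
have := (@cvgrPdist_lt _ _ _ _ (nbhs_filter q) _ _).1 c _ d0.
apply: filterS2 Nd => z dz /= H; split=> //=.
have := ler_normB (box_coord (Bp q)) (box_coord (Bp q) - box_coord (Bp z)).
rewrite opprB addrC subrK; lra.
Qed.

Let bfun : M -> V := box_coord \o Bp.
Let binv : V -> M := chart_inv Bp \o box_point.

Lemma box_image : bfun @` bdom = ball (0 : V) 1.
Proof.
apply/seteqP; split=> [_ [q [dq bq] <-]|u].
  by rewrite -ball_normE /= sub0r normrN.
rewrite -ball_normE /= sub0r normrN => u1.
have u1' : `|box_coord (box_point u)| < 1 by rewrite box_pointK.
have [q dq qE] := box_coord_dom u1'.
by exists q; [split=> //=; rewrite qE|rewrite /bfun /= qE box_pointK].
Qed.

Let bcod_open : open (bfun @` bdom).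
Proof. by rewrite box_image; exact: ball_open. Qed.

Let bfunK q : bdom q -> binv (bfun q) = q.
Proof. by move=> [dq _]; rewrite /binv /bfun /= box_coordK chart_funK. Qed.

Let bfun_cont q : bdom q -> {for q, continuous bfun}.
Proof.
move=> [dq bq]; have [h1 _] := box_coord_size bq; have r1 := rho0.
apply: continuous_comp; first exact: chart_fun_cont.
by apply: box_coord_continuous; lra.
Qed.

Let binv_cont u : (bfun @` bdom) u -> {for u, continuous binv}.
Proof.
rewrite box_image -ball_normE /= sub0r normrN => u1.
apply: continuous_comp; first exact: box_point_continuous.
by apply: chart_inv_cont; apply: box_coord_dom; rewrite box_pointK.
Qed.

Definition box_chart : chart R n M :=
  Chart bdom_open bcod_open bfunK bfun_cont binv_cont.

Local Notation bc := box_chart.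

Lemma box_chart_center : chart_dom box_chart p.
Proof.
split; first exact: chart_at_dom.
rewrite /= -[x0 in box_coord x0](_ : box_point 0 = x0).
  by rewrite box_pointK normr0.
by rewrite /box_point mul0mx scaler0 /box_map linear0 subrr addr0 flow0.
Qed.

Let lift_idem q v : X q (X q v) = X q v.
Proof. by rewrite -[LHS]proj_liftK lift_projK proj_liftK. Qed.

(** The segment between the two coordinate points, reparametrised by [sstep], keeps its transverse
    part; its image is tangent because the flow is C^1 in the base vector with the lift as
    differential. The distance clause later keeps short curves inside a second box. *)
Lemma box_straight q q' : chart_dom bc q -> plaque k bc q q' ->
  exists c : R -> M, [/\ forall t, tangent_at A E c t, stopped c, c 0 = q, c 1 = q' &
    forall t, plaque k bc q (c t) /\ `|bc (c t) - bc q| <= `|bc q' - bc q|].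
Proof.
move=> bq [bq' qq']; have r1 := rho0; have r2 := rho_r.
set u := bc q; set u' := bc q' in qq' *.
have u1 : `|u| < 1 by exact: bq.2.
have u1' : `|u'| < 1 by exact: bq'.2.
have Su : slice k u u' := qq'.
pose v := s *: (u *m Q); pose w := s *: ((u' - u) *m Q).
have Pw : P w = w.
  rewrite PE /w -scalemxAl !mulmxA mulmxK//.
  by rewrite ((slice_pid k u' u).1 Su).
pose c0 := x0 + (v - P v).
have [h1 h2 _ _] := sizes u1.
have conv z := @ball_convex _ _ u u' z u1 u1'.
have wE (a b : V) z : s *: ((a + z *: (b - a)) *m Q) = s *: (a *m Q) + z *: (s *: ((b - a) *m Q)).
  by rewrite mulmxDl -scalemxAl scalerDr scalerA [s * z]mulrC -scalerA.
have pt z : box_point (u + z *: (u' - u)) = flow X (v + z *: w) c0.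
  rewrite /box_point /box_map.
  rewrite wE -/v -/w.
  have -> : P (v + z *: w) = P v + z *: w by rewrite linearD [P (z *: w)]linearZ /= Pw.
  by congr (flow X _ (x0 + _)); rewrite opprD addrACA subrr addr0.
have vw z : 0 <= z <= 1 -> `|v + z *: w| <= rho / 4.
  move=> z01; have [a _ _ _] := sizes (conv z z01).
  by move: a; rewrite wE.
pose gam t := flow X (v + sstep t *: w) c0.
have gamE t : gam t = box_point (u + sstep t *: (u' - u)) by rewrite pt.
have cr : `|c0 - x0| <= rho by rewrite /c0 addrAC subrr add0r; rewrite /= -/v in h2; lra.
have Dg t : cderiv gam t (X (gam t) (sstep' t *: w)).
  have vt := vw _ (sstep_01 t); have vt' : `|v + sstep t *: w| < rho by lra.
  have [c1 c2] := flow_C1 r_gt0 closing cr vt'.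
  have D1 : cderiv (fun t => v + sstep t *: w) t (sstep' t *: w).
    apply: (@cderiv_comp _ _ (fun z => v + z *: w) (@sstep R)); first exact: sstep_deriv.
    exact: cderiv_affine.
  apply: cderiv_eq (cderiv_diff (C1_at_diff c1) D1) _.
  exact: c2.
have gb t : `|box_coord (gam t)| < 1 by rewrite gamE box_pointK; apply: conv; exact: sstep_01.
have gd t : exists2 z, dom p z & Bp z = gam t.
  by have [z dz zE] := box_coord_dom (gb t); exists z.
exists (chart_inv Bp \o gam); split.
- move=> t; have [z dz zE] := gd t.
  apply: (chart_tangent_at dz (esym zE) (Dg t)).
  have [gr _] := box_coord_size (gb t).
  by apply/(XE _).2; [lra|rewrite lift_idem].
- split=> t t0 /=; rewrite /gam; first by rewrite !sstep_le0.
  by rewrite !sstep_ge1.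
- by rewrite /= gamE sstep_le0// scale0r addr0; exact: (chart_funK bq).
- by rewrite /= gamE sstep_ge1// scale1r addrC subrK; exact: (chart_funK bq').
- move=> t; have [z dz zE] := gd t.
  have E1 : (chart_inv Bp \o gam) t = z by rewrite /= -zE chart_funK.
  have bz : bdom z by split=> //=; rewrite zE.
  have E2 : bc z = u + sstep t *: (u' - u) by rewrite /= /bfun /= zE gamE box_pointK.
  rewrite E1; split.
    split; first exact: bz.
    rewrite -/u /=; have := slice_line (sstep t) Su; rewrite -E2.
    exact.
  rewrite E2 -/u addrAC subrr add0r normrZ.
  have /andP[s0 s1] := sstep_01 t.
  by rewrite ger0_norm// ler_piMl.
Qed.

Lemma box_locally_flat (c : R -> M) t : (forall s, tangent_at A E c s) ->
  chart_dom bc (c t) -> \forall s \near t, slice k (bc (c t)) (bc (c s)).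
Proof.
move=> ct bt; have r1 := rho0; have r2 := rho_r.
have cc := (ct t).1.
have N1 : \forall s \near t, dom p (c s).
  by apply: cc; apply: open_nbhs_nbhs; split; [exact: chart_dom_open|exact: bt.1].
have cu : {for t, continuous (Bp \o c)}.
  by apply: continuous_comp => //; apply: chart_fun_cont; exact: bt.1.
(* Two points of the curve are then within [rho / 8], and all are within [rho / 4 + rho / 16] of the
   centre, as [transversal_const] requires. *)
have r16 : 0 < rho / 16 by lra.
have N2 := (@cvgrPdist_lt _ _ _ _ (nbhs_filter t) _ _).1 cu _ r16.
have [d /= d0 Hd] := (@nbhs_ballP _ _ _ _).1 (filterI N1 N2).
have {}Hd z : `|z - t| < d -> dom p (c z) /\ `|Bp (c t) - Bp (c z)| < rho / 16.
  by move=> zt; apply: Hd; rewrite /ball /= distrC.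
have [tr _] := box_coord_size bt.2.
have /choice[u' Hu'] : forall z, exists v, `|z - t| < d ->
    cderiv (Bp \o c) z v /\ in_chart A E p (Bp (c z)) v.
  move=> z; have [zt|] := boolP (`|z - t| < d); last by exists 0.
  by have [v v1 v2] := tangent_at_chart (ct z) (Hd z zt).1; exists v.
have K a b : a <= b -> (forall z, a <= z <= b -> `|z - t| < d) ->
    transversal X x0 (Bp (c b)) = transversal X x0 (Bp (c a)).
  move=> ab Hz.
  have Hn z : a <= z <= b -> `|Bp (c z) - x0| <= rho / 2.
    move=> /Hz /Hd[_ h]; have := ler_distD (Bp (c t)) (Bp (c z)) x0.
    rewrite (distrC (Bp (c z)) (Bp (c t))); lra.
  apply: (@transversal_const _ _ X x0 r r_gt0 closing (Bp \o c) u' a b) => //.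
  - by move=> z /Hz /Hu'[].
  - move=> z zab; have [_ h] := Hu' z (Hz z zab).
    by apply/(XE _).2 => //; have := Hn z zab; lra.
  - move=> z zab; have [_ h] := Hd z (Hz z zab).
    have aa : a <= a <= b by rewrite lexx ab.
    have [_ h'] := Hd a (Hz a aa); have := ler_distD (Bp (c t)) (Bp (c z)) (Bp (c a)).
    rewrite (distrC (Bp (c z)) (Bp (c t))) /=; lra.
apply: filterS (@near_norm_lt R R t _ d0) => z zt.
apply/box_coord_slice; move: zt; rewrite ltr_norml => /andP[z1 z2].
have [tz|/ltW tz] := leP t z.
  by apply: K => // y yz; rewrite ltr_norml; lra.
by apply/esym/K => // y yz; rewrite ltr_norml; lra.
Qed.

Variable q0 : M.
Hypothesis q0_in : chart_dom bc q0.
Let c0 := transversal X x0 (Bp q0).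

(** The box is not known to be C^1 across leaves. The single leaf through [c0] is the graph of a C^1
    flow map over the base, and subtracting this graph flattens it by a C^1 change of
    coordinates. *)
Definition straighten (y : V) : V := P (y - x0) + (y - flow X (y - x0) c0).
Definition unstraighten (v : V) : V := flow X v c0 + (v - P v).

Let c0_near : `|c0 - x0| <= rho.
Proof. by have [_] := box_coord_size q0_in.2; have r1 := rho0; rewrite -/c0; lra. Qed.

Let Pc0 : P c0 = P x0.
Proof. exact: proj_transversal. Qed.

Lemma proj_straighten y : P (straighten y) = P (y - x0).
Proof.
rewrite /straighten linearD lift_proj_idem (linearB P y (flow X (y - x0) c0)) proj_flow Pc0.
rewrite (linearB P y x0); move: (P y) (P x0) => a b.
by apply/rowP => j; rewrite !mxE; ring.
Qed.

Lemma straightenK y : unstraighten (straighten y) = y.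
Proof.
rewrite /unstraighten proj_straighten -(flow_proj X (straighten y)) proj_straighten flow_proj.
rewrite /straighten; move: (P _) (flow _ _ _) => a b.
by apply/rowP => j; rewrite !mxE; ring.
Qed.

Lemma unstraightenK v : straighten (unstraighten v) = v.
Proof.
have E1 : P (unstraighten v - x0) = P v.
  rewrite /unstraighten (linearB P _ x0) linearD proj_flow Pc0 linearB lift_proj_idem.
  by rewrite subrr addr0 addrAC subrr add0r.
rewrite /straighten E1 -(flow_proj X (_ - _)) E1 flow_proj /unstraighten.
move: (P _) (flow _ _ _) => a b.
by apply/rowP => j; rewrite !mxE; ring.
Qed.

Lemma straighten_fixed y : P (straighten y) = straighten y <-> transversal X x0 y = c0.
Proof.
rewrite proj_straighten /straighten.
split=> [/eqP|<-]; last by rewrite flow_transversal subrr addr0.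
rewrite -{1}[P _]addr0 (inj_eq (addrI _)) eq_sym subr_eq0 => /eqP ->.
exact: transversal_flow.
Qed.

Lemma straighten_C1 y : `|y - x0| < rho -> C1_at straighten y /\
  forall w, 'd straighten y w = P w + w - X (flow X (y - x0) c0) w.
Proof.
move=> yr.
pose L1 : {linear V -> V} := P \+ idfun.
have [a1 a2] := C1_at_lin L1 x0 x0 y.
have [b1 b2] := C1_at_lin (idfun : {linear V -> V}) x0 0 y.
have E1 : 0 + idfun (y - x0) = y - x0 by rewrite add0r.
have yr' : `|0 + idfun (y - x0)| < rho by rewrite E1.
have [d1 d2] := flow_C1 r_gt0 closing c0_near yr'.
have e1 := C1_at_comp b1 d1.
have e2 v : 'd ((flow X)^~ c0 \o (fun y => 0 + idfun (y - x0))) y v = X (flow X (y - x0) c0) v.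
  apply: etrans (diff_compE v b1 d1) _.
  apply: etrans (congr1 ('d ((flow X)^~ c0) (0 + idfun (y - x0))) (b2 v)) _.
  by apply: etrans (d2 v) _; rewrite E1.
have [f1 f2] := C1_at_addZ (-1) a1 e1.
have ext : (fun y => x0 + L1 (y - x0) +
    -1 *: ((flow X)^~ c0 \o (fun y => 0 + idfun (y - x0))) y) = straighten.
  apply/funext => z; rewrite /= add0r scaleN1r /straighten; move: (P _) (flow _ _ _) => a b.
  by apply/rowP => j; rewrite !mxE; ring.
rewrite -ext; split=> [//|w].
apply: etrans (f2 w) _.
apply: etrans (congr2 (fun p q : V => p + -1 *: q) (a2 w) (e2 w)) _.
by rewrite scaleN1r.
Qed.

Lemma unstraighten_C1 y : `|y - x0| < rho -> C1_at unstraighten (straighten y).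
Proof.
move=> yr; set v0 := straighten y.
pose L2 : {linear V -> V} := idfun \- P.
have [a1 _] := C1_at_lin L2 0 0 v0.
(* The flow depends only on the projection of its base vector, so [v] may be replaced by
   [y - x0 + (v - v0)], which has the same projection and lies in the ball where [flow_C1]
   applies. *)
have [b1 _] := C1_at_lin (idfun : {linear V -> V}) v0 (y - x0) v0.
have yr' : `|y - x0 + idfun (v0 - v0)| < rho by rewrite subrr addr0.
have [d1 _] := flow_C1 r_gt0 closing c0_near yr'.
have [f1 _] := C1_at_addZ 1 a1 (C1_at_comp b1 d1).
apply: C1_at_near f1; apply: near_all => v.
rewrite /= subr0 add0r scale1r /unstraighten addrC; congr (_ + _).
have Pv0 : P v0 = P (y - x0) := proj_straighten y.
rewrite -[LHS]flow_proj; have -> : P (y - x0 + (v - v0)) = P v.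
  by rewrite (linearD P (y - x0)) (linearB P v) Pv0 addrC subrK.
exact: flow_proj.
Qed.

Let sfun : M -> V := (fun y => straighten y *m W) \o Bp.
Let sinv : V -> M := chart_inv Bp \o (fun x => unstraighten (x *m Q)).

Let sfunK q : bdom q -> sinv (sfun q) = q.
Proof.
by move=> [dq _]; rewrite /sinv /sfun /= mulmxKV// straightenK chart_funK.
Qed.

Let mul_C1 (B : 'M[R]_n) x : C1_at (fun y : V => y *m B) x /\ forall v, 'd (fun y : V => y *m B) x v = v *m B.
Proof.
have [h1 h2] := C1_at_lin (mulmxr B : {linear V -> V}) 0 0 x.
have E1 : (fun y : V => 0 + mulmxr B (y - 0)) = (fun y => y *m B).
  by apply/funext => y; rewrite /= subr0 add0r.
by rewrite E1 in h1 h2.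
Qed.

Let in_rho q : bdom q -> `|Bp q - x0| < rho.
Proof. by move=> [_ bq]; have [h _] := box_coord_size bq; have r1 := rho0; lra. Qed.

Let inv_C1 q : bdom q -> C1_at (fun x => unstraighten (x *m Q)) (sfun q).
Proof.
move=> bq; have [m1 _] := mul_C1 Q (sfun q).
have u1 := unstraighten_C1 (in_rho bq).
have E1 : straighten (Bp q) = sfun q *m Q by rewrite /sfun /= mulmxKV.
by rewrite E1 in u1; exact: (C1_at_comp m1 u1).
Qed.

Let inv_near q : bdom q -> \forall x \near sfun q,
  exists2 z, bdom z & Bp z = unstraighten (x *m Q).
Proof.
move=> bq; have c := differentiable_continuous (C1_at_diff (inv_C1 bq)).
have E1 : unstraighten (sfun q *m Q) = Bp q by rewrite /sfun /= mulmxKV// straightenK.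
have o : open (Bp @` (dom p `&` bdom)) by apply: chart_image_open; exact: bdom_open.
have N : \forall y \near unstraighten (sfun q *m Q), (Bp @` (dom p `&` bdom)) y.
  by apply: open_nbhs_nbhs; split=> //; rewrite E1; exists q => //; split=> //; exact: bq.1.
have N' : \forall x \near sfun q, (Bp @` (dom p `&` bdom)) (unstraighten (x *m Q)) := c _ N.
by apply: filterS N' => x [z [_ bz] zE]; exists z.
Qed.

Let scod_open : open (sfun @` bdom).
Proof.
rewrite openE => _ [q bq <-].
apply: filterS (inv_near bq) => x [z bz zE]; exists z => //.
by rewrite /sfun /= zE unstraightenK mulmxK.
Qed.

Let sfun_C1 q : bdom q -> C1_at (fun y => straighten y *m W) (Bp q).
Proof.
move=> bq; have [t1 _] := straighten_C1 (in_rho bq).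
exact: (C1_at_comp t1 (mul_C1 W (straighten (Bp q))).1).
Qed.

Let sfun_cont q : bdom q -> {for q, continuous sfun}.
Proof.
move=> bq; apply: continuous_comp; first by apply: chart_fun_cont; exact: bq.1.
exact: differentiable_continuous (C1_at_diff (sfun_C1 bq)).
Qed.

Let sinv_cont x : (sfun @` bdom) x -> {for x, continuous sinv}.
Proof.
move=> [q bq <-]; apply: continuous_comp.
  exact: differentiable_continuous (C1_at_diff (inv_C1 bq)).
apply: chart_inv_cont; have [z bz zE] := nbhs_singleton (inv_near bq).
by rewrite -zE; exists z => //; exact: bz.1.
Qed.

Definition slice_chart : chart R n M :=
  Chart bdom_open scod_open sfunK sfun_cont sinv_cont.

Lemma slice_chart_C1 : C1_chart A slice_chart.
Proof.
move=> q; split; apply: C1_at_Ck1 => x [z [h1 h2] <-].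
  have E0 : loc A id q p (chart_at A q z) = Bp z := @locE _ _ _ A id _ p _ h1.
  have s1 := sfun_C1 h2; rewrite -E0 in s1.
  exact: (C1_at_comp (loc_C1 (C1_map_id A) h1 h2.1) s1).
have i1 := inv_C1 h1.
have l1 := loc_C1 (C1_map_id A) h1.1 h2.
have E1 : Bp z = unstraighten (sfun z *m Q) by rewrite /sfun /= mulmxKV// straightenK.
by rewrite E1 in l1; exact: (C1_at_comp i1 l1).
Qed.

Lemma slice_chart_plaque q : chart_dom bc q -> plaque k bc q0 q <-> slice k 0 (slice_chart q).
Proof.
move=> bq.
have -> : slice k 0 (slice_chart q) <-> slice k (0 *m W) (straighten (Bp q) *m W) by rewrite mul0mx.
rewrite slice_proj// subr0 -PE straighten_fixed.
split=> [[_] /box_coord_slice //|H]; split => //.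
exact/box_coord_slice.
Qed.

Lemma slice_chart_tangent q : chart_dom bc q -> plaque k bc q0 q ->
  forall v, v \in E q <-> slice k 0 (dchart A slice_chart q v).
Proof.
move=> bq pq v; have zz := chart_at_dom A q.
have l1 := loc_C1 (C1_map_id A) zz bq.1.
have E1 : loc A id q p (chart_at A q q) = Bp q := @locE _ _ _ A id _ p _ zz.
have s1 := sfun_C1 bq.
have [t1 t2] := straighten_C1 (in_rho bq).
have [m1 m2] := mul_C1 W (straighten (Bp q)).
pose w := dchart A (chart_at A p) q v.
have D1 : dchart A slice_chart q v = (P w + w - X (Bp q) w) *m W.
  pose F (x y : V) : V := 'd (fun y => straighten y *m W) x y.
  have s1' := s1; rewrite -E1 in s1'.
  have e0 : dchart A slice_chart q v =
      F (loc A id q p (chart_at A q q)) ('d (loc A id q p) (chart_at A q q) v).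
    exact: (diff_compE v l1 s1').
  have e1 : F (loc A id q p (chart_at A q q)) ('d (loc A id q p) (chart_at A q q) v) = F (Bp q) w.
    exact: (congr2 F E1 (esym (dchartE A p q v))).
  have e2 : F (Bp q) w = 'd straighten (Bp q) w *m W.
    exact: (etrans (diff_compE w t1 m1) (m2 _)).
  have cE : flow X (Bp q - x0) c0 = Bp q.
    have <- : transversal X x0 (Bp q) = c0 by apply/box_coord_slice; exact: pq.2.
    exact: flow_transversal.
  have e3 : 'd straighten (Bp q) w = P w + w - X (Bp q) w by rewrite -{3}cE; exact: t2.
  exact: (etrans e0 (etrans e1 (etrans e2 (congr1 (mulmx^~ W) e3)))).
rewrite D1; clear D1.
have -> : slice k 0 ((P w + w - X (Bp q) w) *m W) <-> slice k (0 *m W) ((P w + w - X (Bp q) w) *m W).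
  by rewrite mul0mx.
rewrite slice_proj// subr0 -PE.
(* On the plaque the differential of the straightening is [w |-> P w + w - X w], whose value is
   fixed by [P] exactly when [w] is fixed by the lift, that is, when [v] lies in the plane. *)
have -> : P (P w + w - X (Bp q) w) = P w.
  by rewrite (linearB P (P w + w)) (linearD P (P w)) lift_proj_idem lift_projK addrK.
have yr : `|Bp q - x0| <= r by have := in_rho bq; have r2 := rho_r; lra.
have vE : v \in E q <-> X (Bp q) w = w.
  rewrite -(XE yr).2 (in_chartE E w bq.1).
  by have -> : dchart_inv A (chart_at A p) q w = v by exact: dchartK bq.1.
rewrite vE; move: (P w) (X (Bp q) w) => a b.
split=> [->|/eqP]; first by rewrite addrK.
rewrite -[X in X == _ -> _]addr0 -addrA (inj_eq (addrI _)) eq_sym subr_eq0 => /eqP.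
by [].
Qed.

End BoxCharts.

Section LeafBoxes.
Variables (R : realType) (n : nat) (M : topologicalType).
Variable A : smooth_atlas R n M.
Local Notation V := 'rV[R]_n.
Variables (E : M -> {vspace V}) (k : nat).

Definition tangent_curve (c : R -> M) := (forall t, tangent_at A E c t) /\ stopped c.

(** The interface between the local analysis and the global study of leaves: flatness confines
    tangent curves to plaques, straightness makes plaques part of leaves. *)
Record leaf_box (B : chart R n M) : Prop := LeafBox {
  leaf_box_image : B @` chart_dom B = ball (0 : V) 1;
  leaf_box_straight : forall q q', chart_dom B q -> plaque k B q q' ->
    exists c : R -> M, [/\ tangent_curve c, c 0 = q, c 1 = q' &
      forall t, plaque k B q (c t) /\ `|B (c t) - B q| <= `|B q' - B q|];
  leaf_box_flat : forall c t, tangent_curve c -> chart_dom B (c t) ->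
    \forall s \near t, slice k (B (c t)) (B (c s));
  leaf_box_tangent : forall q, chart_dom B q -> C1_submanifold_tangent A k (plaque k B q) E
}.

Lemma exists_leaf_box p (X : lift_field R n) (Q : 'M[R]_n) (r : R) : Q \in unitmx ->
  lift_proj X =1 (fun v => v *m (invmx Q *m pid_mx k *m Q)) -> 0 < r ->
  (forall x, `|x - chart_at A p p| <= r -> (chart_at A p @` chart_dom (chart_at A p)) x /\
    forall v, in_chart A E p x v <-> X x v = v) ->
  (forall y eta, `|y - chart_at A p p| <= r -> 0 < eta ->
    germ_bound (fixed_by X) y Num.norm (fun v => `|v - X y v|) eta) ->
  exists2 B, chart_dom B p & leaf_box B.
Proof.
move=> Qu PE r0 XE /(flow_loop_closing r0) closing.
have [m m0 Hm] := box_sizes X (chart_at A p p) r0.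
have [K K0 HK] := mulmx_bounded Q.
pose s := m / K; have s0 : 0 < s by rewrite divr_gt0.
have sizes (u : V) : `|u| < 1 -> let v := s *: (u *m Q) in
  [/\ `|v| <= flow_radius X r / 4, `|v - lift_proj X v| <= flow_radius X r / 4,
      `|box_map X (chart_at A p p) v - chart_at A p p| <= flow_radius X r / 4 &
      `|transversal X (chart_at A p p) (box_map X (chart_at A p p) v) - chart_at A p p|
        <= flow_radius X r / 4].
  move=> u1; apply: Hm; rewrite normrZ gtr0_norm// /s mulrAC ler_pdivrMr// ler_pM2l//.
  by apply: le_trans (HK u) _; rewrite ler_piMr// ltW.
exists (box_chart Qu r0 XE closing s0 sizes); first exact: box_chart_center.
split=> [|q q' bq qq'|c t [ct _]|q bq q0 pq0].
- exact: (box_image Qu r0 XE s0 sizes).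
- have [c [c1 c2 c3 c4 c5]] := box_straight PE bq qq'.
  by exists c; split.
- exact: box_locally_flat.
- have bq0 := pq0.1; rewrite (plaque_eq pq0).
  exists (slice_chart bq0); split=> //.
  + exact: slice_chart_C1.
  + apply/seteqP; split=> z [h1 h2].
      by split=> //; apply/(slice_chart_plaque PE bq0 h2).
    by split=> //; apply/(slice_chart_plaque PE bq0 h1).
  + move=> z [h1 h2]; exact: (slice_chart_tangent PE).
Qed.

End LeafBoxes.

Lemma rat_dense (R : realType) (x e : R) : 0 < e -> exists q : rat, `|ratr q - x| < e.
Proof.
move=> e0; have [|q] := @rat_in_itvoo R (x - e) (x + e); first by lra.
by rewrite in_itv /= => /andP[h1 h2]; exists q; rewrite ltr_norml; lra.
Qed.

(** A nontrivial interval contained in [S] would be countable, hence Lebesgue null. *)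
Lemma connected_countable_point (R : realType) (S : set R) x y :
  connected S -> countable S -> S x -> S y -> x = y.
Proof.
move=> /connected_intervalP iS cS.
have H a b : S a -> S b -> a < b -> False.
  move=> Sa Sb ab.
  have sub : [set` `[a, b]] `<=` S.
    by move=> z /=; rewrite in_itv /=; exact: iS.
  have c : countable [set` `[a, b]] := sub_countable (subset_card_le sub) cS.
  have := countable_lebesgue_measure0 c.
  rewrite lebesgue_measure_itv /= lte_fin ab -EFinB => -[]/eqP.
  by rewrite subr_eq0 => /eqP ba; rewrite ba ltxx in ab.
move=> Sx Sy; have [|xy|yx] := ltgtP x y; last by [].
- by move=> xy; case: (H x y Sx Sy xy).
- by case: (H y x Sy Sx xy).
Qed.

(** * Leaves *)

Section Leaves.
Variables (R : realType) (n : nat) (M : topologicalType).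
Variable A : smooth_atlas R n M.
Local Notation V := 'rV[R]_n.
Variables (E : M -> {vspace V}) (k : nat).
Local Notation tcurve := (tangent_curve A E).

Lemma tangent_at_cst p t : tangent_at A E (fun=> p) t.
Proof.
split; first exact: cst_continuous.
by exists 0; [exact: cderiv_cst|exact: mem0v].
Qed.

Lemma tangent_at_near (c d : R -> M) t : (\forall s \near t, c s = d s) ->
  tangent_at A E c t -> tangent_at A E d t.
Proof.
move=> cd [cc [v cv Ev]]; have E1 := nbhs_singleton cd.
split.
  have E2 : c t = d t by [].
  have h : d x @[x --> t] --> c t by apply: cvg_trans cc; exact: (near_eq_cvg cd).
  by rewrite E2 in h.
exists v; last by rewrite -E1.
by apply: cderiv_near cv; apply: filterS cd => s /= ->; rewrite E1.
Qed.

Lemma tangent_at_comp (c : R -> M) (h : R -> R) t m : cderiv h t m ->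
  tangent_at A E c (h t) -> tangent_at A E (c \o h) t.
Proof.
move=> hm [cc [v cv Ev]].
split; first by apply: continuous_comp; [exact: (cderiv_continuous hm)|exact: cc].
exists (m *: v); last exact: memvZ.
exact: (cderiv_comp hm cv).
Qed.

Let affine_deriv (a b t : R) : cderiv (fun s => a * s + b) t a.
Proof. by apply: cderiv_ext (cderiv_lin b a t) => s; rewrite addrC mulrC. Qed.

Lemma tangent_curve_cst p : tcurve (fun=> p).
Proof. by split=> // t; exact: tangent_at_cst. Qed.

Lemma tangent_curve_rev c : tcurve c -> tcurve (fun t => c (1 - t)).
Proof.
move=> [ct [c0 c1]]; split=> [t|].
  have E1 t' : -1 * t' + 1 = 1 - t' by rewrite mulN1r addrC.
  apply: (@tangent_at_comp c (fun s => 1 - s) t (-1)); last exact: ct.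
  by apply: cderiv_ext (affine_deriv (-1) 1 t) => s; rewrite E1.
split=> t t0; first by rewrite subr0; apply: c1; lra.
by rewrite subrr; apply: c0; lra.
Qed.

Lemma tangent_curve_sub c t : tcurve c -> tcurve (fun s => c (sstep s * t)).
Proof.
move=> [ct _]; split=> [s|].
  apply: (@tangent_at_comp c (fun s => sstep s * t) s (sstep' s *: t)); last exact: ct.
  apply: (@cderiv_comp _ _ (fun x : R => x * t) (@sstep R)); first exact: sstep_deriv.
  by apply: cderiv_ext (cderiv_lin 0 t _) => x; rewrite add0r.
split=> s s0; first by rewrite (sstep_le0 s0) (sstep_le0 (lexx 0)).
by rewrite (sstep_ge1 s0) (sstep_ge1 (lexx 1)).
Qed.

(* The pause between the two curves makes the concatenation tangent at the junction. *)
Lemma tangent_curve_cat c d : tcurve c -> tcurve d -> c 1 = d 0 ->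
  exists e, [/\ tcurve e, e 0 = c 0 & e 1 = d 1].
Proof.
move=> [ct [c0 c1]] [dt [d0 d1]] cd.
pose e t := if t <= 1 / 2 then c (3 * t + 0) else d (3 * t + -2).
have eL t : t < 2 / 3 -> e t = c (3 * t + 0).
  move=> h2; rewrite /e; have [//|h1] := leP t (1 / 2); rewrite d0; last by lra.
  by rewrite [RHS]c1; [rewrite cd|lra].
have eR t : 1 / 3 < t -> e t = d (3 * t + -2).
  move=> h2; rewrite /e; have [h1|//] := leP t (1 / 2); rewrite c1; last by lra.
  by rewrite [RHS]d0; [rewrite cd|lra].
exists e; split.
- split=> [t|].
    have [h|h] := ltP t (2 / 3).
      apply: (@tangent_at_near (c \o (fun s => 3 * s + 0))); last first.
        by apply: (tangent_at_comp (affine_deriv 3 0 t)); exact: ct.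
      have h' : 0 < 2 / 3 - t by lra.
      apply: filterS (@near_norm_lt R R t _ h') => s; rewrite ltr_norml => /andP[_ s1].
      by rewrite eL//; lra.
    apply: (@tangent_at_near (d \o (fun s => 3 * s + -2))); last first.
      by apply: (tangent_at_comp (affine_deriv 3 (-2) t)); exact: dt.
    have h' : 0 < t - 1 / 3 by lra.
    apply: filterS (@near_norm_lt R R t _ h') => s; rewrite ltr_norml => /andP[s1 _].
    by rewrite eR//; lra.
  split=> t t0.
    by rewrite !eL; [rewrite c0; [rewrite [RHS]c0//; lra|lra]|lra|lra].
  by rewrite !eR; [rewrite d1; [rewrite [RHS]d1//; lra|lra]|lra|lra].
- by rewrite eL; [congr c; lra|lra].
- by rewrite eR; [congr d; lra|lra].
Qed.

Definition leaf (p : M) : set M := [set q | exists c, [/\ tcurve c, c 0 = p & c 1 = q]].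

Lemma leaf_refl p : leaf p p.
Proof. by exists (fun=> p); split=> //; exact: tangent_curve_cst. Qed.

Lemma leaf_sym p q : leaf p q -> leaf q p.
Proof.
move=> [c [ct c0 c1]]; exists (fun t => c (1 - t)); rewrite subr0 subrr.
by split=> //; exact: tangent_curve_rev.
Qed.

Lemma leaf_trans p q z : leaf p q -> leaf q z -> leaf p z.
Proof.
move=> [c [ct c0 c1]] [d [dt d0 d1]].
have [|e [et e0 e1]] := tangent_curve_cat ct dt; first by rewrite c1.
by exists e; rewrite e0 e1.
Qed.

Lemma leaf_eq p q : leaf p q -> leaf q = leaf p.
Proof.
move=> pq; apply/seteqP; split=> z; first exact: leaf_trans.
by apply: leaf_trans; exact: leaf_sym.
Qed.

Lemma leaf_curve c t : tcurve c -> leaf (c 0) (c t).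
Proof.
move=> ct; exists (fun s => c (sstep s * t)); split; first exact: tangent_curve_sub.
  by rewrite sstep_le0// mul0r.
by rewrite sstep_ge1// mul1r.
Qed.

Lemma tangent_curve_continuous c : tcurve c -> continuous c.
Proof. by move=> [ct _] t; exact: (ct t).1. Qed.

Lemma leaf_path_connected p : path_connected R (leaf p).
Proof.
move=> q q' pq pq'.
have [c [ct c0 c1]] : leaf q q' by apply: leaf_trans pq'; exact: leaf_sym.
exists c; split=> //.
  by apply: continuous_subspaceT => t; exact: tangent_curve_continuous.
by move=> _ [t _ <-]; apply: leaf_trans pq _; rewrite -c0; exact: leaf_curve.
Qed.

Lemma leaf_map h p q : C1_map A h ->
  (forall y w, w \in E y -> Df A h y w \in E (h y)) -> leaf p q -> leaf (h p) (h q).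
Proof.
move=> Ch hE [c [[ct [c0 c1]] cp cq]]; exists (h \o c); rewrite /= cp cq; split=> //.
split=> [t|]; first exact: tangent_at_map.
by split=> t t0 /=; rewrite ?(c0 t t0) ?(c1 t t0).
Qed.

Lemma leaf_invariant f f' : cancel f f' -> cancel f' f -> C1_map A f -> C1_map A f' ->
  (forall y w, w \in E y -> Df A f y w \in E (f y)) ->
  (forall y w, w \in E y -> Df A f' y w \in E (f' y)) ->
  invariant_foliation f leaf.
Proof.
move=> fK f'K Cf Cf' fE f'E p; apply/seteqP; split=> [_ [q pq <-]|q pq].
  exact: leaf_map.
exists (f' q); last exact: f'K.
by rewrite -[p]fK; exact: leaf_map.
Qed.

(** Flatness makes each transverse coordinate locally constant along the curve, so its derivative
    vanishes everywhere. *)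
Lemma leaf_box_curve B c : leaf_box A E k B -> tcurve c -> (forall t, chart_dom B (c t)) ->
  forall t, plaque k B (c 0) (c t).
Proof.
move=> lB ct cB t; split; first exact: cB.
move=> j kj; apply: (@cderiv0_eq R (fun s => B (c s) 0 j)) => s _ e e0.
apply: filterS (leaf_box_flat lB ct (cB s)) => s' H.
by rewrite (H j kj) subrr scaler0 subrr normr0 mulr_ge0// ltW.
Qed.

Lemma plaque_sub_component B q : leaf_box A E k B -> chart_dom B q ->
  plaque k B q `<=` connected_component (leaf q `&` chart_dom B) q.
Proof.
move=> lB Bq q' qq'; have [c [ct c0 c1 cp]] := leaf_box_straight lB Bq qq'.
exists (c @` `[0, 1]); last by exists 1 => //=; rewrite in_itv /= ler01 lexx.
split; first by exists 0 => //=; rewrite in_itv /= ler01 lexx.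
  move=> _ [t _ <-]; split; last exact: (cp t).1.1.
  by rewrite -c0; exact: leaf_curve.
apply: connected_continuous_connected; first exact: segment_connected.
by apply: continuous_subspaceT => t; exact: tangent_curve_continuous.
Qed.

End Leaves.

(** * Countably many plaques in a leaf *)

Section Countability.
Variables (R : realType) (n : nat) (M : topologicalType).
Variable A : smooth_atlas R n M.
Local Notation V := 'rV[R]_n.
Variables (E : M -> {vspace V}) (k : nat).
Local Notation tcurve := (tangent_curve A E).

(** Rational leaf coordinates on the plaque of [z]. The result depends on [z] only through its
    plaque, so a passage from one box to another carries countable data. *)
Definition plaque_point (B : chart R n M) (w : 'rV[rat]_n) (z : M) : M :=
  chart_inv B (\row_j if (j < k)%N then ratr (w 0 j) else B z 0 j).

Lemma plaque_point_eq B w z z' : plaque k B z z' -> plaque_point B w z' = plaque_point B w z.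
Proof.
move=> [_ zz']; congr (chart_inv B _); apply/rowP => j; rewrite !mxE.
by case: ltnP => // kj; exact: zz'.
Qed.

Lemma plaque_sym (B : chart R n M) z z' : chart_dom B z -> plaque k B z z' -> plaque k B z' z.
Proof. by move=> Bz [Bz' zz']; split=> // j kj; rewrite (zz' j kj). Qed.

(* A rational point close enough to [z] in its plaque is joined to [z] by a
   curve that stays in the domain of [C]. *)
Lemma plaque_point_switch B C z : leaf_box A E k B -> leaf_box A E k C ->
  chart_dom B z -> chart_dom C z ->
  exists w, chart_dom C (plaque_point B w z) /\ plaque k C (plaque_point B w z) z.
Proof.
move=> lB lC Bz Cz.
have Nz : \forall y \near z, chart_dom C y.
  by apply: open_nbhs_nbhs; split=> //; exact: chart_dom_open.
have [d d0 Hd] := nbhs_radius (near_chart Bz Nz).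
have /choice[w Hw] : forall j : 'I_n, exists a : rat, `|ratr a - B z 0 j| < d / 2.
  by move=> j; apply: rat_dense; lra.
exists (\row_j w j); rewrite /plaque_point; set x := \row_j _.
have xu : `|x - B z| <= d / 2.
  apply: norm_le_coord => [|j]; first by lra.
  rewrite !mxE; case: ifP => _; first exact: ltW.
  by rewrite subrr normr0; lra.
have xd : `|x - B z| < d by lra.
have [h1 h2 _] := Hd x xd; set y := chart_inv B x in h1 h2 *.
have zy : plaque k B z y.
  by split=> // j kj; rewrite h2 mxE ltnNge kj.
have [c [ct c0 c1 cp]] := leaf_box_straight lB Bz zy.
have cC t : chart_dom C (c t).
  have [[Bc _] ct'] := cp t; rewrite h2 in ct'.
  have cd : `|B (c t) - B z| < d by exact: le_lt_trans xd.
  by have [_ _] := Hd _ cd; rewrite chart_funK.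
have := leaf_box_curve lC ct cC 1; rewrite c0 c1 => p1.
by split; [exact: p1.1|exact: plaque_sym p1].
Qed.

Variables (Bs : nat -> chart R n M) (q : M).
Hypothesis Bs_box : forall i, leaf_box A E k (Bs i).
Hypothesis Bs_cover : forall z, exists i, chart_dom (Bs i) z.

(** A chain of passages starting at [q]; the head of the list is the last one. There are countably
    many codes, and ill-formed ones are harmless since they only add values. *)
Definition code (l : seq (nat * 'rV[rat]_n)) : M :=
  foldr (fun a z => plaque_point (Bs a.1) a.2 z) q l.

Let coded z := exists l i, chart_dom (Bs i) (code l) /\ plaque k (Bs i) (code l) z.

Lemma coded_switch z m : coded z -> chart_dom (Bs m) z ->
  exists l, chart_dom (Bs m) (code l) /\ plaque k (Bs m) (code l) z.
Proof.
move=> [l [i [h1 h2]]] Cz.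
have [w Hw] := plaque_point_switch (Bs_box i) (Bs_box m) h2.1 Cz.
by exists ((i, w) :: l); rewrite /= -(plaque_point_eq w h2).
Qed.

Lemma leaf_coded z : leaf A E q z -> coded z.
Proof.
move=> [c [ct c0 c1]].
have coded0 : coded (c 0).
  have [i qi] := Bs_cover q; exists [::], i; rewrite c0 /=.
  by split=> //; split.
have loc t : \forall s \near t, coded (c s) <-> coded (c t).
  have [m Cm] := Bs_cover (c t).
  have N1 : \forall s \near t, chart_dom (Bs m) (c s).
    by apply: (tangent_curve_continuous ct); apply: open_nbhs_nbhs; split=> //; exact: chart_dom_open.
  apply: filterS2 N1 (leaf_box_flat (Bs_box m) ct Cm) => s Cs ts.
  split=> H; [have [l [h1 h2]] := coded_switch H Cs|have [l [h1 h2]] := coded_switch H Cm];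
    exists l, m; split=> //; split=> // j kj.
    by rewrite -(h2.2 j kj) (ts j kj).
  by rewrite (ts j kj) (h2.2 j kj).
(* Connectedness of the line: the indicator of being coded is locally constant, so it has derivative
   zero and takes the same value at both ends. *)
pose f t : R := if `[< coded (c t) >] then 1 else 0.
have f01 : f 0 = f 1.
  apply: cderiv0_eq => t _ e e0; apply: filterS (loc t) => s H.
  have -> : f s = f t by rewrite /f (asbool_equiv_eq H).
  by rewrite subrr scaler0 subrr normr0 mulr_ge0// ltW.
rewrite -c1; move: f01; rewrite /f (asboolT coded0).
by case: asboolP => // _ /eqP; rewrite oner_eq0.
Qed.

Lemma component_sub_plaque i : chart_dom (Bs i) q ->
  connected_component (leaf A E q `&` chart_dom (Bs i)) q `<=` plaque k (Bs i) q.
Proof.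
move=> qi z Hz; split; first by have [] := connected_component_sub Hz.
move=> j kj.
set C := connected_component _ _ in Hz.
pose f (y : M) : R := Bs i y 0 j.
have Cq : C q by apply: connected_component_refl; split=> //; exact: leaf_refl.
have Csub : C `<=` leaf A E q `&` chart_dom (Bs i) := @connected_component_sub _ _ _.
have fC : connected (f @` C).
  apply: connected_continuous_connected; first exact: component_connected.
  apply: continuous_in_subspaceT => y /set_mem /Csub [_ Cy].
  have cj : {for Bs i y, continuous (fun x : V => x 0 j)} by exact: coord_continuous.
  exact: (continuous_comp (chart_fun_cont Cy) cj).
(* Every point of the component lies in the plaque of a coded point of the same box, so the
   transverse coordinate takes only values indexed by codes. *)
have cC : countable (f @` C).
  apply: (@sub_countable _ _ _ (range (fun l => f (code l)))).
    apply: subset_card_le => _ [y /Csub [qy Cy] <-].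
    have [l [h1 h2]] := coded_switch (leaf_coded qy) Cy.
    by exists l => //; rewrite /f (h2.2 j kj).
  exact: (sub_countable (card_image_le _ _)).
by apply: (connected_countable_point fC cC); [exists z|exists q].
Qed.

End Countability.

(** Compactness is applied along the filter of lists that contain a given finite list, for which
    membership of any fixed point holds eventually. *)
Lemma compact_list_cover (M : topologicalType) (D : M -> set M) : compact [set: M] ->
  (forall p, open (D p)) -> (forall p, D p p) ->
  exists l : seq M, forall z, exists2 p, p \in l & D p z.
Proof.
move=> /compact_near_coveringP cM oD Dp.
pose F : set_system (seq M) := fun S =>
  exists l0 : seq M, forall l : seq M, {subset l0 <= l} -> S l.
have FF : Filter F.
  split=> [|S T [s Ss] [t Tt]|S T ST [s Ss]].
  - by exists [::].
  - exists (s ++ t) => l stl; split; [apply: Ss|apply: Tt] => x xs; apply: stl;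
    by rewrite mem_cat xs ?orbT.
  - by exists s => l /Ss /ST.
have [|l0 H] := cM _ F (fun l z => exists2 p, p \in l & D p z) FF.
  move=> x _; exists (D x, [set l : seq M | x \in l]) => /=.
    split; first exact: open_nbhs_nbhs.
    by exists [:: x] => l; apply; rewrite inE.
  by move=> [z l] /= [Dz xl]; exists x.
by exists l0 => z; exact: (H l0 (fun _ => id) z).
Qed.

Section LeafFoliation.
Variables (R : realType) (n : nat) (M : topologicalType).
Variable A : smooth_atlas R n M.
Local Notation V := 'rV[R]_n.
Variables (E : M -> {vspace V}) (k : nat).
Hypothesis cM : compact [set: M].
Hypothesis kn : (k <= n)%N.
Hypothesis boxes : forall p, exists2 B, chart_dom B p & leaf_box A E k B.

Lemma leaf_box_foliation B : leaf_box A E k B -> foliation_box k (leaf A E) B.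
Proof.
move=> lB; split; first exact: (leaf_box_image lB).
move=> q Bq; apply/seteqP; split; last exact: plaque_sub_component.
have /choice[C HC] : forall p, exists B, chart_dom B p /\ leaf_box A E k B.
  by move=> p; have [D D1 D2] := boxes p; exists D.
have [D cov] := compact_list_cover cM (fun p => @chart_dom_open _ _ _ (C p)) (fun p => (HC p).1).
(* Index 0 is the box under study and the successors run through the finite cover; past its end, the
   default [q] repeats one box. *)
pose Bs i := if i is i'.+1 then C (nth q D i') else B.
have Bs_box i : leaf_box A E k (Bs i) by case: i => [//|i]; exact: (HC _).2.
apply: (@component_sub_plaque _ _ _ A E k Bs q Bs_box _ 0%N Bq) => z.
have [p pD zp] := cov z; exists (index p D).+1.
by rewrite /= nth_index.
Qed.

Lemma leaf_foliation : foliation R n k (leaf A E).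
Proof.
split=> //.
- exact: leaf_refl.
- by move=> p q; exact: leaf_eq.
- exact: leaf_path_connected.
- by move=> p; have [B Bp lB] := boxes p; exists B => //; exact: leaf_box_foliation.
Qed.

Lemma leaf_foliation_tangent : foliation_tangent A k (leaf A E) E.
Proof.
move=> p; have [B Bp lB] := boxes p; exists B; split=> //; first exact: leaf_box_foliation.
exact: leaf_box_tangent.
Qed.

End LeafFoliation.

Lemma is_split_rev (R : realType) n (U1 U2 U3 : {vspace 'rV[R]_n}) p1 p2 p3 :
  is_split U1 U2 U3 p1 p2 p3 -> is_split U3 U2 U1 p3 p2 p1.
Proof.
move=> [h1 h2 h3]; split=> [v|v|v3 v2 v1 m3 m2 m1].
- by have [a b c] := h1 v.
- by rewrite {1}(h2 v) -addrA addrC [_ + p3 v]addrC.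
- have -> : v3 + v2 + v1 = v1 + v2 + v3 by rewrite -addrA addrC [_ + v1]addrC.
  by have [a b c] := h3 v1 v2 v3 m1 m2 m3.
Qed.

Lemma uniform_bound_lt1 (R : realType) (M : topologicalType) (phi : M -> R) :
  compact [set: M] -> continuous phi -> (forall q, phi q < 1) ->
  exists2 lam : R, 0 < lam < 1 & forall q, phi q < lam.
Proof.
move=> cM cphi phi1.
pose D p := [set q | phi q < (phi p + 1) / 2].
have oD p : open (D p).
  by apply: (@open_comp _ _ phi [set y | y < (phi p + 1) / 2]) => [x _|]; [exact: cphi|exact: open_lt].
have Dp p : D p p by rewrite /D /=; have := phi1 p; lra.
have [l cov] := compact_list_cover cM oD Dp.
have [lam lam01 Hl] : exists2 lam : R, 0 < lam < 1 &
    forall p, p \in l -> (phi p + 1) / 2 <= lam.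
  (* The starting value [1 / 2] keeps the bound positive and serves for the empty cover of an empty
     manifold. *)
  elim: l {cov} => [|p l [lam lam01 IH]]; first by exists (1 / 2) => //; lra.
  exists (Num.max lam ((phi p + 1) / 2)).
    by rewrite lt_max gt_max; have := phi1 p; case/andP: lam01 => -> -> /=; lra.
  move=> q; rewrite inE => /orP[/eqP ->|ql]; first by rewrite le_max lexx orbT.
  by rewrite le_max IH.
exists lam => // q; have [p pl pq] := cov q.
exact: lt_le_trans pq (Hl p pl).
Qed.

(** * Foliations from domination, and the two directions of time *)

Section Foliations.
Variables (R : realType) (n : nat) (M : topologicalType).
Variable A : smooth_atlas R n M.
Local Notation V := 'rV[R]_n.

Lemma unit_rescaling (g : M -> 'M[R]_n) p p' (T : {linear V -> V}) v :
  riemannian_metric A g -> v != 0 -> exists u, [/\ gnorm g p u = 1,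
    forall U : {vspace V}, v \in U -> u \in U &
    gnorm g p' (T v) = gnorm g p v * gnorm g p' (T u)].
Proof.
move=> rg v0; have g0 := gnorm_gt0 p rg v0.
exists ((gnorm g p v)^-1 *: v); split=> [|U vU|].
- by rewrite (gnormZ _ _ _ rg) gtr0_norm ?invr_gt0// mulVf// gt_eqF.
- exact: memvZ.
- rewrite linearZ /= (gnormZ _ _ _ rg) gtr0_norm ?invr_gt0// mulrA mulfV ?mul1r//.
  by rewrite gt_eqF.
Qed.

(** The rates are abstracted into [a], an upper bound on [E1] and [E2], and [b], the inverse of a
    lower bound on [E3], so that the same statement serves [f] and its inverse. *)
Lemma domination_foliation (h : M -> M) (E1 E2 E3 : M -> {vspace V})
    (p1 p2 p3 : M -> {linear V -> V}) (g : M -> 'M[R]_n) (a b : M -> R) :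
  compact [set: M] -> C1_map A h ->
  [/\ subbundle A E1, subbundle A E2 & subbundle A E3] ->
  (forall p, is_split (E1 p) (E2 p) (E3 p) (p1 p) (p2 p) (p3 p)) ->
  (forall y w, [/\ w \in E1 y -> Df A h y w \in E1 (h y),
    w \in E2 y -> Df A h y w \in E2 (h y) & w \in E3 y -> Df A h y w \in E3 (h y)]) ->
  riemannian_metric A g -> (forall q, 0 < a q /\ 0 < b q) ->
  (forall q v, [/\ v \in E1 q -> gnorm g (h q) (Df A h q v) <= a q * gnorm g q v,
    v \in E2 q -> gnorm g (h q) (Df A h q v) <= a q * gnorm g q v &
    v \in E3 q -> gnorm g q v <= b q * gnorm g (h q) (Df A h q v)]) ->
  continuous a -> continuous b -> (forall q, b q * (a q * a q) < 1) ->
  lipschitz_distribution A (dsum E1 E2) ->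
  exists d, foliation R n d (leaf A (dsum E1 E2)) /\
    foliation_tangent A d (leaf A (dsum E1 E2)) (dsum E1 E2).
Proof.
move=> cM hC1 sE sp hE rg ab0 growth ca cb bunch [k lipE].
have cphi : continuous (fun q => b q * (a q * a q)).
  by move=> q; apply: cvgM; [exact: cb|apply: cvgM; exact: ca].
have [lam lam01 Hlam] := uniform_bound_lt1 cM cphi bunch.
have loc := local_integrability cM hC1 sE sp hE rg ab0 growth lam01 Hlam lipE.
have boxes p : exists2 B, chart_dom B p & leaf_box A (dsum E1 E2) k B.
  have [X [Q [r [_ Qu PE r0 [XE germ]]]]] := loc p.
  exact: (exists_leaf_box Qu PE r0 XE germ).
(* The inequality [k <= n] comes from a chart at a point; on an empty manifold dimension 0 is taken
   instead. *)
have [[p _]|noM] := pselect (exists p : M, True).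
  have [X [Q [r [kn _ _ _ _]]]] := loc p.
  by exists k; split; [exact: leaf_foliation|exact: leaf_foliation_tangent].
exists 0%N; split; last by move=> p; case: noM; exists p.
by split=> // p; case: noM; exists p.
Qed.

Lemma Df_cancel f f' z v : cancel f f' -> C1_map A f -> C1_map A f' ->
  Df A f' (f z) (Df A f z v) = v.
Proof.
move=> fK Cf Cf'; have fK' : f' \o f =1 id by [].
apply: etrans (Df_comp z v fK' Cf Cf') _.
have aux z' : z' = z -> 'd (loc A id z z') (chart_at A z z) v = v.
  by move=> ->; exact: (loc_id v (chart_at_dom A z)).
exact: aux (fK z).
Qed.

Lemma Df_invariant (E : M -> {vspace V}) f y w : invariant_distribution A f E ->
  w \in E y -> Df A f y w \in E (f y).
Proof. by move=> <- wE; have := memv_img (linfun (Df A f y)) wE; rewrite lfunE. Qed.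

Lemma Df_invariant_preimage (E : M -> {vspace V}) f z w : invariant_distribution A f E ->
  w \in E (f z) -> exists2 v, v \in E z & w = Df A f z v.
Proof.
by move=> <- /memv_imgP[v vE ->]; exists v => //; rewrite lfunE.
Qed.

Lemma Df_inv_invariant (E : M -> {vspace V}) f f' y w : cancel f f' -> cancel f' f ->
  C1_map A f -> C1_map A f' -> invariant_distribution A f E ->
  w \in E y -> Df A f' y w \in E (f' y).
Proof.
move=> fK f'K Cf Cf' fE; rewrite -[y]f'K; move: (f' y) => z.
move=> /(Df_invariant_preimage fE)[v vE ->].
by rewrite (Df_cancel z v fK Cf Cf') fK.
Qed.

Lemma dsum_invariant (E1 E2 : M -> {vspace V}) f :
  (forall y w, w \in E1 y -> Df A f y w \in E1 (f y)) ->
  (forall y w, w \in E2 y -> Df A f y w \in E2 (f y)) ->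
  forall y w, w \in dsum E1 E2 y -> Df A f y w \in dsum E1 E2 (f y).
Proof.
move=> h1 h2 y w /memv_addP[u u1 [v v2 ->]].
have -> : Df A f y (u + v) = Df A f y u + Df A f y v by exact: (linearD (Df A f y) u v).
by apply: memv_add; [exact: h1|exact: h2].
Qed.

End Foliations.

Theorem theorem1p18 (R : realType) (n : nat) (M : topologicalType)
    (A : smooth_atlas R n M)
    (hM : hausdorff_space M) (cM : compact [set: M])
    (f : M -> M) (Es Ec Eu : M -> {vspace 'rV[R]_n})
    (g : M -> 'M[R]_n) (nu nuh gam gamh : M -> R)
    (hf : partially_hyperbolic A f Es Ec Eu g nu nuh gam gamh)
    (hb : center_bunched nu nuh gam gamh)
    (hcs : lipschitz_distribution A (dsum Es Ec))
    (hcu : lipschitz_distribution A (dsum Eu Ec)) :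
  dynamically_coherent A f Es Ec Eu.
Proof.
have [[f' [fK f'K Cf Cf']] [[sEs sEc sEu] _ split_full [iEs iEc iEu]] rg
  [cnu cnuh cgam cgamh] rates] := hf.
have pos p : [/\ 0 < nu p, 0 < nuh p, 0 < gam p & 0 < gamh p] by have [] := rates p.
have ord p : [/\ nu p < gam p, gam p < (gamh p)^-1 & (gamh p)^-1 < (nuh p)^-1].
  by have [] := rates p.
(* Homogeneous form of the rates on unit vectors; the inequalities become weak in order to include
   [v = 0]. *)
have grow p v : [/\ v \in Es p -> gnorm g (f p) (Df A f p v) <= nu p * gnorm g p v,
    v \in Ec p -> gam p * gnorm g p v <= gnorm g (f p) (Df A f p v) /\
      gnorm g (f p) (Df A f p v) <= (gamh p)^-1 * gnorm g p v &
    v \in Eu p -> gnorm g p v <= nuh p * gnorm g (f p) (Df A f p v)].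
  have [->|v0] := eqVneq v 0.
    have -> : Df A f p 0 = 0 by exact: (linear0 (Df A f p)).
    by rewrite !(gnorm0 _ rg) !mulr0.
  have [u [u1 uU uE]] := unit_rescaling p (f p) (Df A f p) rg v0.
  have g0 := gnorm_gt0 p rg v0; have [_ n0 _ _] := pos p.
  have [_ _ _ /(_ u u1)[rs rc ru]] := rates p.
  rewrite uE; split=> [/uU/rs r|/uU/rc[r1 r2]|/uU/ru r].
  - by rewrite mulrC ler_pM2r// ltW.
  - by rewrite ![_ * gnorm g p v]mulrC !ler_pM2l// !ltW.
  - rewrite mulrCA ler_peMr ?(ltW g0)// mulrC -ler_pdivrMr// div1r.
    exact: ltW.
have split3 p : exists p123 : {linear 'rV[R]_n -> 'rV[R]_n} *
    {linear 'rV[R]_n -> 'rV[R]_n} * {linear 'rV[R]_n -> 'rV[R]_n},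
    is_split (Es p) (Ec p) (Eu p) p123.1.1 p123.1.2 p123.2.
  have [full dir] := split_full p; have [p1 [p2 [p3 sp]]] := exists_split full dir.
  by exists (p1, p2, p3).
have {split3}[pr spl] := choice split3.
have fE (E : M -> {vspace 'rV[R]_n}) : invariant_distribution A f E ->
    forall y w, w \in E y -> Df A f y w \in E (f y).
  by move=> iE y w; exact: Df_invariant.
have f'E (E : M -> {vspace 'rV[R]_n}) : invariant_distribution A f E ->
    forall y w, w \in E y -> Df A f' y w \in E (f' y).
  by move=> iE y w; exact: (Df_inv_invariant fK f'K Cf Cf' iE).
have cinv (phi : M -> R) : (forall p, 0 < phi p) -> continuous phi ->
    continuous (fun p => (phi p)^-1).
  by move=> phi0 cphi p; apply: cvgV; [rewrite gt_eqF|exact: cphi].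
have bunch (x y : R) : 0 < y -> x < y ^+ 2 -> x * (y^-1 * y^-1) < 1.
  by move=> y0; rewrite -invfM -expr2 ltr_pdivrMr ?exprn_gt0// mul1r.
split.
  have [||||||||d [F1 F2]] := @domination_foliation R n M A f Es Ec Eu (fun p => (pr p).1.1)
      (fun p => (pr p).1.2) (fun p => (pr p).2) g (fun p => (gamh p)^-1) nuh cM Cf _ spl _ rg.
  - by split.
  - by move=> y w; split; exact: fE.
  - by move=> q; have [_ ? _ ?] := pos q; rewrite invr_gt0.
  (* On [Es] the rate [nu] is below [gamh^-1], so the single rate [gamh^-1] serves both summands of
     the center-stable bundle. *)
  - move=> q v; have [growS growC growU] := grow q v; have [lt1 lt2 _] := ord q.
    split=> [/growS h|/growC[]//|//].
    by apply: le_trans h _; rewrite ler_wpM2r ?sqrtr_ge0// ltW// (lt_trans lt1).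
  - by apply: cinv => // p; have [] := pos p.
  - exact: cnuh.
  - by move=> q; have [_ _ _ ?] := pos q; apply: bunch => //; have [] := hb q.
  - exact: hcs.
  exists d, (leaf A (dsum Es Ec)); split=> //.
  by apply: (leaf_invariant fK f'K Cf Cf'); apply: dsum_invariant;
    [exact: fE|exact: fE|exact: f'E|exact: f'E].
(* For the inverse map [Eu] and [Es] exchange roles: [Es] becomes the expanded transverse bundle,
   and the rates at [q] are those of [f] at [f' q]. *)
have [||||||||d [F1 F2]] := @domination_foliation R n M A f' Eu Ec Es (fun p => (pr p).2)
    (fun p => (pr p).1.2) (fun p => (pr p).1.1) g (fun p => (gam (f' p))^-1) (fun p => nu (f' p))
    cM Cf' _ (fun p => is_split_rev (spl p)) _ rg.
- by split.
- by move=> y w; split; exact: f'E.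
- by move=> q; have [? _ ? _] := pos (f' q); rewrite invr_gt0.
- move=> q w; rewrite -[q]f'K; move: (f' q) => z; rewrite fK.
  have [n0 nh0 g0 _] := pos z; have [lt1 lt2 lt3] := ord z.
  have gv v : w = Df A f z v -> gnorm g z (Df A f' (f z) w) = gnorm g z v.
    by move=> wE; congr gnorm; exact: (etrans (congr1 _ wE) (Df_cancel z v fK Cf Cf')).
  have gw v : w = Df A f z v -> gnorm g (f z) (Df A f z v) = gnorm g (f z) w.
    by move=> wE; exact: congr1 (esym wE).
  split=> [/(Df_invariant_preimage iEu)|/(Df_invariant_preimage iEc)|
      /(Df_invariant_preimage iEs)] [v vE wE]; have [growS growC growU] := grow z v;
    rewrite (gv v wE); rewrite (gw v wE) in growS growC growU.
  + apply: le_trans (growU vE) _; rewrite ler_wpM2r ?sqrtr_ge0//.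
    by rewrite -[nuh z]invrK lef_pV2 ?posrE ?invr_gt0// ltW// (lt_trans lt2).
  + by rewrite mulrC ler_pdivlMr// mulrC; have [] := growC vE.
  + exact: growS.
- by apply: (cinv (gam \o f')) => [p|p]; [have [] := pos (f' p)|apply: continuous_comp; [exact: Cf'.1|exact: cgam]].
- by move=> p; apply: continuous_comp; [exact: Cf'.1|exact: cnu].
- by move=> q; have [_ _ ? _] := pos (f' q); apply: bunch => //; have [] := hb (f' q).
- exact: hcu.
exists d, (leaf A (dsum Eu Ec)); split=> //.
by apply: (leaf_invariant fK f'K Cf Cf'); apply: dsum_invariant;
  [exact: fE|exact: fE|exact: f'E|exact: f'E].
Qed.
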